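(* Let $A,B$ be finite nonempty sets, $g:\{s_1,s_2\}\times A\times B\to\mathbb{R}$, and $r,\lambda_1,\lambda_2>0$. Let $v:[0,1]\to\mathbb{R}$ be the limit value function of the associated Markov games with incomplete information on one side, and let $(p_k)$, $(\widetilde p_k)$ and $w$ be the sequences of points and the function generated by the algorithm described in the context. Then: \begin{enumerate} \item For every $k\ge 0$ such that $p_k<1$ we have $p_k<p_{k+1}$. \item For every $k\ge 0$ such that $\widetilde p_k>0$ we have $\widetilde p_{k+1}<\widetilde p_k$. \item The algorithm terminates after a finite number of iterations; that is, there is $k\ge 0$ such that $p_k=1$, and there is $k\ge 0$ such that $\widetilde p_k=0$. \item The function $w$ generated by the algorithm is the limit value function of the game, i.e., $w=v$. \end{enumerate}
   Context: **The game.** For a finite set $Y$, $\Delta(Y)$ is the set of probability distributions on $Y$. Let $S=\{s_1,s_2\}$, and let $A,B$ be finite nonempty action sets of Player 1 (maximizer) and Player 2 (minimizer). Given $\delta,\pi_1,\pi_2\in[0,1]$ and $p\in[0,1]$, the Markov game $(S,A,B,g,\delta,\pi_1,\pi_2,p)$ is played as follows. The initial state $s^1$ is $s_1$ with probability $p$ and $s_2$ with probability $1-p$. At each stage $k\ge1$ the players simultaneously choose actions $a^k\in A$, $b^k\in B$; then, independently of the actions, if $s^k=s_1$ the next state is $s_2$ with probability $\pi_1$ and $s_1$ with probability $1-\pi_1$, and if $s^k=s_2$ the next state is $s_1$ with probability $\pi_2$ and $s_2$ with probability $1-\pi_2$. Player 1 observes the current state, Player 2 does not observe states, both observe past actions,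 and there is perfect recall. A strategy of Player 1 is a sequence $\sigma=(\sigma_k)_{k\ge1}$, $\sigma_k:(S\times A\times B)^{k-1}\times S\to\Delta(A)$; a strategy of Player 2 is a sequence $\tau=(\tau_k)_{k\ge1}$, $\tau_k:(A\times B)^{k-1}\to\Delta(B)$. The payoff is $E_{p,\sigma,\tau}\big[\sum_{k\ge1}\delta(1-\delta)^{k-1}g(s^k,a^k,b^k)\big]$, and the value is $\max_\sigma\min_\tau=\min_\tau\max_\sigma$ of this payoff. For $n\in\{1,2,\dots\}$ let $v^{(n)}(p)$ be the value of the Markov game $(S,A,B,g,1-e^{-r/n},1-e^{-\lambda_1/n},1-e^{-\lambda_2/n},p)$. It is a known result that $v^{(n)}$ converges uniformly on $[0,1]$ as $n\to\infty$; its limit $v:[0,1]\to\mathbb{R}$ is called the limit value function. **Notation.** $p^*:=\frac{\lambda_2}{\lambda_1+\lambda_2}$, $\mu:=\frac{r}{\lambda_1+\lambda_2}$. For $x\in\Delta(A)$, $y\in\Delta(B)$, $g(s,x,y)=\sum_{a,b}g(s,a,b)x(a)y(b)$. For $p\in[0,1]$, $$u(p):=\max_{x\in\Delta(A)}\min_{y\in\Delta(B)}\big(p\,g(s_1,x,y)+(1-p)\,g(s_2,x,y)\big).$$ $\operatorname{cav}u$ is the smallest concave function on $[0,1]$ that is $\ge u$. **Auxiliary functions.** For a continuous real function $f$ on an interval and $p\in[p^*,1)$ in its domain, $$a(p,f):=\sup_{p'\in(p,1]}\frac{\mu(u(p')-f(p))}{p'-p^*+\mu(p'-p)},\qquad \rho(p,f):=\sup\Big\{p'\in(p,1]: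 a(p,f)=\frac{\mu(u(p')-f(p))}{p'-p^*+\mu(p'-p)}\Big\},$$ with the convention $\rho(p,f)=p$ if the set is empty. For $p\in(0,p^*]$ in the domain of $f$, $$\widetilde a(p,f):=\inf_{p'\in[0,p)}\frac{\mu(u(p')-f(p))}{p'-p^*+\mu(p'-p)},\qquad \widetilde\rho(p,f):=\inf\Big\{p'\in[0,p): \widetilde a(p,f)=\frac{\mu(u(p')-f(p))}{p'-p^*+\mu(p'-p)}\Big\},$$ with the convention $\widetilde\rho(p,f)=p$ if the set is empty. **The algorithm.** *Initialization.* $p_0:=\inf\{p\ge p^*:(\operatorname{cav}u)(p)=u(p)\}$ and $\widetilde p_0:=\sup\{p\le p^*:(\operatorname{cav}u)(p)=u(p)\}$. If $\widetilde p_0=p^*=p_0$, set $w(p^* ):=u(p^* )$. If $\widetilde p_0<p_0$, set for $p\in[\widetilde p_0,p_0]$ $$w(p):=u(\widetilde p_0)\frac{p_0(\mu+1)-p^*}{(p_0-\widetilde p_0)(\mu+1)}+u(p_0)\frac{p^*-\widetilde p_0(\mu+1)}{(p_0-\widetilde p_0)(\mu+1)}+p\mu\,\frac{u(p_0)-u(\widetilde p_0)}{(p_0-\widetilde p_0)(\mu+1)}.$$ *Increasing part.* Suppose $p_k$ is defined and $w$ is defined on $[p_0,p_k]$. If $p_k=1$, this part terminates. If $p_k<1$, let $\varphi_k:[p_k,1]\to\mathbb{R}$ be the continuous solution of $\varphi_k(p_k)=w(p_k)$, $\varphi_k'(p)=\frac{\mu(u(p)-\varphi_k(p))}{p-p^*}$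 for $p\in(p_k,1]$. - If $\rho(p_k,w)>p_k$: set $p_{k+1}:=\rho(p_k,w)$ and $w(p):=w(p_k)+(p-p_k)\,a(p_k,w)$ for $p\in(p_k,p_{k+1}]$. - Otherwise ($\rho(p_k,w)=p_k$): set $p_{k+1}:=\inf\{p\in(p_k,1):\rho(p,\varphi_k)>p\}$, with $\inf\emptyset=1$, and $w(p):=\varphi_k(p)$ for $p\in(p_k,p_{k+1}]$. Then increase $k$ by 1 and repeat. *Decreasing part.* Suppose $\widetilde p_k$ is defined and $w$ is defined on $[\widetilde p_k,\widetilde p_0]$. If $\widetilde p_k=0$, the algorithm terminates. If $\widetilde p_k>0$, let $\widetilde\varphi_k:[0,\widetilde p_k]\to\mathbb{R}$ be the continuous solution of $\widetilde\varphi_k(\widetilde p_k)=w(\widetilde p_k)$, $\widetilde\varphi_k'(p)=\frac{\mu(u(p)-\widetilde\varphi_k(p))}{p-p^*}$ for $p\in[0,\widetilde p_k)$. - If $\widetilde\rho(\widetilde p_k,w)<\widetilde p_k$: set $\widetilde p_{k+1}:=\widetilde\rho(\widetilde p_k,w)$ and $w(p):=w(\widetilde p_k)+(p-\widetilde p_k)\,\widetilde a(\widetilde p_k,w)$ for $p\in[\widetilde p_{k+1},\widetilde p_k)$. - Otherwise: set $\widetilde p_{k+1}:=\sup\{p\in(0,\widetilde p_k):\widetilde\rho(p,\widetilde\varphi_k)<p\}$, with $\sup\emptyset=0$, and $w(p):=\widetilde\varphi_k(p)$ for $p\in[\widetilde p_{k+1},\widetilde p_k)$. Then increase $k$ by 1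 and repeat. *)

(* Defs.v *)
From HB Require Import structures.
From mathcomp Require Import all_boot all_order all_algebra.
From mathcomp Require Import all_classical all_reals all_analysis.
Set Implicit Arguments.
Unset Strict Implicit.
Unset Printing Implicit Defensive.
Import Order.TTheory GRing.Theory Num.Theory.
Import numFieldNormedType.Exports.
Local Open Scope classical_set_scope.
Local Open Scope ring_scope.

Record dist (R : realType) (Y : finType) := Dist {
  dist_val :> Y -> R;
  dist_ge0 : forall y, 0 <= dist_val y;
  dist_sum1 : \sum_y dist_val y = 1 }.

(* [true] is s_1 and [false] is s_2. *)
Definition state : finType := bool.

(* A history is listed in chronological order; the component of index k of a
   strategy is its restriction to histories of length k - 1. Player 2 sees only
   the actions, Player 1 also the past and current states. *)
Definition strategy1 (R : realType) (A B : finType) :=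
  seq (state * A * B) -> state -> dist R A.
Definition strategy2 (R : realType) (A B : finType) :=
  seq (A * B) -> dist R B.

Section MarkovGame.
Context {R : realType} {A B : finType}.
Variables (g : state -> A -> B -> R) (delta pi1 pi2 p : R).

Definition init_prob (s : state) : R := if s then p else 1 - p.

Definition trans_prob (s s' : state) : R :=
  if s then (if s' then 1 - pi1 else pi1)
  else (if s' then pi2 else 1 - pi2).

Definition next_state_prob (h : seq (state * A * B)) (s : state) : R :=
  if h is m :: h' then trans_prob (last m h').1.1 s else init_prob s.

Definition public (m : state * A * B) : A * B := (m.1.2, m.2).

Definition play_prob (sigma : strategy1 R A B) (tau : strategy2 R A B)
    (k : nat) (h : k.-tuple (state * A * B)) : R :=
  \prod_(j < k)
    let: (s, a, b) := tnth h j in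
    let past := take j h in
    next_state_prob past s * sigma past s a * tau (map public past) b.

(* Expected payoff of stage k + 1. *)
Definition stage_payoff (sigma : strategy1 R A B) (tau : strategy2 R A B)
    (k : nat) : R :=
  \sum_(h : k.+1.-tuple (state * A * B))
    play_prob sigma tau h *
    (let: (s, a, b) := tnth h ord_max in g s a b).

(* The expectation of the discounted sum, taken term by term: the stage payoffs
   are bounded, so expectation and sum commute. *)
Definition payoff (sigma : strategy1 R A B) (tau : strategy2 R A B) : R :=
  limn (series (fun k => delta * (1 - delta) ^+ k * stage_payoff sigma tau k)).

Definition is_max (E : set R) (m : R) := E m /\ ubound E m.
Definition is_min (E : set R) (m : R) := E m /\ lbound E m.

Definition is_value (V : R) : Prop :=
  is_max [set m | exists sigma, is_min (range (payoff sigma)) m] V /\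
  is_min [set m | exists tau, is_max (range (payoff ^~ tau)) m] V.

End MarkovGame.

(* The value of index 0 is left unconstrained. *)
Definition is_limit_value {R : realType} {A B : finType}
    (g : state -> A -> B -> R) (r lambda1 lambda2 : R) (v : R -> R) : Prop :=
  exists vn : nat -> R -> R,
    (forall (n : nat) (p : R), (0 < n)%N -> 0 <= p <= 1 ->
      is_value g (1 - expR (- (r / n%:R))) (1 - expR (- (lambda1 / n%:R)))
        (1 - expR (- (lambda2 / n%:R))) p (vn n p)) /\
    {uniform `[0, 1], vn @ \oo --> v}.

Definition mixed_payoff {R : realType} {A B : finType}
    (g : state -> A -> B -> R) (s : state) (x : dist R A) (y : dist R B) : R :=
  \sum_a \sum_b g s a b * x a * y b.

(* The supremum and the infimum are attained, by compactness. *)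
Definition nonrevealing_value {R : realType} {A B : finType}
    (g : state -> A -> B -> R) (p : R) : R :=
  sup (range (fun x : dist R A => inf (range (fun y : dist R B =>
    p * mixed_payoff g true x y + (1 - p) * mixed_payoff g false x y)))).

Definition concave_function {R : realType} (D : set R) (f : R -> R) : Prop :=
  convex_function (D : set R^o) (fun x => - f x : R^o).

(* Pointwise infimum of the concave majorants on [0, 1]; it is itself concave. *)
Definition cav {R : realType} (f : R -> R) (p : R) : R :=
  inf [set h p | h in [set h : R -> R | concave_function `[0, 1] h /\
                        forall q, 0 <= q <= 1 -> f q <= h q]].

(* Derivative along D, hence one-sided at the endpoints of an interval D. *)
Definition has_derivative_within {R : realType} (D : set R) (f : R -> R)
    (p l : R) : Prop :=
  (f q - f p) / (q - p) @[q --> within D p^'] --> l.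

Section Algorithm.
Context {R : realType}.
Variables (u : R -> R) (pstar mu : R).

Definition slope (f : R -> R) (p p' : R) : R :=
  mu * (u p' - f p) / (p' - pstar + mu * (p' - p)).

Definition a_up (p : R) (f : R -> R) : R :=
  sup [set slope f p p' | p' in `]p, 1]].

Definition rho_up (p : R) (f : R -> R) : R :=
  let E := [set p' | p < p' <= 1 /\ a_up p f = slope f p p'] in
  if `[< E !=set0 >] then sup E else p.

Definition a_down (p : R) (f : R -> R) : R :=
  inf [set slope f p p' | p' in `[0, p[].

Definition rho_down (p : R) (f : R -> R) : R :=
  let E := [set p' | 0 <= p' < p /\ a_down p f = slope f p p'] in
  if `[< E !=set0 >] then inf E else p.

Definition ode_solution (D : set R) (q c : R) (phi : R -> R) : Prop :=
  [/\ {within D, continuous phi},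
      phi q = c &
      forall p, D p -> p != q ->
        has_derivative_within D phi p (mu * (u p - phi p) / (p - pstar))].

(* A solution is determined only on [q, 1], respectively [0, q]. *)
Definition phi_up (q c : R) : R -> R :=
  xget (fun=> 0) [set phi | ode_solution `[q, 1] q c phi].

Definition phi_down (q c : R) : R -> R :=
  xget (fun=> 0) [set phi | ode_solution `[0, q] q c phi].

Definition p_init : R :=
  inf [set p | pstar <= p <= 1 /\ cav u p = u p].

Definition pt_init : R :=
  sup [set p | 0 <= p <= pstar /\ cav u p = u p].

Definition w_init (p : R) : R :=
  if pt_init < p_init then
    u pt_init * ((p_init * (mu + 1) - pstar)
                 / ((p_init - pt_init) * (mu + 1)))
    + u p_init * ((pstar - pt_init * (mu + 1))
                  / ((p_init - pt_init) * (mu + 1)))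
    + p * mu * ((u p_init - u pt_init) / ((p_init - pt_init) * (mu + 1)))
  else u p.

(* The algorithm acts on pairs (p_k, w): the second component is meaningful
   only on the part of [0, 1] covered so far. A terminated part stays put. *)
Definition step_up (st : R * (R -> R)) : R * (R -> R) :=
  let: (p, w) := st in
  if p < 1 then
    if p < rho_up p w then
      (rho_up p w,
       fun q => if q <= p then w q else w p + (q - p) * a_up p w)
    else
      let phi := phi_up p (w p) in
      let E := [set q | p < q < 1 /\ q < rho_up q phi] in
      (if `[< E !=set0 >] then inf E else 1,
       fun q => if q <= p then w q else phi q)
  else st.

Definition step_down (st : R * (R -> R)) : R * (R -> R) :=
  let: (p, w) := st in
  if 0 < p then
    if rho_down p w < p then
      (rho_down p w,
       fun q => if p <= q then w q else w p + (q - p) * a_down p w)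
    else
      let phi := phi_down p (w p) in
      let E := [set q | 0 < q < p /\ rho_down q phi < q] in
      (if `[< E !=set0 >] then sup E else 0,
       fun q => if p <= q then w q else phi q)
  else st.

Definition run_up (k : nat) := iter k step_up (p_init, w_init).
Definition run_down (k : nat) := iter k step_down (pt_init, w_init).

Definition p_seq (k : nat) : R := (run_up k).1.
Definition pt_seq (k : nat) : R := (run_down k).1.

(* The value at q is read off any stage whose interval has reached q: later
   stages do not change it. *)
Definition w_alg (q : R) : R :=
  if pstar <= q then (run_up (xget 0%N [set k | q <= p_seq k])).2 q
  else (run_down (xget 0%N [set k | pt_seq k <= q])).2 q.

End Algorithm.

(* Main.v *)
(** The function [w] is concave with a supergradient [d] such that
    [d p * (p - ps) >= mu * (u p - w p)] everywhere, with equality at the points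
    reached by the differential equation or by the ends of the linear pieces;
    every other point lies on a segment between two such points along which [w]
    is affine. Along the drift of the belief towards [ps], the inequality says
    that [w] satisfies Bellman's inequality of Player 2 up to an error quadratic
    in the length of a stage, and the equality, combined with a splitting of the
    belief by Player 1, gives the reverse one. Player 2 does not know how much
    Player 1 reveals at a stage: a small strictly concave quadratic term added to
    [w] pays for the change of belief. Hence the discounted values converge
    to [w].

    The value [u] of the nonrevealing game is attained at vertices of a linear
    programme, so by Cramer's rule it is piecewise rational, and has finitely many
    pieces, each convex or strictly concave. On a strictly concave piece the
    differential equation keeps its slope above the chords of [u], and on a convex
    piece the slope test is decided at the end of the piece; so the test stays
    negative for a while and each step makes progress. A linear step crosses a
    point between two pieces, and a step of the differential equation that stops
    before 1 is followed by a linear one, which bounds the number of steps. The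
    decreasing part is the increasing one for [q |-> u (1 - q)]. *)

(* The point [ps] shapes much of the proof. The differential equation is singular there, so it does
   not fix a slope at [ps]; the slope comes from the supremum [a_up] or from the initial line, and
   several lemmas have a separate version at [ps]. The supergradient may jump there, but its product
   with [x - ps] is Lipschitz, and this product is what the estimates use. Since [u] has kinks,
   convexity is expressed by chords and the equation in mean value form; no derivative of [u] enters
   the analysis of the algorithm. On the side of the game, beliefs are kept unnormalised and
   functions of the belief are extended homogeneously, so that no conditional probability given a
   null history appears. With stages of length [h], the error per stage is quadratic in [h] and
   [delta] is of order [h], which leaves an error of order [h] in the payoff. The coefficient [c] of
   the quadratic term is fixed first, large enough to make the cost of revelation small, and [h] is
   chosen afterwards. *)
Require Import Defs.
From HB Require Import structures.
From mathcomp Require Import all_boot all_order all_algebra.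
From mathcomp Require Import all_classical all_reals all_analysis.
From mathcomp Require Import ring lra.
Set Implicit Arguments.
Unset Strict Implicit.
Unset Printing Implicit Defensive.
Import Order.TTheory GRing.Theory Num.Theory.
Import numFieldNormedType.Exports.
Local Open Scope classical_set_scope.
Local Open Scope ring_scope.

(** * Payoffs without revelation of the state *)

Section MatrixGame.
Context {R : realType} {A B : finType}.
Variable g : state -> A -> B -> R.

Definition avg_payoff (q : R) (a : A) (b : B) : R :=
  q * g true a b + (1 - q) * g false a b.

(** [x] is any vector, not only a distribution, because the linear programme below evaluates it
    along directions too. *)
Definition pure_reply_payoff (q : R) (x : A -> R) (b : B) : R :=
  \sum_a avg_payoff q a b * x a.

Definition payoff_bound : R := \sum_s \sum_a \sum_b `|g s a b|.

Lemma payoff_bound_ge0 : 0 <= payoff_bound.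
Proof. by do 3!(apply: sumr_ge0 => ? _). Qed.

Lemma ler_payoff_bound s a b : `|g s a b| <= payoff_bound.
Proof.
rewrite /payoff_bound (bigD1 s)//= (bigD1 a)//= (bigD1 b)//= -!addrA lerDl.
by rewrite !addr_ge0//; do 3?(apply: sumr_ge0 => ? _).
Qed.

Lemma mixed_payoff_pure (q : R) (x : dist R A) (y : dist R B) :
  q * mixed_payoff g true x y + (1 - q) * mixed_payoff g false x y =
  \sum_b y b * pure_reply_payoff q x b.
Proof.
rewrite /mixed_payoff !mulr_sumr -big_split/=.
under [RHS]eq_bigr do rewrite mulr_sumr.
rewrite exchange_big; apply: eq_bigr => a _ /=.
rewrite !mulr_sumr -big_split/=; apply: eq_bigr => b _.
by rewrite /avg_payoff; ring.
Qed.

Lemma dirac_dist_subproof (Y : finType) (y0 : Y) :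
  \sum_y ((y == y0)%:R : R) = 1.
Proof. by rewrite (bigD1 y0)//= eqxx big1 ?addr0// => i /negbTE->. Qed.

Definition dirac_dist (Y : finType) (y0 : Y) : dist R Y :=
  @Dist R Y (fun y => (y == y0)%:R) (fun y => ler0n _ _)
    (dirac_dist_subproof y0).

Lemma sum_dirac (Y : finType) (y0 : Y) (f : Y -> R) :
  \sum_y dirac_dist y0 y * f y = f y0.
Proof.
rewrite (bigD1 y0)//= eqxx mul1r big1 ?addr0// => i /negbTE->.
by rewrite mul0r.
Qed.

Lemma avg_payoff_lipschitz q q' a b :
  `|avg_payoff q a b - avg_payoff q' a b| <= 2 * payoff_bound * `|q - q'|.
Proof.
have -> : avg_payoff q a b - avg_payoff q' a b =
   (g true a b - g false a b) * (q - q').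
  by rewrite /avg_payoff; ring.
rewrite normrM ler_wpM2r// (le_trans (ler_normB _ _))//.
by rewrite mulrDl mul1r lerD// ler_payoff_bound.
Qed.

Lemma pure_reply_payoff_lipschitz q q' (x : dist R A) b :
  `|pure_reply_payoff q x b - pure_reply_payoff q' x b| <=
  2 * payoff_bound * `|q - q'|.
Proof.
rewrite /pure_reply_payoff -sumrB.
under eq_bigr do rewrite -mulrBl.
apply: (le_trans (ler_norm_sum _ _ _)).
rewrite -[leRHS]mulr1 -[X in _ <= _ * X](dist_sum1 x) mulr_sumr; apply: ler_sum => a _.
rewrite normrM (ger0_norm (dist_ge0 x a)) ler_wpM2r ?dist_ge0//.
exact: avg_payoff_lipschitz.
Qed.

Hypotheses (hA : (0 < #|A|)%N) (hB : (0 < #|B|)%N).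
Let u := nonrevealing_value g.

Let a0 : A := enum_val (Ordinal hA).
Let b0 : B := enum_val (Ordinal hB).

Lemma reply_exists (q : R) (x : A -> R) :
  exists b, forall b', pure_reply_payoff q x b <= pure_reply_payoff q x b'.
Proof.
by case: (arg_minP (pure_reply_payoff q x) (erefl : predT b0)) => b _ hb; exists b => b'; exact: hb.
Qed.

(** The payoff is linear in [y], hence an average of the payoffs against pure actions, and a best
    pure action attains the infimum. *)
Lemma inf_mixed_reply (q : R) (x : dist R A) b :
  (forall b', pure_reply_payoff q x b <= pure_reply_payoff q x b') ->
  inf (range (fun y : dist R B => q * mixed_payoff g true x y +
     (1 - q) * mixed_payoff g false x y)) = pure_reply_payoff q x b.
Proof.
move=> hb; apply/eqP; rewrite eq_le; apply/andP; split.
- apply: ge_inf.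
    exists (pure_reply_payoff q x b) => _ [y _ <-].
    rewrite mixed_payoff_pure -[leLHS]mul1r -(dist_sum1 y) mulr_suml.
    by apply: ler_sum => b' _; rewrite ler_wpM2l ?dist_ge0.
  by exists (dirac_dist b) => //; rewrite mixed_payoff_pure sum_dirac.
- apply: lb_le_inf; first by eexists; exists (dirac_dist b).
  move=> _ [y _ <-].
  rewrite mixed_payoff_pure -[leLHS]mul1r -(dist_sum1 y) mulr_suml.
  by apply: ler_sum => b' _; rewrite ler_wpM2l ?dist_ge0.
Qed.

Lemma pure_reply_payoff_le_bound q (x : dist R A) b :
  pure_reply_payoff q x b <= `|q| * payoff_bound + `|1 - q| * payoff_bound.
Proof.
apply: (le_trans (ler_norm _)); apply: (le_trans (ler_norm_sum _ _ _)).
rewrite -[leRHS]mulr1 -[X in _ <= _ * X](dist_sum1 x) mulr_sumr; apply: ler_sum => a _.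
rewrite normrM (ger0_norm (dist_ge0 x a)) ler_wpM2r ?dist_ge0//.
apply: (le_trans (ler_normD _ _)); rewrite !normrM lerD// ler_wpM2l//;
  exact: ler_payoff_bound.
Qed.

Lemma has_sup_nonrevealing q : has_sup (range (fun x : dist R A =>
   inf (range (fun y : dist R B => q * mixed_payoff g true x y +
     (1 - q) * mixed_payoff g false x y)))).
Proof.
split; first by eexists; exists (dirac_dist a0).
exists (`|q| * payoff_bound + `|1 - q| * payoff_bound) => _ [x _ <-].
have [b hb] := reply_exists q x; rewrite (inf_mixed_reply hb).
exact: pure_reply_payoff_le_bound.
Qed.

Lemma nonrevealing_value_reply q (x : dist R A) :
  exists b, pure_reply_payoff q x b <= u q.
Proof.
have [b hb] := reply_exists q x; exists b; rewrite -(inf_mixed_reply hb).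
apply: ub_le_sup; last by exists x.
by have [] := has_sup_nonrevealing q.
Qed.

Lemma nonrevealing_value_ge q (x : dist R A) t :
  (forall b, t <= pure_reply_payoff q x b) -> t <= u q.
Proof.
by move=> ht; have [b] := nonrevealing_value_reply q x; exact: le_trans.
Qed.

(** Strategies optimal up to [e] come directly from the supremum and suffice everywhere below, so
    the compactness of the simplex is never invoked. *)
Lemma nonrevealing_value_approx q e : 0 < e ->
  exists x : dist R A, forall b, u q - e < pure_reply_payoff q x b.
Proof.
move=> e0; have [_ [x _ <-]] := sup_adherent e0 (has_sup_nonrevealing q).
have [b hb] := reply_exists q x; rewrite (inf_mixed_reply hb) => h.
by exists x => b'; exact: lt_le_trans (hb b').
Qed.

Lemma nonrevealing_value_lipschitz q q' :
  `|u q - u q'| <= 2 * payoff_bound * `|q - q'|.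
Proof.
wlog suff H : q q' / u q - u q' <= 2 * payoff_bound * `|q - q'|.
  by rewrite ler_norml H andbT lerNl opprB distrC H.
apply/ler_addgt0Pr => e e0.
have [x hx] := nonrevealing_value_approx q e0.
suff: u q - e - 2 * payoff_bound * `|q - q'| <= u q' by lra.
apply: (nonrevealing_value_ge (x := x)) => b.
have := pure_reply_payoff_lipschitz q q' x b.
by rewrite ler_norml => /andP[_ h]; have := hx b; lra.
Qed.

End MatrixGame.

(** * Vertices of the linear programme and rational formulas for the value *)

Section MatrixGameRational.
Context {R : realType} {A B : finType}.
Variable g : state -> A -> B -> R.
Hypotheses (hA : (0 < #|A|)%N) (hB : (0 < #|B|)%N).

(* The linear programme behind the matrix game: the unknown [z] lists a mixed
   action of Player 1 and, at [None], a guaranteed payoff. The constraints say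
   that actions have nonnegative weight, that the payoff is guaranteed against
   every column, and, at [None], that the weights add up to 1. *)
Let unknown : finType := option A.
Let constraint : finType := option (A + B).

Definition lp_coef (c : constraint) (o : unknown) : {poly R} :=
  match c, o with
  | None, None => 0
  | None, Some _ => 1
  | Some (inl _), None => 0
  | Some (inl a), Some a' => (a == a')%:R
  | Some (inr _), None => -1
  | Some (inr b), Some a =>
      'X * (g true a b)%:P + (1 - 'X) * (g false a b)%:P
  end.

Definition lp_form (q : R) (c : constraint) (z : unknown -> R) : R :=
  \sum_o (lp_coef c o).[q] * z o.

Lemma lp_formDZ q c (z d : unknown -> R) t :
  lp_form q c (fun o => z o + t * d o) = lp_form q c z + t * lp_form q c d.
Proof.
rewrite /lp_form mulr_sumr -big_split/=.
by apply: eq_bigr => o _; ring.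
Qed.

Lemma sum_option (F : unknown -> R) : \sum_o F o = F None + \sum_a F (Some a).
Proof.
rewrite (bigD1 None)//=; congr (_ + _).
rewrite (reindex_omap Some id)/=; last by case.
by apply: eq_bigl => a; rewrite eqxx.
Qed.

Lemma lp_form_total q z : lp_form q None z = \sum_a z (Some a).
Proof.
rewrite /lp_form sum_option /= horner0 mul0r add0r.
by apply: eq_bigr => a _; rewrite hornerC mul1r.
Qed.

Lemma lp_form_weight q a z : lp_form q (Some (inl a)) z = z (Some a).
Proof.
rewrite /lp_form sum_option /= horner0 mul0r add0r (bigD1 a)//= eqxx hornerC.
rewrite mul1r big1 ?addr0// => a' /negbTE; rewrite eq_sym => ->.
by rewrite hornerC mul0r.
Qed.

Lemma lp_form_payoff q b z : lp_form q (Some (inr b)) z =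
  pure_reply_payoff g q (fun a => z (Some a)) b - z None.
Proof.
rewrite /lp_form sum_option /= addrC hornerN hornerC mulN1r; congr (_ - _).
apply: eq_bigr => a _; congr (_ * _).
by rewrite !hornerE.
Qed.

Definition lp_feasible (q : R) (z : unknown -> R) : Prop :=
  lp_form q None z = 1 /\ forall c, 0 <= lp_form q (Some c) z.

Definition lp_tight (q : R) (z : unknown -> R) (c : constraint) : bool :=
  if c is Some _ then lp_form q c z == 0 else true.

Definition lp_vertex (q : R) (z : unknown -> R) : Prop :=
  forall d : unknown -> R, (forall c, lp_tight q z c -> lp_form q c d = 0) ->
    forall o, d o = 0.

(** No feasible ray raises the payoff: if no constraint decreased along [d], the weights would be
    nonnegative with sum 0, hence all 0, and then a positive [d None] would decrease every payoff
    constraint. *)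
Lemma lp_escape q (d : unknown -> R) : lp_form q None d = 0 ->
  0 <= d None -> (exists o, d o != 0) -> exists c, lp_form q (Some c) d < 0.
Proof.
move=> d1 d0 [w dn0]; apply: contrapT => hn.
have hge c : 0 <= lp_form q (Some c) d.
  by rewrite leNgt; apply/negP => h; apply: hn; exists c.
have dA a : d (Some a) = 0.
  have := d1; rewrite lp_form_total => /eqP.
  rewrite psumr_eq0; last first.
    by move=> a' _; have := hge (inl a'); rewrite lp_form_weight.
  by move/allP => /(_ a (mem_index_enum _))/eqP.
have dN : 0 < d None.
  by case: w dn0 => [a|]; [rewrite dA eqxx|rewrite lt_neqAle d0 eq_sym andbT].
have b : B by exact: (enum_val (Ordinal hB)).
have := hge (inr b); rewrite lp_form_payoff /pure_reply_payoff.
by rewrite big1 ?sub0r ?oppr_ge0 ?leNgt ?dN// => a _; rewrite dA mulr0.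
Qed.

(** As long as the tight constraints leave a free direction, moving along it keeps them tight until
    one more becomes tight. The induction is on the number of slack constraints. *)
Lemma lp_vertex_above q z : lp_feasible q z ->
  exists z', [/\ lp_feasible q z', lp_vertex q z' & z None <= z' None].
Proof.
have [k] := ubnP #|[pred c | ~~ lp_tight q z c]|.
elim: k z => // k IH z hk [z1 z0].
have [hv|] := pselect (lp_vertex q z); first by exists z.
move=> /existsNP[d] /not_implyP[dt /existsNP[w /eqP dn0]].
(* The opposite of a free direction is free as well, so the guaranteed payoff may be assumed not to
   decrease. *)
wlog d0 : d dt w dn0 / 0 <= d None.
  move=> W; have [d0|d0] := leP 0 (d None); first exact: (W d dt w dn0).
  apply: (W (fun o => - d o) _ w); [|by rewrite oppr_eq0|by rewrite oppr_ge0 ltW].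
  move=> c /dt h; transitivity (- lp_form q c d); last by rewrite h oppr0.
  rewrite /lp_form -sumrN.
  by apply: eq_bigr => i _; rewrite mulrN.
have d1 : lp_form q None d = 0 by exact: dt.
have [c0 hc0] : exists c, lp_form q (Some c) d < 0.
  by apply: lp_escape => //; exists w.
(* The ratio test: [t] is the first time at which a decreasing constraint reaches 0. *)
have [/= c hc hmin] := arg_minP (fun c => lp_form q (Some c) z / - lp_form q (Some c) d)
  (hc0 : (fun c => lp_form q (Some c) d < 0) c0).
set t := lp_form q (Some c) z / - lp_form q (Some c) d in hmin.
have t0 : 0 <= t by rewrite divr_ge0// oppr_ge0 ltW.
pose z' o := z o + t * d o.
have tight' c' : lp_tight q z c' -> lp_tight q z' c'.
  case: c' => [c'|//] /= h; rewrite lp_formDZ (dt (Some c') h).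
  by rewrite mulr0 addr0.
have ntc : ~~ lp_tight q z (Some c).
  by apply/negP => h; move: hc; rewrite (dt (Some c) h) ltxx.
have tc : lp_tight q z' (Some c).
  rewrite /= lp_formDZ /t; apply/eqP; field.
  by rewrite lt_eqF.
have [] := IH z'.
- move: hk; rewrite ltnS; apply: leq_trans; apply: proper_card.
  apply/properP; split.
    by apply/fintype.subsetP => c'; rewrite !inE; apply: contra; exact: tight'.
  by exists (Some c); rewrite !inE ?ntc ?tc.
- split; first by rewrite lp_formDZ d1 mulr0 addr0.
  move=> c'; rewrite lp_formDZ.
  have [dn|dn] := leP 0 (lp_form q (Some c') d).
    by rewrite addr_ge0// mulr_ge0.
  have := hmin c' dn; rewrite ler_pdivlMr ?oppr_gt0//.
  by rewrite mulrN => h; rewrite -lerBlDr sub0r.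
- move=> z'' [f' v' le']; exists z''; split => //.
  by apply: le_trans le'; rewrite /z' lerDl mulr_ge0.
Qed.

Let N := #|unknown|.

Definition basis_mx (f : {ffun 'I_N -> constraint}) : 'M[{poly R}]_N :=
  \matrix_(i, j) lp_coef (f i) (enum_val j).

Definition basis_rhs (f : {ffun 'I_N -> constraint}) : 'cV[{poly R}]_N :=
  \col_i (f i == None)%:R.

(** Cramer's rule with the adjugate: [basis_num f / basis_den f] is the payoff coordinate of the
    solution of the system chosen by [f], and both are polynomials in the belief. *)
Definition basis_num f : {poly R} :=
  (\adj (basis_mx f) *m basis_rhs f) (enum_rank None) ord0.

Definition basis_den f : {poly R} := \det (basis_mx f).

Lemma lp_vertex_value q z : lp_feasible q z -> lp_vertex q z ->
  exists f, (basis_den f).[q] != 0 /\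
    z None * (basis_den f).[q] = (basis_num f).[q].
Proof.
move=> [z1 z0] vz.
(* Rows of slack constraints are replaced by 0. The vertex condition gives full column rank, and an
   invertible selection of rows then consists of tight constraints only. *)
pose T : 'M[R]_(#|constraint|, N) := \matrix_(i, j)
  if lp_tight q z (enum_val i) then (lp_coef (enum_val i) (enum_val j)).[q] else 0.
have Tfull : row_full T.
  rewrite /row_full -mxrank_tr; apply: (@inj_row_free _ _ _ T^T) => v vT.
  apply/rowP => j; rewrite mxE -[j]enum_valK.
  apply: (vz (fun o => v 0 (enum_rank o))) => c tc.
  have := congr1 (fun M : 'rV_ _ => M 0 (enum_rank c)) vT.
  rewrite !mxE => <-; rewrite /lp_form.
  rewrite (reindex_onto enum_val enum_rank)/=; last first.
    by move=> o _; exact: enum_rankK.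
  rewrite (eq_bigl predT); last by move=> i; rewrite enum_valK eqxx.
  apply: eq_bigr => i _; rewrite !mxE !enum_rankK enum_valK.
  by rewrite tc mulrC.
pose h := fullrankfun Tfull.
pose f := [ffun i => enum_val (h i)] : {ffun 'I_N -> constraint}.
have unitT := fullrowsub_unit Tfull.
have tf i : lp_tight q z (f i).
  apply/negPn/negP => /negbTE nt.
  have := unitT; rewrite unitmxE unitfE => /eqP; apply.
  rewrite (expand_det_row _ i) big1// => j _.
  by rewrite !mxE; move: nt; rewrite ffunE => ->; rewrite mul0r.
have Tf : rowsub h T = map_mx (horner_eval q) (basis_mx f).
  apply/matrixP => i j; rewrite !mxE.
  by have := tf i; rewrite ffunE => ->; rewrite /horner_eval.
have dE : (basis_den f).[q] = \det (rowsub h T).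
  by rewrite Tf det_map_mx.
exists f; split; first by move: unitT; rewrite unitmxE unitfE dE.
pose zc : 'cV[R]_N := \col_j z (enum_val j).
have Tz : rowsub h T *m zc = map_mx (horner_eval q) (basis_rhs f).
  apply/colP => i; rewrite Tf !mxE.
  transitivity (lp_form q (f i) z).
    rewrite /lp_form [RHS](reindex_onto enum_val enum_rank)/=; last first.
      by move=> o _; exact: enum_rankK.
    rewrite [RHS](eq_bigl predT); last by move=> k; rewrite enum_valK eqxx.
    by apply: eq_bigr => k _; rewrite !mxE.
  rewrite /horner_eval; have := tf i; case: (f i) => [c /= /eqP->|_].
    by rewrite horner0.
  by rewrite z1 eqxx hornerC.
have /(congr1 (fun M : 'cV_ _ => M (enum_rank None) ord0)) :
   \det (rowsub h T) *: zc =
   map_mx (horner_eval q) (\adj (basis_mx f) *m basis_rhs f).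
  rewrite map_mxM -Tz map_mx_adj -Tf mulmxA mul_adj_mx.
  by rewrite mul_scalar_mx.
by rewrite dE mulrC mxE mxE enum_rankK => ->; rewrite mxE.
Qed.

Lemma finite_gap (I : finType) (P : pred I) (val : I -> R) (u : R) :
  exists2 e, 0 < e & forall i, P i -> val i < u -> val i <= u - e.
Proof.
have [[i0 /andP[P0 h0]]|hn] := pselect (exists i, P i && (val i < u)); last first.
  by exists 1 => // i Pi hi; exfalso; apply: hn; exists i; rewrite Pi.
have [/= i /andP[Pi hi] hmax] := arg_maxP val
  (introT andP (conj P0 h0) : (fun i => P i && (val i < u)) i0).
exists (u - val i); first by rewrite subr_gt0.
by move=> j Pj hj; rewrite subKr; apply: hmax; rewrite Pj.
Qed.

(** One finite list serves all beliefs; the entry that gives the value depends on [q]. No optimal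
    strategy is needed: the finitely many candidates below [u] lie at least [e] below it, so a
    vertex above a strategy worth [u - e / 2] has value exactly [u]. *)
Lemma nonrevealing_value_rational : exists s : seq ({poly R} * {poly R}),
  forall q, exists2 nd, nd \in s &
    nd.2.[q] != 0 /\ nonrevealing_value g q * nd.2.[q] = nd.1.[q].
Proof.
exists [seq (basis_num f, basis_den f) | f <- enum {ffun 'I_N -> constraint}].
move=> q; set u := nonrevealing_value g q.
pose val f := (basis_num f).[q] / (basis_den f).[q].
have [e e0 he] := finite_gap (fun f => (basis_den f).[q] != 0) val u.
have [x hx] := nonrevealing_value_approx g hA hB q (divr_gt0 e0 (ltr0n R 2)).
pose z (o : unknown) := if o is Some a then x a else u - e / 2.
have fz : lp_feasible q z.
  split; first by rewrite lp_form_total dist_sum1.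
  case=> [a|b]; first by rewrite lp_form_weight dist_ge0.
  by rewrite lp_form_payoff subr_ge0 ltW.
have [z' [[z1 z0] vz' zz']] := lp_vertex_above fz.
have [f [f0 fE]] := lp_vertex_value (conj z1 z0) vz'.
have x'0 a : 0 <= z' (Some a) by have := z0 (inl a); rewrite lp_form_weight.
have x'1 : \sum_a z' (Some a) = 1 by rewrite -z1 lp_form_total.
have le_u : z' None <= u.
  apply: (nonrevealing_value_ge hA hB (x := Dist x'0 x'1)) => b.
  by have := z0 (inr b); rewrite lp_form_payoff subr_ge0.
have valE : val f = z' None by rewrite /val -fE mulfK.
exists (basis_num f, basis_den f).
  by apply/mapP; exists f => //; rewrite mem_enum.
split => //=; rewrite -fE; congr (_ * _).
apply/eqP; rewrite eq_le le_u andbT leNgt; apply/negP => lt_u.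
have := he f f0; rewrite valE => /(_ lt_u) lt_e.
move: zz'; rewrite /z => h1; move: e0 lt_e h1; lra.
Qed.

End MatrixGameRational.

(** * Piecewise convex or strictly concave functions *)

Section Pieces.
Context {R : realType}.

Definition chord_convex (f : R -> R) (c d : R) : Prop :=
  forall s p t, c <= s -> s < p -> p < t -> t <= d ->
    (f p - f s) * (t - p) <= (f t - f p) * (p - s).

Definition chord_sconcave (f : R -> R) (c d : R) : Prop :=
  forall s p t, c <= s -> s < p -> p < t -> t <= d ->
    (f t - f p) * (p - s) < (f p - f s) * (t - p).

(** The convex case is weak and the concave one strict, so affine pieces count as convex. *)
Definition breakpoints (f : R -> R) (cs : seq R) : Prop :=
  forall c d, c < d -> (forall x, x \in cs -> ~~ (c < x < d)) ->
    chord_convex f c d \/ chord_sconcave f c d.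

Lemma lipschitz_continuous (f : R -> R) (L : R) :
  (forall p q, `|f p - f q| <= L * `|p - q|) -> continuous f.
Proof.
move=> fL x; apply/cvgrPdist_le => e e0; near=> y.
rewrite (le_trans (fL x y))//.
have L1 : 0 < `|L| + 1 by rewrite ltr_wpDl.
apply: (@le_trans _ _ ((`|L| + 1) * `|x - y|)).
  by rewrite ler_wpM2r// (le_trans (ler_norm _))// lerDl.
rewrite mulrC -ler_pdivlMr//.
near: y; apply: (@cvgr_dist_le _ _ _ _ _ id) => //.
by rewrite divr_gt0.
Unshelve. all: by end_near. Qed.

Lemma poly_finite_roots (p : {poly R}) : p != 0 ->
  exists s : seq R, forall x, root p x -> x \in s.
Proof.
have [n] := ubnP (size p); elim: n p => // n IH p hn p0.
have [[a pa]|hno] := pselect (exists a, root p a); last first.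
  by exists [::] => x px; exfalso; apply: hno; exists x.
have /factor_theorem[q pE] := pa.
have q0 : q != 0 by apply: contraNneq p0 => q0; rewrite pE q0 mul0r.
have [|s hs] := IH q _ q0.
  by move: hn; rewrite pE size_Mmonic ?monicXsubC// size_XsubC addn2.
exists (a :: s) => x; rewrite pE rootM root_XsubC inE => /orP[/hs->|->//].
by rewrite orbT.
Qed.

Lemma poly_const_sign (p : {poly R}) (c d : R) :
  (forall x, c < x < d -> p.[x] != 0) ->
  (forall x, c < x < d -> 0 < p.[x]) \/ (forall x, c < x < d -> p.[x] < 0).
Proof.
move=> p0; apply: contrapT => /not_orP[/existsNP[x /not_implyP[xcd /negP px]]].
move=> /existsNP[y /not_implyP[ycd /negP py]].
have {}px : p.[x] < 0 by rewrite lt_neqAle p0//= leNgt.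
have {}py : 0 < p.[y] by rewrite lt_neqAle eq_sym p0//= leNgt.
wlog xy : p p0 x y xcd ycd px py / x <= y.
  move=> W; have [xy|yx] := leP x y; first exact: (W p p0 x y).
  apply: (W (- p) _ y x) => //; rewrite ?hornerN ?oppr_lt0 ?oppr_gt0//.
  - by move=> z /p0; rewrite hornerN oppr_eq0.
  - exact: ltW.
have [] := @IVT R (horner p) x y 0 xy.
- by apply: continuous_subspaceT; exact: continuous_horner.
- by rewrite ge_min le_max (ltW px) (ltW py) orbT.
move=> z; rewrite in_itv/= => /andP[xz zy] /eqP; apply/negP; apply: p0.
by move: xcd ycd => /andP[cx _] /andP[_ yd]; rewrite (lt_le_trans cx)// (le_lt_trans zy).
Qed.

Lemma chord_convex_deriv (f df : R -> R) (c d : R) :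
  {within `[c, d], continuous f} ->
  (forall x, c < x < d -> is_derive x 1 f (df x)) ->
  (forall x y, c < x -> x <= y -> y < d -> df x <= df y) ->
  chord_convex f c d.
Proof.
move=> fc fd dfm s p t cs sp pt td.
have itvW a b : c <= a -> b <= d -> {within `[a, b], continuous f}.
  move=> ca bd; apply: continuous_subspaceW fc.
  by apply: subset_itv; rewrite ?bnd_simp.
have [z||x /[!in_itv]/= /andP[sx xp] ->] := MVT (f := f) (df := df) sp.
- rewrite in_itv/= => /andP[? ?]; apply: fd; lra.
- by apply: itvW => //; lra.
have [z||y /[!in_itv]/= /andP[py yt] ->] := MVT (f := f) (df := df) pt.
- rewrite in_itv/= => /andP[? ?]; apply: fd; lra.
- by apply: itvW => //; lra.
rewrite -!mulrA [(t - p) * _]mulrC ler_wpM2r//.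
  by rewrite mulr_ge0 ?subr_ge0 ?ltW.
by apply: dfm; lra.
Qed.

Lemma chord_sconcave_deriv (f df : R -> R) (c d : R) :
  {within `[c, d], continuous f} ->
  (forall x, c < x < d -> is_derive x 1 f (df x)) ->
  (forall x y, c < x -> x < y -> y < d -> df y < df x) ->
  chord_sconcave f c d.
Proof.
move=> fc fd dfm s p t cs sp pt td.
have itvW a b : c <= a -> b <= d -> {within `[a, b], continuous f}.
  move=> ca bd; apply: continuous_subspaceW fc.
  by apply: subset_itv; rewrite ?bnd_simp.
have [z||x /[!in_itv]/= /andP[sx xp] ->] := MVT (f := f) (df := df) sp.
- rewrite in_itv/= => /andP[? ?]; apply: fd; lra.
- by apply: itvW => //; lra.
have [z||y /[!in_itv]/= /andP[py yt] ->] := MVT (f := f) (df := df) pt.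
- rewrite in_itv/= => /andP[? ?]; apply: fd; lra.
- by apply: itvW => //; lra.
rewrite -!mulrA [(t - p) * _]mulrC ltr_pM2r//; last by rewrite mulr_gt0 ?subr_gt0.
by apply: dfm; lra.
Qed.

Let numden := ({poly R} * {poly R})%type.

Definition deriv_num (nd : numden) : {poly R} :=
  nd.1^`() * nd.2 - nd.1 * nd.2^`().

(** The last factor [nd.2] makes the denominator of the second derivative [nd.2 ^+ 4], an even
    power, so this numerator alone decides the sign. *)
Definition deriv2_num (nd : numden) : {poly R} :=
  ((deriv_num nd)^`() * nd.2 - 2 * deriv_num nd * nd.2^`()) * nd.2.

(** Numerator of the difference of two quotients: it is the zero polynomial exactly when they
    coincide as rational functions (with nonzero denominators), and otherwise its roots contain all
    their meeting points. *)
Definition cross (nd nd' : numden) : {poly R} := nd.1 * nd'.2 - nd'.1 * nd.2.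

Lemma is_derive_quotient (n e : {poly R}) x : e.[x] != 0 ->
  is_derive x 1 (fun y => n.[y] / e.[y])
    ((deriv_num (n, e)).[x] / e.[x] ^+ 2).
Proof.
move=> e0.
have dV := is_deriveV e0 (is_derive_poly e x).
apply: (is_derive_eq (is_deriveM (is_derive_poly n x) dV)).
rewrite /deriv_num/= !hornerE /GRing.scale/=; field.
by rewrite e0.
Qed.

Lemma is_derive_quotient2 (n e : {poly R}) x : e.[x] != 0 ->
  is_derive x 1 (fun y => (deriv_num (n, e)).[y] / e.[y] ^+ 2)
    ((deriv2_num (n, e)).[x] / e.[x] ^+ 4).
Proof.
move=> e0.
have e20 : (e ^+ 2).[x] != 0 by rewrite horner_exp expf_neq0.
have := is_derive_quotient (deriv_num (n, e)) e20.
rewrite (_ : (fun y => _) = (fun y => (deriv_num (n, e)).[y] / e.[y] ^+ 2)); last first.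
  by apply/funext => y; rewrite horner_exp.
move=> h; apply: (is_derive_eq h).
rewrite /deriv2_num {1}/deriv_num/= deriv_exp.
rewrite !(hornerE, hornerMn, horner_exp) /=.
by field.
Qed.

Lemma quotient_chord (f : R -> R) (n e : {poly R}) (c d : R) : c < d ->
  continuous f -> (forall x, c < x < d -> e.[x] != 0) ->
  (forall x, c < x < d -> f x = n.[x] / e.[x]) ->
  (deriv2_num (n, e) = 0) \/
  (forall x, c < x < d -> (deriv2_num (n, e)).[x] != 0) ->
  chord_convex f c d \/ chord_sconcave f c d.
Proof.
move=> cd fc e0 fE d2.
pose df x := (deriv_num (n, e)).[x] / e.[x] ^+ 2.
have fd x : c < x < d -> is_derive x 1 f (df x).
  move=> xcd; apply: near_eq_is_derive (is_derive_quotient n (e0 x xcd)).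
  have := near_in_itvoo; move=> /(_ R c d x); rewrite in_itv/= => /(_ xcd).
  by apply: filterS => y; rewrite in_itv/= => /fE.
have dfd x : c < x < d ->
    is_derive x 1 df ((deriv2_num (n, e)).[x] / e.[x] ^+ 4).
  by move=> /e0; exact: is_derive_quotient2.
have dfc x y : c < x -> y < d -> {within `[x, y], continuous df}.
  move=> cx yd; apply/continuous_in_subspaceT => z.
  rewrite inE/= in_itv/= => /andP[xz zy].
  apply/differentiable_continuous/derivable1_diffP.
  have zcd : c < z < d by rewrite (lt_le_trans cx)// (le_lt_trans zy).
  by have [] := dfd z zcd.
have fcd : {within `[c, d], continuous f} by exact: continuous_subspaceT.
have dMVT x y : c < x -> x < y -> y < d ->
    exists2 z, c < z < d & df y - df x = (deriv2_num (n, e)).[z] / e.[z] ^+ 4 * (y - x).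
  move=> cx xy yd.
  have [z|z /[!in_itv]/= /andP[xz zy] zE] :=
      MVT (df := fun z => (deriv2_num (n, e)).[z] / e.[z] ^+ 4) xy _ (dfc x y cx yd).
    by rewrite in_itv/= => /andP[xz zy]; apply: dfd; lra.
  by exists z => //; lra.
have e4 z : c < z < d -> 0 < e.[z] ^+ 4.
  by move=> zcd; rewrite exprn_even_gt0// e0.
have [pos|neg] : (forall x, c < x < d -> 0 <= (deriv2_num (n, e)).[x]) \/
    (forall x, c < x < d -> (deriv2_num (n, e)).[x] < 0).
- case: d2 => [->|/poly_const_sign[h|h]]; last by right.
    by left => x _; rewrite horner0.
  by left => x /h /ltW.
- left; apply: (chord_convex_deriv fcd fd) => x y cx xy yd.
  move: xy; rewrite le_eqVlt => /predU1P[->//|xy].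
  have [z zcd zE] := dMVT x y cx xy yd.
  rewrite -subr_ge0 zE mulr_ge0 ?subr_ge0 ?(ltW xy)// divr_ge0 ?pos//.
  by rewrite ltW// e4.
- right; apply: (chord_sconcave_deriv fcd fd) => x y cx xy yd.
  have [z zcd zE] := dMVT x y cx xy yd.
  rewrite -subr_lt0 zE pmulr_llt0 ?subr_gt0//.
  by rewrite pmulr_llt0 ?invr_gt0 ?e4// neg.
Qed.

(** The break points are the roots of all denominators, second derivative numerators and [cross]
    polynomials. Between two consecutive roots distinct quotients do not meet, so a continuous [f]
    cannot switch from one to another, and the second derivative does not change sign. *)
Lemma rational_pieces (f : R -> R) (s : seq numden) : continuous f ->
  (forall q, exists2 nd, nd \in s & nd.2.[q] != 0 /\ f q * nd.2.[q] = nd.1.[q]) ->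
  exists cs, breakpoints f cs.
Proof.
move=> fc fs.
(* Zero polynomials, such as [cross nd nd], are replaced by 1 so that the product [P] is nonzero and
   has finitely many roots. *)
pose nz (p : {poly R}) := if p == 0 then 1 else p.
have nz0 p : nz p != 0 by rewrite /nz; case: (eqVneq p 0) => [_|//]; exact: oner_neq0.
pose P := (\prod_(nd <- s) (nz nd.2 * nz (deriv2_num nd))) *
  \prod_(nd <- s) \prod_(nd' <- s) nz (cross nd nd').
have P0 : P != 0.
  rewrite mulf_neq0// prodf_seq_neq0; apply/allP => nd _ /=.
    by rewrite mulf_neq0.
  by rewrite prodf_seq_neq0; apply/allP => nd' _ /=.
have [cs hcs] := poly_finite_roots P0.
exists cs => c d cd ncs.
have Pn x : c < x < d -> P.[x] != 0.
  by move=> xcd; apply/negP => h; have := ncs x (hcs x h); rewrite xcd.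
have horner_prod_neq0 (F : numden -> {poly R}) x nd :
    (\prod_(nd <- s) F nd).[x] != 0 -> nd \in s -> (F nd).[x] != 0.
  rewrite horner_prod prodf_seq_neq0 => /allP h /h; exact.
have nzP p x : (nz p).[x] != 0 -> p != 0 -> p.[x] != 0.
  by rewrite /nz => + /negbTE p0; rewrite p0.
have Pn1 nd x : c < x < d -> nd \in s ->
    (nz nd.2).[x] != 0 /\ (nz (deriv2_num nd)).[x] != 0.
  move=> /Pn; rewrite /P hornerM mulf_eq0 negb_or => /andP[h _] nds.
  have := horner_prod_neq0 _ _ _ h nds.
  by rewrite hornerM mulf_eq0 negb_or => /andP.
have Pn2 nd nd' x : c < x < d -> nd \in s -> nd' \in s -> (nz (cross nd nd')).[x] != 0.
  move=> /Pn; rewrite /P hornerM mulf_eq0 negb_or => /andP[_ h] nds nds'.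
  exact: horner_prod_neq0 (horner_prod_neq0 _ _ _ h nds) nds'.
have mcd : c < (c + d) / 2 < d by lra.
have [nd nds [ndm0 ndm]] := fs ((c + d) / 2).
have e0 x : c < x < d -> nd.2.[x] != 0.
  move=> xcd; apply: nzP (Pn1 nd x xcd nds).1 _.
  by apply: contraNneq ndm0 => ->; rewrite horner0.
have fE x : c < x < d -> f x = nd.1.[x] / nd.2.[x].
  move=> xcd; apply/eqP; rewrite -[f x](mulfK (e0 x xcd)).
  apply: contrapT => /negP fx.
  (* At each point exactly one of [Z] and [H] vanishes, so [Z^2 - H^2] keeps its
     sign. *)
  pose Z x := f x * nd.2.[x] - nd.1.[x].
  pose H x := \prod_(nd' <- s | cross nd nd' != 0) (f x * nd'.2.[x] - nd'.1.[x]).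
  have ZH y : c < y < d -> Z y ^+ 2 - H y ^+ 2 != 0.
    move=> ycd; have [Zy|Zy] := eqVneq (Z y) 0.
      rewrite Zy expr0n sub0r oppr_eq0 expf_neq0//.
      rewrite prodf_seq_neq0; apply/allP => nd' nds'; apply/implyP => cr.
      have := nzP _ _ (Pn2 nd nd' y ycd nds nds') cr.
      apply: contraNneq => fy; rewrite /cross !hornerE.
      move/eqP : Zy; rewrite subr_eq0 => /eqP <-.
      by move/eqP : fy; rewrite subr_eq0 => /eqP <-; apply/eqP; ring.
    have [nd' nds' [nd'0 nd'E]] := fs y.
    have cr : cross nd nd' != 0.
      apply: contraNneq Zy => /(congr1 (horner^~ y)).
      rewrite /cross !hornerE -nd'E /Z => h; apply/eqP.
      by apply: (mulIf nd'0); rewrite mul0r -[RHS]oppr0 -h; ring.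
    have -> : H y = 0.
      rewrite /H; apply/eqP; rewrite prodf_seq_eq0; apply/hasP; exists nd' => //.
      by rewrite cr /= nd'E subrr.
    by rewrite expr0n subr0 expf_neq0.
  have Zc : continuous Z.
    move=> y; apply: cvgB; last exact: continuous_horner.
    by apply: cvgM; [exact: fc|exact: continuous_horner].
  have Hc : continuous H.
    move=> y; rewrite /H.
    elim: (s) => [|nd' s' IH].
      under eq_fun do rewrite big_nil.
      exact: cvg_cst.
    under eq_fun do rewrite big_cons.
    case: ifP => // _; apply: cvgM => //.
    apply: cvgB; last exact: continuous_horner.
    by apply: cvgM; [exact: fc|exact: continuous_horner].
  pose h y := Z y ^+ 2 - H y ^+ 2.
  have hc : continuous h.
    by move=> y; apply: cvgB; under eq_fun do rewrite expr2; rewrite expr2;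
      apply: cvgM; try exact: Zc; exact: Hc.
  have hm : h ((c + d) / 2) < 0.
    rewrite lt_neqAle ZH//= /h {1}/Z ndm subrr expr0n sub0r oppr_le0.
    exact: sqr_ge0.
  have hx : 0 < h x.
    rewrite lt_neqAle eq_sym ZH//= /h.
    have [nd' nds' [nd'0 nd'E]] := fs x.
    have [Hx|Hx] := eqVneq (H x) 0; first by rewrite Hx expr0n subr0 sqr_ge0.
    exfalso; move/eqP: Hx; apply.
    rewrite /H; apply/eqP; rewrite prodf_seq_eq0; apply/hasP; exists nd' => //.
    rewrite nd'E subrr eqxx andbT; apply/eqP => /(congr1 (horner^~ x)).
    rewrite /cross !hornerE -nd'E => h0; apply: (negP fx).
    rewrite mulfK ?e0//; apply/eqP; apply: (mulIf (e0 x xcd)).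
    rewrite divfK ?e0//; apply: (mulIf nd'0).
    by apply/eqP; rewrite -subr_eq0; apply/eqP; rewrite -[RHS]oppr0 -h0; ring.
  have [y ycd hy0] : exists2 y, c < y < d & h y = 0.
    move: (mcd) (xcd) => /andP[? ?] /andP[? ?].
    have [xm|mx] := leP x ((c + d) / 2).
      have [||y /[!in_itv]/= /andP[? ?] ?] := @IVT R h x ((c + d) / 2) 0 xm.
      - exact: continuous_subspaceT.
      - by rewrite ge_min le_max (ltW hm) (ltW hx) orbT.
      by exists y => //; lra.
    have [||y /[!in_itv]/= /andP[? ?] ?] := @IVT R h ((c + d) / 2) x 0 (ltW mx).
    - exact: continuous_subspaceT.
    - by rewrite ge_min le_max (ltW hm) (ltW hx) orbT.
    by exists y => //; lra.
  by have := ZH y ycd; rewrite -/(h y) hy0 eqxx.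
apply: (quotient_chord cd fc e0 fE).
have [d20|d20] := eqVneq (deriv2_num (nd.1, nd.2)) 0; first by left.
right => x xcd; apply: nzP d20; move: (Pn1 nd x xcd nds) => [_].
by case: (nd).
Qed.

End Pieces.

(** * The differential equation *)

Section WithinContinuity.
Context {R : realType}.
Implicit Types (f g : R -> R) (D : set R).

Lemma within_continuousP D f : {within D, continuous f} <->
  forall x, D x -> forall e, 0 < e -> exists2 eta, 0 < eta &
    forall y, D y -> `|x - y| < eta -> `|f x - f y| < e.
Proof.
rewrite subspace_continuousP; split=> [fc x Dx e e0|fc x Dx].
  have /cvgrPdist_lt/(_ e e0) := fc x Dx.
  rewrite near_withinE => /nbhs_ballP[eta /= eta0 h]; exists eta => // y Dy xy.
  by apply: h.
apply/cvgrPdist_lt => e e0; have [eta eta0 h] := fc x Dx e e0.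
rewrite near_withinE; apply/nbhs_ballP; exists eta => //= y xy Dy.
exact: h.
Qed.

Lemma within_continuousM D f g : {within D, continuous f} ->
  {within D, continuous g} -> {within D, continuous (fun x => f x * g x)}.
Proof. by move=> fc gc x; apply: cvgM; [exact: fc|exact: gc]. Qed.

Lemma within_continuousB D f g : {within D, continuous f} ->
  {within D, continuous g} -> {within D, continuous (fun x => f x - g x)}.
Proof. by move=> fc gc x; apply: cvgB; [exact: fc|exact: gc]. Qed.

Lemma within_continuousV D f : (forall x, D x -> f x != 0) ->
  {within D, continuous f} -> {within D, continuous (fun x => (f x)^-1)}.
Proof.
move=> f0 /subspace_continuousP fc; apply/subspace_continuousP => x Dx.
by apply: cvgV; [exact: f0|exact: fc].
Qed.

Lemma within_continuous_affine D (a b : R) :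
  {within D, continuous (fun x => a * x + b)}.
Proof.
apply: continuous_subspaceT => x; apply: cvgD; last exact: cvg_cst.
by apply: cvgM; [exact: cvg_cst|exact: cvg_id].
Qed.

Lemma within_continuous_closed_ge0 f (a b x : R) : {within `[a, b], continuous f} ->
  a <= x <= b ->
  (forall e, 0 < e -> exists y, [/\ a <= y <= b, `|x - y| < e & 0 <= f y]) ->
  0 <= f x.
Proof.
move=> /within_continuousP fc xab h; rewrite leNgt; apply/negP => fx.
have Dx : x \in `[a, b] by rewrite in_itv.
have nfx : 0 < - f x by rewrite oppr_gt0.
have [eta eta0 he] := fc x Dx _ nfx.
have [y [yab xy fy]] := h eta eta0.
have := he y; rewrite /= in_itv/= => /(_ yab xy).
by rewrite ltr_norml => /andP[+ _]; rewrite opprK => ?; lra.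
Qed.

Lemma last_nonneg f (a b : R) : a <= b -> {within `[a, b], continuous f} ->
  0 <= f a -> f b < 0 ->
  exists s, [/\ a <= s < b, 0 <= f s & forall t, s < t <= b -> f t < 0].
Proof.
move=> ab fc fa fb.
pose E := [set s | a <= s <= b /\ 0 <= f s].
have E0 : E !=set0 by exists a; split => //; rewrite lexx.
have Eb : has_ubound E by exists b => s [/andP[]].
have Ea : a <= sup E by apply: ub_le_sup => //; split => //; rewrite lexx.
have supb : sup E <= b by apply: ge_sup => // s [/andP[]].
have fs : 0 <= f (sup E).
  apply: (within_continuous_closed_ge0 fc); first by rewrite Ea.
  move=> e e0; have [y [yab fy] hy] := sup_adherent e0 (conj E0 Eb).
  exists y; split => //; have : y <= sup E by apply: ub_le_sup.
  by move=> ys; rewrite ger0_norm; lra.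
exists (sup E); split => //.
  by rewrite Ea/= lt_neqAle supb andbT; apply: contraTneq fb => <-; rewrite -leNgt.
move=> t /andP[st tb]; rewrite ltNge; apply/negP => ft.
suff : t <= sup E by rewrite leNgt st.
by apply: ub_le_sup => //; split => //; rewrite tb andbT; lra.
Qed.

Lemma has_derivative_within_interior D f (p l : R) : nbhs p D ->
  has_derivative_within D f p l -> is_derive p 1 f l.
Proof.
move=> pD h.
suff H : h^-1 *: ((f \o shift p) (h *: (1 : R)) - f p) @[h --> 0^'] --> l.
  apply: DeriveDef; first by apply/cvg_ex; exists l.
  exact/cvg_lim.
apply/cvgrPdist_lt => e e0.
have /cvgrPdist_lt/(_ e e0) := h.
rewrite !near_withinE /= => /nbhs_ballP[eta /= eta0 he].
move/nbhs_ballP : pD => [eta' /= eta'0 hD].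
apply/nbhs_ballP; exists (Num.min eta eta') => /=; first by rewrite lt_min eta0.
move=> x /=; rewrite -ball_normE /ball_/= sub0r normrN lt_min => /andP[xe xe'] x0.
have xpE : `|p - (x + p)| = `|x| by rewrite opprD addrCA subrr addr0 normrN.
have xD : D (x + p) by apply: hD; rewrite -ball_normE /ball_/= xpE.
have xp : x + p != p by rewrite -subr_eq0 addrK.
have := he (x + p); rewrite -ball_normE /ball_/= xpE => /(_ xe xp xD).
by rewrite /GRing.scale/= mulr1 addrK mulrC.
Qed.

End WithinContinuity.

Section Ode.
Context {R : realType}.
Variables (u : R -> R) (ps mu L : R).
Hypotheses (mu_gt0 : 0 < mu) (uL : forall p q, `|u p - u q| <= L * `|p - q|).
Implicit Types (phi : R -> R) (p q c d : R).

(** The right-hand side of the equation multiplied by [s - ps]: unlike [ode_field], it stays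
    continuous at [ps]. *)
Definition ode_gap phi s := mu * (u s - phi s).
Definition ode_field phi s := ode_gap phi s / (s - ps).

Lemma fieldK phi s : ps < s -> ode_field phi s * (s - ps) = ode_gap phi s.
Proof. by move=> h; rewrite divfK// subr_eq0 gt_eqF. Qed.

(* The mean value form of [phi' = ode_field phi]. *)
Definition solves phi c d : Prop := {within `[c, d], continuous phi} /\
  forall p q, c <= p -> p < q -> q <= d ->
    exists xi, p < xi < q /\ phi q - phi p = ode_field phi xi * (q - p).

Lemma solvesW phi c d c' d' : c <= c' -> d' <= d -> solves phi c d ->
  solves phi c' d'.
Proof.
move=> cc dd [fc fm]; split.
  apply: continuous_subspaceW fc; apply: subset_itv; by rewrite bnd_simp.
by move=> p q cp pq qd; apply: fm => //; lra.
Qed.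

Lemma ode_solution_solves phi c k : ode_solution u ps mu `[c, 1] c k phi ->
  solves phi c 1 /\ phi c = k.
Proof.
move=> [fc fk fd]; split => //; split=> // p q cp pq q1.
have [||xi /[!in_itv]/= hxi ->] := @MVT R phi (ode_field phi) p q pq.
- move=> x; rewrite in_itv/= => /andP[px xq].
  apply: (@has_derivative_within_interior _ `[c, 1]).
    have xc1 : x \in `]c, 1[ by rewrite in_itv/=; lra.
    have := near_in_itvoo xc1; apply: filterS => y.
    by rewrite /= !in_itv/= => /andP[/ltW-> /ltW->].
  apply: fd; first by rewrite /= in_itv/=; lra.
  by rewrite gt_eqF//; lra.
- by apply: continuous_subspaceW fc; apply: subset_itv; rewrite bnd_simp.
by exists xi.
Qed.

Lemma u_continuous : continuous u.
Proof. exact: lipschitz_continuous uL. Qed.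

Lemma gap_continuous phi c d : {within `[c, d], continuous phi} ->
  {within `[c, d], continuous (ode_gap phi)}.
Proof.
move=> fc; apply: within_continuousM; first exact/continuous_subspaceT/cst_continuous.
apply: within_continuousB fc; apply: continuous_subspaceT; exact: u_continuous.
Qed.

Lemma field_continuous phi c d : ps < c -> {within `[c, d], continuous phi} ->
  {within `[c, d], continuous (ode_field phi)}.
Proof.
move=> pc fc; apply: within_continuousM; first exact: gap_continuous.
apply: within_continuousV.
  by move=> x /=; rewrite in_itv/= => /andP[cx _]; rewrite subr_eq0 gt_eqF//; lra.
rewrite (_ : (fun x => x - ps) = (fun x => 1 * x + - ps)).
  exact: within_continuous_affine.
by apply/funext => x; rewrite mul1r.
Qed.

(* [p] passes the test at [q] when [u q] lies below the line through
   [(p, u p)] of slope [(1 + mu) / mu * a]; for [a = ode_field phi p] this says that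
   the slope function of the algorithm does not exceed [a] at [q]. *)
Definition below_line a p q := mu * (u q - u p) <= (1 + mu) * a * (q - p).
Definition sbelow_line a p q := mu * (u q - u p) < (1 + mu) * a * (q - p).

(** Let [s1] minimise the field on [[p, q]]. If [s1 < q], the solution grows from [s1] to [q] at a
    rate at least the field at [s1], while the test at [s1] bounds the growth of [u]. Together they
    give a field at [q] at most the one at [s1], hence at most the one at [p]. *)
Lemma field_nonincreasing phi c d : ps < c -> solves phi c d ->
  (forall p q, c <= p -> p < q -> q <= d -> below_line (ode_field phi p) p q) ->
  forall p q, c <= p -> p <= q -> q <= d -> ode_field phi q <= ode_field phi p.
Proof.
move=> pc [fc fm] ht p q cp; rewrite le_eqVlt => /predU1P[->//|pq] qd.
have pqcd : `[p, q] `<=` `[c, d] by apply: subset_itv; rewrite bnd_simp.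
have fpq := continuous_subspaceW pqcd (field_continuous pc fc).
have [s1] := EVT_min (ltW pq) fpq.
rewrite in_itv/= => /andP[ps1 s1q] hmin.
apply: (@le_trans _ _ (ode_field phi s1)); last first.
  by apply: hmin; rewrite in_itv/= lexx ltW.
move: s1q; rewrite le_eqVlt => /predU1P[->//|s1q].
have [xi [/andP[s1xi xiq] xiE]] := fm s1 q (le_trans cp ps1) s1q qd.
have h1 : ode_field phi s1 <= ode_field phi xi.
  by apply: hmin; rewrite in_itv/=; lra.
have h2 := ht s1 q (le_trans cp ps1) s1q qd.
have q0 : 0 < q - ps by lra.
rewrite -(ler_pM2r q0) fieldK; last lra.
have E1 : ode_field phi s1 * (s1 - ps) = ode_gap phi s1 by apply: fieldK; lra.
have h3 : 0 <= (ode_field phi xi - ode_field phi s1) * (q - s1).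
  by apply: mulr_ge0; lra.
have h4 : 0 <= mu * ((ode_field phi xi - ode_field phi s1) * (q - s1)).
  by rewrite mulr_ge0// ltW.
move: E1 h2 h4; rewrite /ode_gap /below_line.
rewrite (_ : phi q = phi s1 + ode_field phi xi * (q - s1)); last by rewrite -xiE; ring.
move: (ode_field phi xi) (ode_field phi s1) => X A; lra.
Qed.

Definition supergrad (W dW : R -> R) c d : Prop :=
  forall x y, c <= x <= d -> c <= y <= d -> W y <= W x + dW x * (y - x).

Lemma supergrad_nonincr W dW c d x y : supergrad W dW c d ->
  c <= x -> x <= y -> y <= d -> dW y <= dW x.
Proof.
move=> sg cx; rewrite le_eqVlt => /predU1P[->//|xy] yd.
have xcd : c <= x <= d by lra.
have ycd : c <= y <= d by lra.
have h1 := sg x y xcd ycd; have h2 := sg y x ycd xcd.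
have xy0 : 0 < y - x by lra.
by rewrite -(ler_pM2r xy0); lra.
Qed.

(** [W] may have a concave kink at [c]: [dl] is a left slope there, and [dW c] is kept as the right
    slope. *)
Lemma supergrad_glue W dW b c d : b <= c -> c <= d ->
  (exists dl, dW c <= dl /\ supergrad W (fun x => if x < c then dW x else dl) b c) ->
  supergrad W dW c d -> supergrad W dW b d.
Proof.
move=> bc cd [dl [dlc sl]] sr x y /andP[bx xd] /andP[by_ yd].
have ccd : c <= c <= d by rewrite lexx.
have bcc : b <= c <= c by rewrite bc lexx.
have [xc|cx] := ltP x c; have [yc|cy] := ltP y c.
- by have := sl x y; rewrite xc bx ltW// by_ ltW//; exact.
- have ycd : c <= y <= d by rewrite cy.
  have h1 := sr c y ccd ycd.
  have bxc : b <= x <= c by rewrite bx ltW.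
  have := sl x c bxc bcc; rewrite xc => h2.
  have : dl <= dW x.
    have := supergrad_nonincr sl bx (ltW xc) (lexx c).
    by rewrite ltxx xc.
  move=> h3; have h4 : 0 <= (dW x - dW c) * (y - c) by apply: mulr_ge0; lra.
  lra.
- have xcd : c <= x <= d by rewrite cx.
  have h1 := sr x c xcd ccd.
  have byc : b <= y <= c by rewrite by_ ltW.
  have := sl c y bcc byc; rewrite ltxx => h2.
  have h3 := supergrad_nonincr sr (lexx c) cx xd.
  have h4 : 0 <= (dl - dW x) * (c - y) by apply: mulr_ge0; lra.
  lra.
- by apply: sr; rewrite ?cx ?cy.
Qed.

Lemma field_supergrad phi c d : ps < c -> solves phi c d ->
  (forall p q, c <= p -> p < q -> q <= d -> below_line (ode_field phi p) p q) ->
  supergrad phi (ode_field phi) c d.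
Proof.
move=> pc so ht x y /andP[cx xd] /andP[cy yd].
have mono := field_nonincreasing pc so ht.
have [xy|yx|->] := ltgtP x y; last by rewrite subrr mulr0 addr0.
- have [xi [/andP[h1 h2] E]] := so.2 x y cx xy yd.
  have xid : xi <= d by lra.
  have h := mono x xi cx (ltW h1) xid.
  have : 0 <= (ode_field phi x - ode_field phi xi) * (y - x) by apply: mulr_ge0; lra.
  lra.
- have [xi [/andP[h1 h2] E]] := so.2 y x cy yx xd.
  have cxi : c <= xi by lra.
  have h := mono xi x cxi (ltW h2) xd.
  have : 0 <= (ode_field phi xi - ode_field phi x) * (x - y) by apply: mulr_ge0; lra.
  lra.
Qed.

(* The solution issued from the singular point [ps]. *)
Lemma field_supergrad_start phi a d : ps <= d -> solves phi ps d -> phi ps = u ps ->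
  (forall q, ps < q -> q <= d -> below_line a ps q) ->
  (forall p q, ps < p -> p < q -> q <= d -> below_line (ode_field phi p) p q) ->
  supergrad phi (fun q => if q == ps then a else ode_field phi q) ps d.
Proof.
move=> psd so phips hta ht.
have mono p q : ps < p -> p <= q -> q <= d -> ode_field phi q <= ode_field phi p.
  move=> psp pq qd; apply: (@field_nonincreasing phi p d) => //.
  - by apply: solvesW so => //; exact: ltW.
  - by move=> p' q' pp' p'q' q'd; apply: ht => //; lra.
have le_a p : ps < p -> p <= d -> ode_field phi p <= a.
  move=> psp pd.
  have [xi [/andP[h1 h2] E]] := so.2 ps p (lexx _) psp pd.
  have h := mono xi p h1 (ltW h2) pd.
  have h3 := hta p psp pd.
  have E1 : ode_field phi p * (p - ps) = ode_gap phi p by apply: fieldK; lra.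
  have p0 : 0 < (1 + mu) * (p - ps) by apply: mulr_gt0; [move: mu_gt0; lra|lra].
  rewrite -(ler_pM2r p0).
  have h4 : 0 <= mu * ((ode_field phi xi - ode_field phi p) * (p - ps)).
    apply: mulr_ge0; [exact: ltW|apply: mulr_ge0]. - lra. - lra.
  move: E1 h3 h4; rewrite /ode_gap /below_line.
  rewrite (_ : phi p = phi ps + ode_field phi xi * (p - ps)); last by rewrite -E; ring.
  rewrite phips; lra.
move=> x y /andP[cx xd] /andP[cy yd].
have [xE|xps] := eqVneq x ps.
  have [->|yps] := eqVneq y ps; first by rewrite xE subrr mulr0 addr0.
  have py : ps < y by rewrite lt_neqAle eq_sym yps.
  have [xi [/andP[h1 h2] E]] := so.2 ps y (lexx _) py yd.
  have xid : xi <= d by lra.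
  have h := le_a xi h1 xid.
  have h3 : 0 <= (a - ode_field phi xi) * (y - ps) by apply: mulr_ge0; lra.
  by rewrite xE; lra.
have px : ps < x by rewrite lt_neqAle eq_sym xps.
have [xy|yx|->] := ltgtP x y; last by rewrite subrr mulr0 addr0.
- have [xi [/andP[h1 h2] E]] := so.2 x y cx xy yd.
  have xid : xi <= d by lra.
  have h := mono x xi px (ltW h1) xid.
  have : 0 <= (ode_field phi x - ode_field phi xi) * (y - x) by apply: mulr_ge0; lra.
  lra.
- have [xi [/andP[h1 h2] E]] := so.2 y x cy yx xd.
  have cxi : ps < xi by lra.
  have h := mono xi x cxi (ltW h2) xd.
  have : 0 <= (ode_field phi xi - ode_field phi x) * (x - y) by apply: mulr_ge0; lra.
  lra.
Qed.

(** After the last point [s] where the gap reaches the line of slope [f] through [ps], the field is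
    below [f], so [phi] gains at most [f * (p - s)], while [u] gains more than [m * (p - s)]. As
    [mu * m = (1 + mu) * f], the gap would be above the line at [p]. *)
Lemma gap_ge_line phi c d p f m : ps <= c -> solves phi c d -> c < p -> p <= d ->
  mu * m = (1 + mu) * f -> f * (c - ps) <= ode_gap phi c ->
  (forall s, c <= s -> s < p -> m * (p - s) < u p - u s) ->
  f * (p - ps) <= ode_gap phi p.
Proof.
move=> pc so cp pd mf gc hu; rewrite leNgt; apply/negP => gp.
pose h s := ode_gap phi s - (f * s + - (f * ps)).
have hcont : {within `[c, p], continuous h}.
  apply: within_continuousB; last exact: within_continuous_affine.
  apply: continuous_subspaceW (gap_continuous so.1).
  by apply: subset_itv; rewrite bnd_simp.
have hc0 : 0 <= h c by rewrite /h; lra.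
have hp0 : h p < 0 by rewrite /h; lra.
have [s [/andP[cs sp] hs ht]] := last_nonneg (ltW cp) hcont hc0 hp0.
have [xi [/andP[h1 h2] E]] := so.2 s p cs sp pd.
have psxi : ps < xi by lra.
have hxi : ode_field phi xi < f.
  have x0 : 0 < xi - ps by lra.
  rewrite -(ltr_pM2r x0) fieldK//.
  by have := ht xi; rewrite h1 ltW// /h => /(_ isT); lra.
have h3 : 0 <= mu * ((f - ode_field phi xi) * (p - s)).
  by apply: mulr_ge0; [exact: ltW|apply: mulr_ge0; lra].
have h4 : mu * (m * (p - s)) < mu * (u p - u s) by rewrite ltr_pM2l// hu.
have h5 : mu * (m * (p - s)) = (1 + mu) * f * (p - s) by rewrite mulrA mf.
move: hs hp0; rewrite /h /ode_gap => h6 h7.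
have E2 : mu * (phi p - phi s) = mu * (ode_field phi xi * (p - s)) by rewrite E.
lra.
Qed.

End Ode.

(** * The slope test *)

Section Slopes.
Context {R : realType}.
Variables (u : R -> R) (ps mu L : R).
Hypotheses (mu_gt0 : 0 < mu) (ps_ge0 : 0 <= ps) (L_ge0 : 0 <= L).
Hypothesis (uL : forall p q, `|u p - u q| <= L * `|p - q|).
Implicit Types (f phi : R -> R) (a p q c d : R).

Local Notation gap := (ode_gap u mu).
Local Notation field := (ode_field u ps mu).
Local Notation below := (below_line u mu).
Local Notation sbelow := (sbelow_line u mu).
Local Notation slope := (slope u ps mu).
Local Notation a_up := (a_up u ps mu).
Local Notation rho_up := (rho_up u ps mu).

Definition den p q := q - ps + mu * (q - p).

Lemma den_gt0 p q : ps <= p -> p < q -> 0 < den p q.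
Proof.
move=> pp pq; rewrite /den ltr_pwDl//; first lra.
by apply: mulr_ge0; [exact: ltW|lra].
Qed.

(** The normalisation [gap f p = a * (p - ps)] eliminates [f p] from the comparison. For [p > ps] it
    forces [a] to be the field at [p]; at [ps] it says [f ps = u ps] and leaves [a] free. *)
Lemma slope_leE f a p q : ps <= p -> p < q -> gap f p = a * (p - ps) ->
  (slope f p q <= a) = (mu * (u q - u p) <= (1 + mu) * a * (q - p)).
Proof.
move=> pp pq; rewrite /ode_gap /slope ler_pdivrMr ?(den_gt0 pp pq)// => g.
by apply/idP/idP => h; move: g h; lra.
Qed.

Lemma slope_ltE f a p q : ps <= p -> p < q -> gap f p = a * (p - ps) ->
  (slope f p q < a) = (mu * (u q - u p) < (1 + mu) * a * (q - p)).
Proof.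
move=> pp pq; rewrite /ode_gap /slope ltr_pdivrMr ?(den_gt0 pp pq)// => g.
by apply/idP/idP => h; move: g h; lra.
Qed.

Lemma u_le p q : p <= q -> u q - u p <= L * (q - p).
Proof.
by move=> pq; rewrite (le_trans (ler_norm _))// (le_trans (uL _ _))// ger0_norm ?subr_ge0.
Qed.

Lemma u_ge p q : p <= q -> - (L * (q - p)) <= u q - u p.
Proof.
move=> pq; rewrite lerNl opprB (le_trans (ler_norm _))// (le_trans (uL _ _))//.
by rewrite distrC ger0_norm ?subr_ge0.
Qed.

Definition attained f p := exists q, p < q <= 1 /\ a_up p f = slope f p q.

Lemma slopes_has_ubound f a p : ps <= p -> gap f p = a * (p - ps) ->
  has_ubound [set slope f p q | q in `]p, 1]].
Proof.
move=> pp g; exists (Num.max a (L * mu)) => _ [q /= + <-].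
rewrite in_itv/= => /andP[pq q1].
rewrite /slope ler_pdivrMr ?(den_gt0 pp pq)//.
set M := Num.max _ _.
have aM : a <= M by rewrite le_max lexx.
have LM : L * mu <= M by rewrite le_max lexx orbT.
have h0 : 0 <= (M - a) * (p - ps) by apply: mulr_ge0; lra.
have h1 := u_le (ltW pq).
have h2 : 0 <= (M - L * mu) * (q - p) by apply: mulr_ge0; lra.
have h3 : mu * (u q - u p) <= mu * (L * (q - p)) by rewrite ler_pM2l.
have h4 : 0 <= M * (mu * (q - p)).
  apply: mulr_ge0; last by apply: mulr_ge0; [exact: ltW|lra].
  by apply: le_trans LM; apply: mulr_ge0 => //; exact: ltW.
by move: g; rewrite /ode_gap; lra.
Qed.

Lemma slope_le_a_up f a p q : ps <= p -> gap f p = a * (p - ps) ->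
  p < q -> q <= 1 -> slope f p q <= a_up p f.
Proof.
move=> pp g pq q1; apply: ub_le_sup; first exact: slopes_has_ubound pp g.
by exists q => //=; rewrite in_itv/= pq.
Qed.

Lemma lt_rho_up f p : p < rho_up p f <-> attained f p.
Proof.
rewrite /rho_up; case: asboolP => [E0|nE]; last first.
  by rewrite ltxx; split => // -[q hq]; exfalso; apply: nE; exists q.
split=> _; first exact: E0.
have [q [/andP[pq q1] hq]] := E0.
apply: (lt_le_trans pq); apply: ub_le_sup; last by split => //; rewrite pq.
by exists 1 => x [/andP[]].
Qed.

(** The set of maximisers is closed on the right by continuity, so its supremum is itself a
    maximiser, and beyond it the slope is strictly smaller. *)
Lemma rho_up_attained f a p : ps <= p -> gap f p = a * (p - ps) -> attained f p ->
  let r := rho_up p f in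
  [/\ p < r, r <= 1, a_up p f = slope f p r &
    forall q, r < q -> q <= 1 -> slope f p q < a_up p f].
Proof.
move=> pp g at_p r.
have pr : p < r by apply/lt_rho_up.
have rE : r = sup [set q | p < q <= 1 /\ a_up p f = slope f p q].
  by rewrite /r /rho_up; case: asboolP.
set E := [set q | _] in rE.
have Eb : has_ubound E by exists 1 => x [/andP[]].
have r1 : r <= 1 by rewrite rE; apply: ge_sup => // x [/andP[]].
(* Clearing the denominator turns the maximisers into zeros of a function that is continuous
   everywhere. *)
pose h q := a_up p f * den p q - mu * (u q - f p).
have hc : {within `[r - 1, r], continuous h}.
  apply: continuous_subspaceT => x; apply: cvgB; apply: cvgM; (try exact: cvg_cst).
    apply: cvgD; first by apply: cvgB; [exact: cvg_id|exact: cvg_cst].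
    by apply: cvgM; [exact: cvg_cst|apply: cvgB; [exact: cvg_id|exact: cvg_cst]].
  by apply: cvgB; [exact: (u_continuous uL)|exact: cvg_cst].
have hE q : E q -> h q = 0.
  move=> [/andP[pq q1] aE]; rewrite /h aE /slope -/(den p q) divfK ?subrr//.
  by rewrite gt_eqF// den_gt0.
have near_r e : 0 < e -> exists y, [/\ r - 1 <= y <= r, `|r - y| < e & E y].
  move=> e0; have [|y Ey hy] := @sup_adherent _ E (Num.min e 1) _ (conj at_p Eb).
    by rewrite lt_min e0 ltr01.
  have yr : y <= r by rewrite rE; apply: ub_le_sup.
  move: hy; rewrite -rE => hy; exists y; split => //.
    by rewrite yr andbT; move: hy; rewrite /Num.min; case: ifP => ?; lra.
  rewrite ger0_norm ?subr_ge0//.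
  by move: hy; rewrite /Num.min; case: ifP => ?; lra.
have rr : r - 1 <= r <= r by rewrite lexx andbT; lra.
have h0 : h r = 0.
  apply/eqP; rewrite eq_le; apply/andP; split.
    rewrite -oppr_ge0.
    apply: (@within_continuous_closed_ge0 _ (fun x => - h x) (r - 1) r r) => //.
      by move=> x; apply: cvgN; exact: hc.
    by move=> e /near_r[y [? ? /hE Ey]]; exists y; split => //; rewrite Ey oppr0.
  apply: (within_continuous_closed_ge0 hc) => //.
  by move=> e /near_r[y [? ? /hE Ey]]; exists y; split => //; rewrite Ey.
have ar : a_up p f = slope f p r.
  have h0' : a_up p f * den p r = mu * (u r - f p).
    by apply/eqP; rewrite -subr_eq0; apply/eqP; exact: h0.
  by rewrite /slope -/(den p r) -h0' mulfK// gt_eqF// den_gt0.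
split => // q rq q1; rewrite lt_neqAle (slope_le_a_up pp g) ?(lt_trans pr rq)//.
rewrite andbT; apply/eqP => sE.
suff : q <= r by rewrite leNgt rq.
by rewrite rE; apply: ub_le_sup => //; split; rewrite ?(lt_trans pr rq).
Qed.

(** The slope at [q] tends to [a] as [q] decreases to [p], so [a] is a lower bound of the supremum;
    the test gives the upper bound. The proof makes the limit explicit with a step [t] so small that
    the slope at [p + t] exceeds any given [b < a]. *)
Lemma a_up_eq f a p : ps < p -> p < 1 -> gap f p = a * (p - ps) ->
  (forall q, p < q -> q <= 1 -> below a p q) -> a_up p f = a.
Proof.
move=> pp p1 g ha; apply/eqP; rewrite eq_le; apply/andP; split.
  apply: ge_sup; first by exists (slope f p 1); exists 1 => //=; rewrite in_itv/= p1 lexx.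
  move=> _ [q /= /[!in_itv]/= /andP[pq q1] <-].
  by rewrite (slope_leE (ltW pp) pq g); exact: ha.
rewrite leNgt; apply/negP => lta.
set b := a_up p f in lta.
pose C := mu * L + (1 + mu) * `|b| + 1.
have C0 : 0 < C.
  have h1 : 0 <= mu * L by apply: mulr_ge0 => //; exact: ltW.
  have h2 : 0 <= (1 + mu) * `|b| by apply: mulr_ge0 => //; move: mu_gt0; lra.
  by rewrite /C; lra.
pose t := Num.min (1 - p) ((a - b) * (p - ps) / C).
have t0 : 0 < t.
  by rewrite lt_min subr_gt0 p1 divr_gt0//; apply: mulr_gt0; lra.
have t1 : t <= 1 - p by rewrite ge_min lexx.
have t2 : t * C <= (a - b) * (p - ps) by rewrite -ler_pdivlMr// ge_min lexx orbT.
have ptp : p < p + t by lra.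
have pt1 : p + t <= 1 by lra.
have := slope_le_a_up (ltW pp) g ptp pt1.
rewrite -/b /slope ler_pdivrMr ?(den_gt0 (ltW pp) ptp)// leNgt => /negP; apply.
have h1 := u_ge (ltW ptp).
have h2 : mu * - (L * (p + t - p)) <= mu * (u (p + t) - u p) by rewrite ler_pM2l.
have h3 : 0 <= (`|b| - b) * (t * (1 + mu)).
  apply: mulr_ge0; first by have := ler_norm b; lra.
  by apply: mulr_ge0; move: mu_gt0; lra.
by move: g t2; rewrite /ode_gap /C; lra.
Qed.

(** Stands in at [ps] for the continuity of the field: chords of [u] issued from [p], with ends
    arbitrarily close to [p], have rescaled slopes arbitrarily close to [a] or above. *)
Definition approached a p := forall eta, 0 < eta ->
  exists q, [/\ p < q < p + eta, q <= 1 &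
    (1 + mu) * (a - eta) * (q - p) < mu * (u q - u p)].

(** For [p > ps] the slope function extends continuously to [p] with the field as value. A maximiser
    on [[p, 1]] other than [p] would attain the supremum. *)
Lemma not_attained_gt f p : ps < p -> p < 1 -> ~ attained f p ->
  forall q, p < q -> q <= 1 -> sbelow (field f p) p q.
Proof.
move=> pp p1 nat q pq q1.
have g : gap f p = field f p * (p - ps) by rewrite fieldK.
have pden x : p <= x -> 0 < den p x.
  move=> px; rewrite /den ltr_pwDl//; first lra.
  by apply: mulr_ge0; [exact: ltW|lra].
have sc : {within `[p, 1], continuous (slope f p)}.
  apply: within_continuousM.
    apply: continuous_subspaceT => x; apply: cvgM; first exact: cvg_cst.
    by apply: cvgB; [exact: (u_continuous uL)|exact: cvg_cst].
  apply: within_continuousV => [x /=|].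
    by rewrite in_itv/= => /andP[px _]; rewrite gt_eqF// pden.
  apply: continuous_subspaceT => x.
  apply: cvgD; first by apply: cvgB; [exact: cvg_id|exact: cvg_cst].
  by apply: cvgM; [exact: cvg_cst|apply: cvgB; [exact: cvg_id|exact: cvg_cst]].
have spp : slope f p p = field f p by rewrite /slope subrr mulr0 addr0.
have sup_ge x : p < x -> x <= 1 -> (forall z, p < z -> z <= 1 -> slope f p z <= slope f p x) ->
    attained f p.
  move=> px x1 hx; exists x; rewrite px x1; split => //.
  apply/eqP; rewrite eq_le (slope_le_a_up (ltW pp) g)// andbT.
  apply: ge_sup; first by exists (slope f p x); exists x => //=; rewrite in_itv/= px.
  by move=> _ [z /= /[!in_itv]/= /andP[pz z1] <-]; exact: hx.
have [m /[!in_itv]/= /andP[pm m1] hm] := EVT_max (ltW p1) sc.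
move: pm; rewrite le_eqVlt => /predU1P[pm|pm]; last first.
  exfalso; apply: nat; apply: (sup_ge m) => // z pz z1.
  by apply: hm; rewrite in_itv/= z1 ltW.
rewrite -pm in hm.
rewrite /sbelow_line -(slope_ltE (ltW pp) pq g) -spp.
have hq : slope f p q <= slope f p p by apply: hm; rewrite in_itv/= q1 ltW.
rewrite lt_neqAle hq andbT; apply/eqP => sE; apply: nat.
apply: (sup_ge q) => // z pz z1; rewrite sE; apply: hm.
by rewrite in_itv/= z1 ltW.
Qed.

(** The denominator vanishes at [ps], so there is no extension to [ps]. Instead, the slopes on
    [[ps + eta, 1]] have a maximum below the supremum, which forces almost optimal ends into []ps,
    ps + eta[]. *)
Lemma not_attained_ps f : ps < 1 -> f ps = u ps -> ~ attained f ps ->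
  (forall q, ps < q -> q <= 1 -> sbelow (a_up ps f) ps q) /\
  approached (a_up ps f) ps.
Proof.
move=> p1 fps nat; set a := a_up ps f.
have g x : gap f ps = x * (ps - ps) by rewrite /ode_gap fps !subrr !mulr0.
have lt_a q : ps < q -> q <= 1 -> slope f ps q < a.
  move=> pq q1; rewrite lt_neqAle (slope_le_a_up (lexx _) (g 0))// andbT.
  by apply/eqP => sE; apply: nat; exists q; rewrite pq.
split=> [q pq q1|eta eta0].
  by rewrite /sbelow_line -(slope_ltE (lexx _) pq (g a)); exact: lt_a.
have sc : {within `[ps + eta, 1], continuous (slope f ps)}.
  apply: within_continuousM.
    apply: continuous_subspaceT => x; apply: cvgM; first exact: cvg_cst.
    by apply: cvgB; [exact: (u_continuous uL)|exact: cvg_cst].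
  apply: within_continuousV => [x /=|].
    rewrite in_itv/= => /andP[px _]; rewrite gt_eqF// (@den_gt0 ps x)//; lra.
  apply: continuous_subspaceT => x.
  apply: cvgD; first by apply: cvgB; [exact: cvg_id|exact: cvg_cst].
  by apply: cvgM; [exact: cvg_cst|apply: cvgB; [exact: cvg_id|exact: cvg_cst]].
have [M Ma hM] : exists2 M, M < a & forall q, ps + eta <= q -> q <= 1 -> slope f ps q <= M.
  have [h|h] := leP (ps + eta) 1; last first.
    by exists (a - 1); [lra|move=> q ? ?; lra].
  have [m /[!in_itv]/= /andP[pm m1] hm] := EVT_max h sc.
  exists (slope f ps m); first by apply: lt_a => //; lra.
  by move=> q pq q1; apply: hm; rewrite in_itv/= pq.
have e0 : 0 < Num.min eta (a - M) by rewrite lt_min eta0 subr_gt0.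
have hs : has_sup [set slope f ps q | q in `]ps, 1]].
  split; last exact: slopes_has_ubound (lexx _) (g 0).
  by exists (slope f ps 1); exists 1 => //=; rewrite in_itv/= p1 lexx.
have [_ [q /= /[!in_itv]/= /andP[pq q1] <-]] := sup_adherent e0 hs.
rewrite -/(a_up ps f) -/a => hq.
have [hq1 hq2] : a - eta < slope f ps q /\ M < slope f ps q.
  by move: hq; rewrite /Num.min; case: ifP => ? ?; split; lra.
exists q; split => //.
  by rewrite pq ltNge; apply/negP => h; have := hM q h q1; lra.
move: hq1; rewrite /slope ltr_pdivlMr ?(den_gt0 (lexx _) pq)// fps.
by rewrite /den; lra.
Qed.

Lemma sbelow_not_attained f a p : ps <= p -> gap f p = a * (p - ps) ->
  a_up p f = a -> (forall q, p < q -> q <= 1 -> sbelow a p q) -> ~ attained f p.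
Proof.
move=> pp g aE ha [q [/andP[pq q1]]]; rewrite aE => sE.
by have := ha q pq q1; rewrite /sbelow_line -(slope_ltE pp pq g) -sE ltxx.
Qed.

Lemma next_breakpoint (cs : seq R) c : c < 1 ->
  exists d, [/\ c < d, d <= 1 & forall x, x \in cs -> ~~ (c < x < d)].
Proof.
move=> c1; elim: cs => [|y cs [d [cd d1 hd]]]; first by exists 1.
have [yc|cy] := leP y c.
  exists d; split => // x; rewrite inE => /predU1P[->|/hd//].
  by rewrite negb_and -leNgt yc.
exists (Num.min y d); split.
- by rewrite lt_min cy.
- by rewrite ge_min d1 orbT.
- move=> x; rewrite inE => /predU1P[->|/hd].
    by rewrite lt_min ltxx andbF.
  by apply: contra => /andP[-> /=]; rewrite lt_min => /andP[_ ->].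
Qed.

End Slopes.

Section Persistence.
Context {R : realType}.
Variables (u : R -> R) (ps mu L : R).
Hypotheses (mu_gt0 : 0 < mu) (ps_ge0 : 0 <= ps) (L_ge0 : 0 <= L).
Hypothesis (uL : forall p q, `|u p - u q| <= L * `|p - q|).
Implicit Types (f phi : R -> R) (a p q c d : R).

Local Notation gap := (ode_gap u mu).
Local Notation field := (ode_field u ps mu).
Local Notation below := (below_line u mu).
Local Notation sbelow := (sbelow_line u mu).
Local Notation solves := (solves u ps mu).

(** Chords of [u] ending at [p] are steeper than those starting at [p]. The gap therefore stays
    above the line belonging to a chord issued from [p], which means that the field at [p] dominates
    that chord. *)
Lemma sconcave_persist phi a c d : ps <= c -> c < d -> d <= 1 -> solves phi c 1 ->
  gap phi c = a * (c - ps) -> (forall q, c < q -> q <= 1 -> sbelow a c q) ->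
  chord_sconcave u c d ->
  forall p q, c < p -> p < q -> q <= d -> sbelow (field phi p) p q.
Proof.
move=> pc cd d1 so g ha hu p q cp pq qd.
(* The comparison uses the chord to the midpoint, which is strictly steeper than the one to [q];
   this yields the strict test. *)
pose q' := (p + q) / 2.
pose m := (u q' - u p) / (q' - p).
pose f := mu * m / (1 + mu).
have q'p : 0 < q' - p by rewrite /q'; lra.
have mE : m * (q' - p) = u q' - u p by rewrite /m divfK// gt_eqF.
have fE : mu * m = (1 + mu) * f.
  by rewrite /f; field; rewrite gt_eqF//; move: mu_gt0; lra.
have hs s : c <= s -> s < p -> m * (p - s) < u p - u s.
  move=> cs sp.
  have := @hu s p q' cs sp; rewrite -mE => h.
  have : m * (q' - p) * (p - s) < (u p - u s) * (q' - p).
    by apply: h; rewrite /q'; lra.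
  by rewrite mulrAC ltr_pM2r.
have p1 : p < 1 by lra.
have gc : f * (c - ps) <= gap phi c.
  rewrite g ler_wpM2r//; first lra.
  have h1 := ha p cp (ltW p1).
  have h2 : mu * (m * (p - c)) < mu * (u p - u c) by rewrite ltr_pM2l// hs.
  have h3 : 0 < (1 + mu) * (p - c) by apply: mulr_gt0; move: mu_gt0; lra.
  rewrite -(ler_pM2r h3) ltW//; move: h1 h2; rewrite /sbelow_line.
  have -> : mu * (m * (p - c)) = (1 + mu) * f * (p - c) by rewrite mulrA fE.
  lra.
have := gap_ge_line mu_gt0 uL pc so cp (ltW p1) fE gc hs.
have psp : 0 < p - ps by lra.
have psp' : ps < p by lra.
rewrite -(fieldK u mu phi psp') ler_pM2r// => hf.
rewrite /sbelow_line.
have h1 : (u q - u q') * (q' - p) < (u q' - u p) * (q - q').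
  by apply: hu; rewrite /q'; lra.
have h2 : (u q - u p) * (q' - p) < (u q' - u p) * (q - p).
  by move: h1; lra.
have h3 : u q - u p < m * (q - p).
  rewrite -(ltr_pM2r q'p) (lt_le_trans h2)// -mE.
  by rewrite mulrAC.
have h4 : mu * (u q - u p) < mu * (m * (q - p)) by rewrite ltr_pM2l.
have h5 : 0 <= (field phi p - f) * ((1 + mu) * (q - p)).
  apply: mulr_ge0; first lra.
  by apply: mulr_ge0; move: mu_gt0; lra.
apply: (lt_le_trans h4); rewrite mulrA fE; move: h5; lra.
Qed.

Lemma field_near phi a c : ps < c -> c < 1 -> solves phi c 1 ->
  gap phi c = a * (c - ps) -> forall eta, 0 < eta ->
  exists2 e, 0 < e & forall p, c < p -> p < c + e -> p < 1 -> a - eta <= field phi p.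
Proof.
move=> pc c1 so g eta eta0.
have /within_continuousP fc := @field_continuous _ _ _ mu _ uL _ _ _ pc so.1.
have fca : field phi c = a by rewrite /ode_field g mulfK// subr_eq0 gt_eqF.
have c01 : c \in `[c, 1] by rewrite in_itv/= lexx ltW.
have [e e0 he] := fc c c01 eta eta0.
exists e => // p cp pe p1.
have p01 : p \in `[c, 1] by rewrite in_itv/= !ltW.
have cpe : `|c - p| < e by rewrite distrC ger0_norm ?subr_ge0 ?ltW//; lra.
by have := he p p01 cpe; rewrite fca ltr_norml => /andP[_]; lra.
Qed.

(** For ends in the compact [[d, 1]] the strict test at [c] has a positive margin [G m], which
    survives a small move of [p] and a small decrease of the slope. *)
Lemma far_persist phi a c d : ps <= c -> c < d -> d <= 1 ->
  gap phi c = a * (c - ps) -> (forall q, c < q -> q <= 1 -> sbelow a c q) ->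
  (forall eta, 0 < eta -> exists2 e, 0 < e &
     forall p, c < p -> p < c + e -> p < 1 -> a - eta <= field phi p) ->
  exists2 e, 0 < e & forall p, c < p -> p < c + e -> p < 1 ->
     forall q, p < q -> d <= q -> q <= 1 -> sbelow (field phi p) p q.
Proof.
move=> pc cd d1 g ha hF.
pose G q := (1 + mu) * a * (q - c) - mu * (u q - u c).
have Gc : {within `[d, 1], continuous G}.
  apply: continuous_subspaceT => x; apply: cvgB; apply: cvgM; (try exact: cvg_cst).
    by apply: cvgB; [exact: cvg_id|exact: cvg_cst].
  by apply: cvgB; [exact: (u_continuous uL)|exact: cvg_cst].
have [m /[!in_itv]/= /andP[dm m1] hm] := EVT_min d1 Gc.
have Gm : 0 < G m by rewrite subr_gt0; apply: ha => //; lra.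
have mu1 : 0 < 1 + mu by move: mu_gt0; lra.
have eta0 : 0 < G m / (4 * (1 + mu)) by apply: divr_gt0 => //; lra.
have [e1 e10 he1] := hF _ eta0.
pose C := (1 + mu) * `|a| + mu * L + 1.
have C0 : 0 < C.
  have h1 : 0 <= mu * L by apply: mulr_ge0 => //; exact: ltW.
  have h2 : 0 <= (1 + mu) * `|a| by apply: mulr_ge0 => //; lra.
  by rewrite /C; lra.
exists (Num.min e1 (G m / (4 * C))).
  by rewrite lt_min e10 divr_gt0//; lra.
move=> p cp; rewrite -ltrBlDl lt_min => /andP[pe1 pe2] p1 q pq dq q1.
have pe1' : p < c + e1 by lra.
have hFp := he1 p cp pe1' p1.
have hGq : G m <= G q by apply: hm; rewrite in_itv/= dq.
have h2 : (p - c) * C < G m / 4.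
  move: pe2; rewrite invfM mulrA ltr_pdivlMr//.
have h3 : (a - field phi p) * ((1 + mu) * (q - p)) <= G m / 4.
  have q0 : 0 <= q - p <= 1 by move: ps_ge0; lra.
  apply: (@le_trans _ _ (G m / (4 * (1 + mu)) * ((1 + mu) * (q - p)))).
    apply: ler_wpM2r; last lra.
    by apply: mulr_ge0; lra.
  have -> : G m / (4 * (1 + mu)) * ((1 + mu) * (q - p)) = G m / 4 * (q - p).
    by field; rewrite gt_eqF.
  rewrite -[leRHS]mulr1 ler_wpM2l//; first lra.
  by move: q0 => /andP[].
have h4 : (1 + mu) * a * (p - c) <= (1 + mu) * `|a| * (p - c).
  apply: ler_wpM2r; first lra.
  by apply: ler_wpM2l; [exact: ltW|exact: ler_norm].
have h5 : mu * (u p - u c) >= - (mu * (L * (p - c))).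
  rewrite -mulrN ler_pM2l//; exact: (u_ge uL (ltW cp)).
rewrite /sbelow_line; move: (G m) Gm hGq h2 h3 h4 h5 => g0.
by rewrite /G /C; lra.
Qed.

(** Ends beyond the current piece are handled by [far_persist]. Inside a convex piece the test at
    its end [d] implies the test before [d]; inside a strictly concave one [sconcave_persist]
    applies. *)
Lemma persistence (cs : seq R) phi a c : breakpoints u cs ->
  ps <= c -> c < 1 -> solves phi c 1 ->
  gap phi c = a * (c - ps) -> (forall q, c < q -> q <= 1 -> sbelow a c q) ->
  (ps < c \/ approached u mu a c) ->
  exists2 e, 0 < e & forall p, c < p -> p < c + e -> p < 1 ->
     forall q, p < q -> q <= 1 -> sbelow (field phi p) p q.
Proof.
move=> hcs pc c1 so g ha hc.
have [d [cd d1 hd]] := next_breakpoint cs c1.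
have mu1 : 0 < 1 + mu by move: mu_gt0; lra.
have [cvx|ccv] := hcs c d cd hd.
- have {}pc : ps < c.
    (* Slopes of chords issued from the left end of a convex piece increase with their end, so they
       stay below that of the chord to [d], which is strictly below [a]: they cannot approach
       [a]. *)
    case: hc => // happ; exfalso.
    have A := ha d cd d1.
    have dc : 0 < (1 + mu) * (d - c) by apply: mulr_gt0; lra.
    pose eta := a - mu * (u d - u c) / ((1 + mu) * (d - c)).
    have eta0 : 0 < eta.
      rewrite /eta subr_gt0 ltr_pdivrMr//; move: A; rewrite /sbelow_line; lra.
    have [q [/andP[cq qe] q1 hq]] := happ (Num.min eta (d - c))
      (ltac:(by rewrite lt_min eta0 subr_gt0)).
    have qd : q < d.
      by move: qe; rewrite /Num.min; case: ifP => ?; lra.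
    have hq' : (1 + mu) * (a - eta) * (q - c) < mu * (u q - u c).
      apply: le_lt_trans hq; apply: ler_wpM2r; first lra.
      by apply: ler_wpM2l; [exact: ltW|rewrite lerB// ge_min lexx].
    have := cvx c q d (lexx _) cq qd (lexx _).
    have E : (1 + mu) * (a - eta) * (d - c) = mu * (u d - u c).
      by rewrite /eta; field; rewrite !gt_eqF//; lra.
    apply/negP; rewrite -ltNge.
    have cq0 : 0 < q - c by lra.
    have dc0 : 0 < d - c by lra.
    have h1 : mu * (u d - u c) * (q - c) < mu * (u q - u c) * (d - c).
      by rewrite -E mulrAC ltr_pM2r.
    have h2 : (u d - u c) * (q - c) < (u q - u c) * (d - c).
      by rewrite -(ltr_pM2l mu_gt0) !mulrA.
    lra.
  have [e e0 he] := far_persist (ltW pc) cd d1 g ha (field_near pc c1 so g).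
  exists (Num.min e (d - c)); first by rewrite lt_min e0 subr_gt0.
  move=> p cp; rewrite -ltrBlDl lt_min => /andP[pe pd] p1 q pq q1.
  have pe' : p < c + e by lra.
  have [dq|qd] := leP d q; first exact: he.
  have pd' : p < d by lra.
  have h1 := he p cp pe' p1 d pd' (lexx _) d1.
  have h2 := cvx p q d (ltW cp) pq qd (lexx _).
  have h3 : (u q - u p) * (d - p) <= (u d - u p) * (q - p) by move: h2; lra.
  have dp : 0 < d - p by lra.
  have qp : 0 < q - p by lra.
  rewrite /sbelow_line -(ltr_pM2r dp).
  apply: (@le_lt_trans _ _ (mu * (u d - u p) * (q - p))).
    by rewrite -!mulrA ler_pM2l.
  by rewrite [ltRHS]mulrAC ltr_pM2r.
- have near_part := sconcave_persist pc cd d1 so g ha ccv.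
  (* At [ps] the lower bound on the field comes from the test itself: for [p] near [c] the field
     dominates the chord from [p] to a fixed [q] whose chord from [c] nearly realises [a]. *)
  have hF eta : 0 < eta -> exists2 e, 0 < e &
      forall p, c < p -> p < c + e -> p < 1 -> a - eta <= field phi p.
    move=> eta0; case: hc => [pc'|happ]; first exact: (field_near pc' c1 so g).
    have [q [/andP[cq qe] q1 hq]] := happ (Num.min (eta / 2) (d - c))
      (ltac:(by rewrite lt_min divr_gt0// subr_gt0)).
    have qd : q < d by move: qe; rewrite /Num.min; case: ifP => ?; lra.
    have hq' : (1 + mu) * (a - eta / 2) * (q - c) < mu * (u q - u c).
      apply: le_lt_trans hq; apply: ler_wpM2r; first lra.
      by apply: ler_wpM2l; [exact: ltW|rewrite lerB// ge_min lexx].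
    pose C := mu * L + (1 + mu) * `|a - eta / 2| + 1.
    have C0 : 0 < C.
      have h1 : 0 <= mu * L by apply: mulr_ge0 => //; exact: ltW.
      have h2 : 0 <= (1 + mu) * `|a - eta / 2| by apply: mulr_ge0 => //; lra.
      by rewrite /C; lra.
    pose e := Num.min ((q - c) / 2) ((1 + mu) * (eta / 2) * ((q - c) / 2) / C).
    have e0 : 0 < e.
      rewrite lt_min; apply/andP; split; first lra.
      apply: divr_gt0 => //; apply: mulr_gt0; last lra.
      by apply: mulr_gt0; lra.
    exists e => // p cp; rewrite -ltrBlDl lt_min => /andP[pe1 pe2] p1.
    have pq : p < q by lra.
    have h1 := near_part p q cp pq (ltW qd).
    have qp0 : 0 < (1 + mu) * (q - p) by apply: mulr_gt0; lra.
    rewrite leNgt; apply/negP => hlt.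
    have h2 : (p - c) * C < (1 + mu) * (eta / 2) * ((q - c) / 2).
      by rewrite -ltr_pdivlMr.
    have h3 : 0 < (a - eta - field phi p) * ((1 + mu) * (q - p)).
      by apply: mulr_gt0 => //; lra.
    have h4 : 0 <= (1 + mu) * (eta / 2) * (q - p - (q - c) / 2).
      by apply: mulr_ge0; [apply: mulr_ge0; lra|lra].
    have h5 : mu * (u p - u c) <= mu * (L * (p - c)).
      by rewrite ler_pM2l//; exact: (u_le uL (ltW cp)).
    have h6 : - ((1 + mu) * `|a - eta / 2| * (p - c)) <= (1 + mu) * (a - eta / 2) * (p - c).
      rewrite -mulNr; apply: ler_wpM2r; first lra.
      rewrite -mulrN; apply: ler_wpM2l; first lra.
      by rewrite lerNl; have := ler_norm (- (a - eta / 2)); rewrite normrN; lra.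
    move: h1 hq' h2 h3 h4 h5 h6; rewrite /sbelow_line /C; lra.
  have [e e0 he] := far_persist pc cd d1 g ha hF.
  exists (Num.min e (d - c)); first by rewrite lt_min e0 subr_gt0.
  move=> p cp; rewrite -ltrBlDl lt_min => /andP[pe pd] p1 q pq q1.
  have pe' : p < c + e by lra.
  have [dq|qd] := leP d q; first exact: he.
  by apply: near_part => //; exact: ltW.
Qed.

End Persistence.

(** * One run of the algorithm *)

Section UpRun.
Context {R : realType}.
Variables (u : R -> R) (ps mu L : R) (cs : seq R).
Hypotheses (mu_gt0 : 0 < mu) (ps_ge0 : 0 <= ps) (L_ge0 : 0 <= L).
Hypothesis (uL : forall p q, `|u p - u q| <= L * `|p - q|).
Hypothesis (ucs : breakpoints u cs).
Implicit Types (phi W dW : R -> R) (a p q c d : R).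

Local Notation gap := (ode_gap u mu).
Local Notation field := (ode_field u ps mu).
Local Notation below := (below_line u mu).
Local Notation sbelow := (sbelow_line u mu).
Local Notation slope := (slope u ps mu).
Local Notation a_up := (a_up u ps mu).
Local Notation rho_up := (rho_up u ps mu).
Local Notation attained := (attained u ps mu).

Definition lipschitz_on (f : R -> R) c d := exists2 C, 0 <= C &
  forall x y, c <= x <= d -> c <= y <= d -> `|f x - f y| <= C * `|x - y|.

Lemma lipschitz_on_eq f f' c d : (forall x, c <= x <= d -> f x = f' x) ->
  lipschitz_on f c d -> lipschitz_on f' c d.
Proof.
move=> ff [C C0 h]; exists C => // x y xcd ycd.
by rewrite -!ff//; exact: h.
Qed.

Lemma lipschitz_on_glue f b c d : b <= c -> c <= d ->
  lipschitz_on f b c -> lipschitz_on f c d -> lipschitz_on f b d.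
Proof.
move=> bc cd [C1 C10 h1] [C2 C20 h2]; exists (Num.max C1 C2).
  by rewrite le_max C10.
have ub1 : C1 <= Num.max C1 C2 by rewrite le_max lexx.
have ub2 : C2 <= Num.max C1 C2 by rewrite le_max lexx orbT.
suff W x y : b <= x -> x <= y -> y <= d -> `|f x - f y| <= Num.max C1 C2 * `|x - y|.
  move=> x y /andP[bx xd] /andP[by_ yd]; have [xy|yx] := leP x y; first exact: W.
  by rewrite distrC (distrC x); apply: W => //; exact: ltW.
move=> bx xy yd.
have [yc|cy] := leP y c.
  apply: (le_trans (h1 x y _ _)); [lra..|].
  by rewrite ler_wpM2r.
have [cx|xc] := leP c x.
  apply: (le_trans (h2 x y _ _)); [lra..|].
  by rewrite ler_wpM2r.
have -> : f x - f y = (f x - f c) + (f c - f y) by ring.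
have -> : `|x - y| = `|x - c| + `|c - y|.
  by rewrite !ler0_norm ?subr_le0 ?(ltW xc) ?(ltW cy)//; ring.
apply: (le_trans (ler_normD _ _)); rewrite mulrDr lerD//.
  apply: (le_trans (h1 x c _ _)); [lra..|].
  by rewrite ler_wpM2r.
apply: (le_trans (h2 c y _ _)); [lra..|].
by rewrite ler_wpM2r.
Qed.

Lemma supergrad_eq W dW W' dW' c d : (forall x, c <= x <= d -> W x = W' x) ->
  (forall x, c <= x <= d -> dW x = dW' x) ->
  supergrad W dW c d -> supergrad W' dW' c d.
Proof. by move=> h h' sg x y hx hy; rewrite -!h// -h'//; exact: sg. Qed.

Lemma supergrad_cat W dW b c d : b <= c -> c <= d -> supergrad W dW b c ->
  supergrad W dW c d -> supergrad W dW b d.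
Proof.
move=> bc cd sl; apply: supergrad_glue => //; exists (dW c); split => //.
apply: supergrad_eq sl => // x /andP[_ xc]; case: ltP => // cx.
by congr dW; apply/eqP; rewrite eq_le xc.
Qed.

Lemma supergrad_lipschitz W dW c d : supergrad W dW c d -> c <= d ->
  lipschitz_on W c d.
Proof.
move=> sg cd; exists (`|dW c| + `|dW d|); first by rewrite addr_ge0.
suff H x y : c <= x -> x <= y -> y <= d -> `|W x - W y| <= (`|dW c| + `|dW d|) * `|x - y|.
  move=> x y /andP[cx xd] /andP[cy yd]; have [xy|yx] := leP x y; first exact: H.
  by rewrite distrC (distrC x); apply: H => //; exact: ltW.
move=> cx xy yd.
have xcd : c <= x <= d by lra.
have ycd : c <= y <= d by lra.
have h1 := sg x y xcd ycd; have h2 := sg y x ycd xcd.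
have h3 := supergrad_nonincr sg (lexx c) cx (le_trans xy yd).
have h4 := supergrad_nonincr sg (le_trans cx xy) yd (lexx d).
rewrite (distrC x) (ger0_norm (_ : 0 <= y - x)) ?subr_ge0//.
have n1 := ler_norm (dW c); have n2 := ler_norm (- dW d); rewrite normrN in n2.
have p1 := normr_ge0 (dW c); have p2 := normr_ge0 (dW d).
have yx0 : 0 <= y - x by lra.
have m1 : 0 <= (`|dW c| + `|dW d| - dW x) * (y - x) by apply: mulr_ge0; lra.
have m2 : 0 <= (`|dW c| + `|dW d| + dW y) * (y - x) by apply: mulr_ge0; lra.
by rewrite ler_norml; lra.
Qed.

(** Equality in the stationary Bellman equation; at [ps] it means [W ps = u ps]. *)
Definition good W dW x := gap W x = dW x * (x - ps).

(* Where Player 1 can secure [W]: either directly, or by splitting the belief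
   between two such points along which [W] is affine. *)
Definition tame W dW lo hi x := good W dW x \/
  exists y z, [/\ lo <= y, y < z, z <= hi, y <= x <= z &
    [/\ good W dW y, good W dW z & W x * (z - y) = W y * (z - x) + W z * (x - y)]].

(** [up_lip] concerns the product because this is the quantity that remains Lipschitz across [ps].
    [up_tame] spares points before [p0], whose splitting uses an end on the other side of [ps].
    [up_ps] compares the slope at [ps] with the initial one [a0], for gluing the two halves. *)
Record up_inv (a0 p0 p : R) W dW : Prop := UpInv {
  up_range : [/\ ps <= p, ps <= p0 <= p & p <= 1];
  up_sg : supergrad W dW ps p;
  up_upper : forall x, ps <= x <= p -> gap W x <= dW x * (x - ps);
  up_lip : lipschitz_on (fun x => dW x * (x - ps)) ps p;
  up_tame : forall x, ps <= x <= p -> x <= p0 \/ tame W dW ps p x;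
  up_good : good W dW p;
  up_below : forall q, p < q -> q <= 1 -> below (dW p) p q;
  up_a : p < 1 -> a_up p W = dW p;
  up_ps : dW ps <= a0;
  up_good0 : good W dW p0 }.

Definition ode_exit p phi : R :=
  let E := [set q | p < q < 1 /\ q < rho_up q phi] in
  if `[< E !=set0 >] then inf E else 1.

(** A relation rather than a function, so that the reflected decreasing part satisfies it too: that
    part follows its own choice of solution, and only the values up to [p'] matter. *)
Definition up_step p W p' W' : Prop := (forall q, q <= p -> W' q = W q) /\
  if p < rho_up p W then
    p' = rho_up p W /\ forall q, p < q -> q <= p' -> W' q = W p + (q - p) * a_up p W
  else exists phi, [/\ ode_solution u ps mu `[p, 1] p (W p) phi,
    p' = ode_exit p phi & forall q, p < q -> q <= p' -> W' q = phi q].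

Lemma rho_up_eq f f' q : f q = f' q -> rho_up q f = rho_up q f'.
Proof.
move=> ff; have ss p' : slope f q p' = slope f' q p' by rewrite /Defs.slope ff.
have aa : a_up q f = a_up q f'.
  by rewrite /Defs.a_up; congr sup; apply: eq_imagel => x _; exact: ss.
rewrite /Defs.rho_up aa.
by under eq_fun do rewrite ss.
Qed.

Lemma tame_extend W dW W' dW' p p' x : p <= p' ->
  (forall y, ps <= y <= p -> W y = W' y) ->
  (forall y, ps <= y <= p -> dW y = dW' y) ->
  ps <= x <= p -> tame W dW ps p x -> tame W' dW' ps p' x.
Proof.
move=> pp hW hd xp.
have good_ext y : ps <= y <= p -> good W dW y -> good W' dW' y.
  by move=> yp; rewrite /good /ode_gap hW// hd.
case=> [g|[y [z [psy yz zp /andP[yx xz] [gy gz E]]]]]; first by left; exact: good_ext.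
have yp : ps <= y <= p by lra.
have zp' : ps <= z <= p by lra.
right; exists y, z; split => //; first lra.
  by rewrite yx.
by rewrite -!hW//; split => //; exact: good_ext.
Qed.

(** As [p'] attains the supremum [dW p], the segment ends at a good point with unchanged slope; as
    it is the largest maximiser, the test is strict beyond it. The last clause serves the
    termination argument. *)
Lemma linear_step a0 p0 p W dW p' W' : up_inv a0 p0 p W dW -> p < 1 ->
  up_step p W p' W' -> p < rho_up p W ->
  [/\ p < p', exists dW', up_inv a0 p0 p' W' dW' &
   ps < p -> exists2 x, x \in 1 :: cs & p < x <= p'].
Proof.
move=> [[psp /andP[psp0 p0p] p1'] sg upper lip tm gd bl ap dps gd0] p1 [WW hstep] rp.
move: hstep; rewrite rp ap// => -[p'E W'E].
have g : gap W p = dW p * (p - ps) by exact: gd.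
have at_p : attained W p by apply/lt_rho_up.
have [pr r1 aE alt] := rho_up_attained mu_gt0 L_ge0 uL psp g at_p.
rewrite -p'E in pr r1 aE alt; rewrite ap// in aE alt.
have psp' : ps < p' by lra.
have den0 : den ps mu p p' != 0 by rewrite gt_eqF// den_gt0.
have touch : mu * (u p' - W p) = dW p * (p' - ps + mu * (p' - p)).
  by rewrite aE /Defs.slope divfK.
have touch' : mu * (u p' - u p) = (1 + mu) * dW p * (p' - p).
  by move: g touch; rewrite /ode_gap; lra.
pose d' q := if q <= p then dW q else dW p.
have Waff q : p <= q -> q <= p' -> W' q = W p + (q - p) * dW p.
  rewrite le_eqVlt => /predU1P[<- _|pq qp']; last exact: W'E.
  by rewrite WW// subrr mul0r addr0.
have daff q : p <= q -> d' q = dW p.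
  rewrite /d'; case: (leP q p) => // qp pq.
  by congr dW; apply/eqP; rewrite eq_le qp.
have WW0 q : ps <= q <= p -> W q = W' q by move=> /andP[_ qp]; rewrite WW.
have dd0 q : ps <= q <= p -> dW q = d' q by rewrite /d' => /andP[_ ->].
have W'p' : W' p' = W p + (p' - p) * dW p by apply: Waff => //; exact: ltW.
have d'p' : d' p' = dW p by apply: daff; exact: ltW.
have d'p : d' p = dW p by apply: daff.
have gp' : gap W' p' = d' p' * (p' - ps).
  by rewrite d'p' /ode_gap W'p'; move: touch; lra.
have gp : gap W' p = d' p * (p - ps) by rewrite d'p /ode_gap -WW0 ?psp ?lexx.
have sg' : supergrad W' d' p p'.
  move=> x y /andP[px xp'] /andP[py yp'].
  by rewrite !Waff// daff//; lra.
have bl' q : p' < q -> q <= 1 -> sbelow (d' p') p' q.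
  move=> p'q q1; have := alt q p'q q1.
  rewrite (slope_ltE mu_gt0 psp (lt_trans pr p'q) g) d'p' /sbelow_line.
  by move: touch'; lra.
split => //.
  exists d'; split.
  - by split => //; rewrite ?psp0 ?(le_trans p0p) ?ltW//; lra.
  - apply: supergrad_cat (ltW pr) _ sg' => //.
    exact: supergrad_eq sg.
  - move=> x /andP[psx xp'].
    have [xp|px] := leP x p.
      have xx : ps <= x <= p by rewrite psx.
      by rewrite /ode_gap -WW0// -dd0//; exact: upper.
    have px' := ltW px; rewrite daff// /ode_gap Waff//.
    have h := bl x px (le_trans xp' r1).
    by move: g h; rewrite /below_line /ode_gap; lra.
  - apply: lipschitz_on_glue psp (ltW pr) _ _.
      by apply: lipschitz_on_eq lip => x xp; rewrite dd0.
    exists `|dW p| => // x y /andP[px _] /andP[py _].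
    by rewrite !daff// -mulrBr normrM opprB addrA subrK.
  - move=> x /andP[psx xp'].
    have [xp|px] := leP x p.
      have xx : ps <= x <= p by rewrite psx.
      have [?|h] := tm x xx; first by left.
      by right; apply: tame_extend h => //; exact: ltW.
    right; right; exists p, p'; split => //; first by rewrite xp' ltW.
    split => //; rewrite !Waff ?(ltW px) ?(ltW pr)//.
    by ring.
  - exact: gp'.
  - by move=> q p'q q1; apply/ltW/bl'.
  - move=> p'1; apply: (a_up_eq mu_gt0 L_ge0 uL psp' p'1 gp').
    by move=> q p'q q1; apply/ltW/bl'.
  - by rewrite -dd0 // psp lexx.
  - by rewrite /good /ode_gap -WW0 -?dd0 ?psp0.
move=> pps; have [p'1|p'1] := leP 1 p'.
  by exists 1; rewrite ?inE ?eqxx// p1.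
(* Otherwise one piece of [u] extends from [p] to some [d > p']. If it is convex, its slope after
   [p'] is at least that of the touching chord, against [bl']; if strictly concave, its value at the
   midpoint of [[p, p']] is above that chord, against [bl]. *)
apply: contrapT => hno.
have ncs x : x \in cs -> ~~ (p < x <= p').
  move=> xcs; apply/negP => h; apply: hno; exists x => //.
  by rewrite inE xcs orbT.
have [d [p'd d1 hd]] := next_breakpoint cs p'1.
have pd : p < d by lra.
have [|cvx|ccv] := ucs pd.
- move=> x xcs; apply/negP => /andP[px xd].
  have := ncs x xcs; rewrite px/= -ltNge => p'x.
  by have := hd x xcs; rewrite p'x xd.
- have h1 := cvx p p' d (lexx _) pr p'd (lexx _).
  have h2 := bl' d p'd d1.
  move: h2; rewrite /sbelow_line d'p' => h2.
  have h3 : mu * (u p' - u p) * (d - p') <= mu * (u d - u p') * (p' - p).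
    by rewrite -!mulrA ler_pM2l.
  have pp'0 : 0 < p' - p by lra.
  have h4 : mu * (u d - u p') * (p' - p) < (1 + mu) * dW p * (d - p') * (p' - p).
    by rewrite ltr_pM2r.
  by move: h3 h4; rewrite touch'; lra.
- pose m := (p + p') / 2.
  have h1 := @ccv p m p' (lexx _) (ltac:(rewrite /m; lra)) (ltac:(rewrite /m; lra)) (ltW p'd).
  have pm : p < m by rewrite /m; lra.
  have m1 : m <= 1 by rewrite /m; lra.
  have h2 := bl m pm m1; rewrite /below_line in h2.
  have h3 : mu * (u p' - u m) * (m - p) < mu * (u m - u p) * (p' - m).
    by rewrite -!mulrA ltr_pM2l.
  have mE1 : m - p = (p' - p) / 2 by rewrite /m; field.
  have mE2 : p' - m = (p' - p) / 2 by rewrite /m; field.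
  have pp'0 : 0 < (p' - p) / 2 by lra.
  move: h3; rewrite mE1 mE2 ltr_pM2r// => h3.
  by move: h2; rewrite mE1; move: touch'; lra.
Qed.

(** Persistence at [p] separates the exit point from [p]. The final alternative says that a step
    which stops early is followed by a linear one. *)
Lemma ode_step a0 p0 p W dW p' W' : up_inv a0 p0 p W dW -> p < 1 ->
  up_step p W p' W' -> ~~ (p < rho_up p W) ->
  [/\ p < p', exists dW', up_inv a0 p0 p' W' dW' &
   p' = 1 \/ p' < rho_up p' W'].
Proof.
move=> [[psp /andP[psp0 p0p] p1'] sg upper lip tm gd bl ap dps gd0] p1 [WW hstep] rp.
move: hstep; rewrite (negbTE rp) => -[phi [sol p'E W'E]].
have [so phip] := ode_solution_solves sol.
have g : gap W p = dW p * (p - ps) by exact: gd.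
have gphi : gap phi p = dW p * (p - ps) by rewrite /ode_gap phip.
have nat : ~ attained W p by move/lt_rho_up => h; move: rp; rewrite h.
(* Since [rho_up] stays at [p], the supremum is not attained, which makes the test strict; at [ps]
   it also gives [approached], because [dW ps] is that supremum. *)
have [sb appr] : (forall q, p < q -> q <= 1 -> sbelow (dW p) p q) /\
    (ps < p \/ approached u mu (dW p) p).
  move: psp; rewrite le_eqVlt => /predU1P[psE|psp].
    have Wps : W ps = u ps.
      move: g; rewrite -psE subrr mulr0 /ode_gap => /eqP.
      by rewrite mulf_eq0 gt_eqF//= subr_eq0 => /eqP.
    rewrite -psE in p1 nat ap *.
    have := not_attained_ps mu_gt0 L_ge0 uL p1 Wps nat.
    by rewrite ap// => -[? ?]; split => //; right.
  split; last by left.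
  have -> : dW p = field W p by rewrite /ode_field g mulfK// subr_eq0 gt_eqF.
  exact: (not_attained_gt mu_gt0 L_ge0 uL psp p1 nat).
have [e e0 he] := persistence mu_gt0 ps_ge0 L_ge0 uL ucs psp p1 so gphi sb appr.
have exit_step q : p < q -> q < 1 -> ~~ (q < rho_up q phi) ->
    forall q', q < q' -> q' <= 1 -> sbelow (field phi q) q q'.
  move=> pq q1 nr; apply: (not_attained_gt mu_gt0 L_ge0 uL (le_lt_trans psp pq) q1).
  by move/lt_rho_up => h; move: nr; rewrite h.
have no_exit q : ps < q -> q < 1 ->
    (forall q', q < q' -> q' <= 1 -> sbelow (field phi q) q q') -> ~~ (q < rho_up q phi).
  move=> psq q1 hs; apply/negP => /lt_rho_up.
  have gq : gap phi q = field phi q * (q - ps) by rewrite fieldK.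
  apply: (sbelow_not_attained mu_gt0 (ltW psq) gq) => //.
  apply: (a_up_eq mu_gt0 L_ge0 uL psq q1 gq) => q' qq' q'1.
  exact/ltW/hs.
pose E := [set q | p < q < 1 /\ q < rho_up q phi].
have Elb : has_lbound E by exists p => q [/andP[/ltW]].
have [pp' p'1 ltp' hexit] : [/\ p < p', p' <= 1,
    forall q, p < q -> q < p' -> ~~ (q < rho_up q phi) &
    p' = 1 \/ p' < rho_up p' phi].
  rewrite p'E /ode_exit -/E; case: asboolP => [E0|nE]; last first.
    split => //; last by left.
    by move=> q pq q1; apply/negP => h; apply: nE; exists q; split => //; rewrite pq.
  have infE q : E q -> inf E <= q by exact: ge_inf.
  have [q0 Eq0] := E0.
  have pe : p < inf E.
    apply: (@lt_le_trans _ _ (Num.min (p + e) 1)); first by rewrite lt_min ltrDl e0.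
    apply: lb_le_inf => // q [/andP[pq q1] hq].
    rewrite leNgt lt_min; apply/negP => /andP[qe _].
    by have := no_exit q (le_lt_trans psp pq) q1 (he q pq qe q1); rewrite hq.
  have inf1 : inf E < 1.
    by apply: (le_lt_trans (infE q0 Eq0)); case: Eq0 => /andP[].
  split => //; first exact: ltW.
  - move=> q pq qi; apply/negP => h.
    have : inf E <= q by apply: infE; split => //; rewrite pq (lt_trans qi).
    by rewrite leNgt qi.
  (* If the infimum were not itself an exit, the test would be strict there, and persistence from it
     would exclude all exits just after it. *)
  - right; apply: contrapT => /negP nr.
    have psi : ps < inf E by lra.
    have gi : gap phi (inf E) = field phi (inf E) * (inf E - ps) by rewrite fieldK.
    have so' := solvesW (ltW pe) (lexx 1) so.
    have [e' e'0 he'] := persistence mu_gt0 ps_ge0 L_ge0 uL ucs (ltW psi) inf1 so' gi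
      (exit_step _ pe inf1 nr) (or_introl psi).
    have [q Eq qe'] := inf_adherent e'0 (conj E0 Elb).
    have := infE q Eq; rewrite le_eqVlt => /predU1P[iE|iq].
      by move: Eq => [_ hq]; move: nr; rewrite iE hq.
    move: Eq => [/andP[pq q1] hq].
    by have := no_exit q (lt_trans psi iq) q1 (he' q iq qe' q1); rewrite hq.
have W'phi q : p <= q -> q <= p' -> W' q = phi q.
  rewrite le_eqVlt => /predU1P[<- _|pq qp']; last exact: W'E.
  by rewrite WW// phip.
have psp' : ps < p' by lra.
have sop' : solves u ps mu phi p p' by apply: solvesW so.
have test q q' : p < q -> q < p' -> q < q' -> q' <= 1 -> sbelow (field phi q) q q'.
  move=> pq qp' qq' q'1; apply: exit_step => //; first lra.
  exact: ltp'.
(* At the end point only the weak test survives, as a limit of strict ones. The window starts at a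
   midpoint [c > ps], where the field is continuous even if [p = ps]. *)
have test' q : p' < q -> q <= 1 -> below (field phi p') p' q.
  move=> p'q q1.
  pose c := (p + p') / 2.
  pose h x := (1 + mu) * (field phi x * (q - x)) - mu * (u q - u x).
  have cc : ps < c by rewrite /c; lra.
  have fc : {within `[c, p'], continuous (field phi)}.
    apply: (field_continuous uL cc).
    by apply: continuous_subspaceW sop'.1; apply: subset_itv; rewrite bnd_simp// /c; lra.
  have hc : {within `[c, p'], continuous h}.
    apply: within_continuousB; apply: within_continuousM;
      (try exact: (continuous_subspaceT (@cst_continuous _ _ _))).
      apply: within_continuousM fc _.
      by apply: within_continuousB;
        [exact: (continuous_subspaceT (@cst_continuous _ _ _))|
         apply: continuous_subspaceT => x; exact: cvg_id].
    by apply: within_continuousB;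
      [exact: (continuous_subspaceT (@cst_continuous _ _ _))|
       apply: continuous_subspaceT; exact: (u_continuous uL)].
  have : 0 <= h p'.
    apply: (within_continuous_closed_ge0 hc).
      by rewrite lexx andbT /c; lra.
    move=> e1 e10; pose y := Num.max c (p' - e1 / 2).
    have cy : c <= y by rewrite le_max lexx.
    have yp' : y < p' by rewrite gt_max /c; lra.
    have ye : p' - e1 / 2 <= y by rewrite le_max lexx orbT.
    exists y; split; first by rewrite cy ltW.
      by rewrite ger0_norm ?subr_ge0 ?ltW//; lra.
    have py : p < y by apply: lt_le_trans cy; rewrite /c; lra.
    have := test y q py yp' (lt_trans yp' p'q) q1.
    by rewrite /sbelow_line /h; lra.
  by rewrite /h /below_line; lra.
pose d' q := if q <= p then dW q else field phi q.
have WW0 q : ps <= q <= p -> W q = W' q by move=> /andP[_ qp]; rewrite WW.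
have dd0 q : ps <= q <= p -> dW q = d' q by rewrite /d' => /andP[_ ->].
have d'p' : d' p' = field phi p' by rewrite /d' leNgt pp'.
have d'p : d' p = dW p by rewrite /d' lexx.
have d'phi q : p < q -> d' q = field phi q by rewrite /d' leNgt => ->.
have gall q : p <= q -> q <= p' -> gap W' q = d' q * (q - ps).
  rewrite le_eqVlt => /predU1P[<- _|pq qp'].
    by rewrite d'p /ode_gap -WW0 ?psp ?lexx.
  by rewrite d'phi// fieldK ?(le_lt_trans psp)// /ode_gap W'phi ?(ltW pq).
have sg' : supergrad W' d' p p'.
  move: (psp); rewrite le_eqVlt => /predU1P[psE|pspl].
    have phips : phi ps = u ps.
      move: gphi; rewrite -psE subrr mulr0 /ode_gap => /eqP.
      by rewrite mulf_eq0 gt_eqF//= subr_eq0 => /eqP.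
    have := @field_supergrad_start _ u ps mu L mu_gt0 uL phi (dW p) p' (ltW psp').
    rewrite -psE in sop' sb test W'phi d'p d'phi *.
    move=> /(_ sop' phips) h.
    apply: supergrad_eq (h _ _).
    - by move=> x /andP[? ?]; rewrite W'phi.
    - move=> x /andP[psx xp']; case: eqVneq => [->//|xps].
      by rewrite d'phi// lt_neqAle eq_sym xps.
    - by move=> q psq qp'; apply/ltW/sb => //; lra.
    - by move=> q q' psq qq' q'p'; apply/ltW/test => //; lra.
  have fp : field phi p = dW p by rewrite /ode_field gphi mulfK// subr_eq0 gt_eqF.
  apply: supergrad_eq (@field_supergrad _ u ps mu L mu_gt0 uL phi p p' pspl sop' _).
  - by move=> x /andP[? ?]; rewrite W'phi.
  - move=> x /andP[]; rewrite le_eqVlt => /predU1P[<- _|px _].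
      by rewrite d'p.
    by rewrite d'phi.
  - move=> q q'; rewrite le_eqVlt => /predU1P[<-|pq] qq' q'p'.
      by rewrite fp; apply/ltW/sb => //; lra.
    by apply/ltW/test => //; lra.
split => //.
- exists d'; split.
  + by split => //; rewrite ?psp0 ?(le_trans p0p) ?ltW//; lra.
  + by apply: supergrad_cat (ltW pp') _ sg' => //; exact: supergrad_eq sg.
  + move=> x /andP[psx xp']; have [xp|px] := leP x p.
      have xx : ps <= x <= p by rewrite psx.
      by rewrite /ode_gap -WW0// -dd0//; exact: upper.
    by rewrite gall// ltW.
  + apply: lipschitz_on_glue psp (ltW pp') _ _.
      by apply: lipschitz_on_eq lip => x xp; rewrite dd0.
    have [B B0 hB] := supergrad_lipschitz sg' (ltW pp').
    exists (mu * (L + B)); first by apply: mulr_ge0; [exact: ltW|exact: addr_ge0].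
    move=> x y xx yy; move: (xx) (yy) => /andP[? ?] /andP[? ?].
    rewrite -!gall// /ode_gap -mulrBr normrM (gtr0_norm mu_gt0) -mulrA ler_pM2l//.
    have -> : u x - W' x - (u y - W' y) = (u x - u y) - (W' x - W' y) by ring.
    by rewrite (le_trans (ler_normB _ _))// mulrDl lerD ?uL ?hB.
  + move=> x /andP[psx xp']; have [xp|px] := leP x p.
      have xx : ps <= x <= p by rewrite psx.
      have [?|h] := tm x xx; first by left.
      by right; apply: tame_extend h => //; exact: ltW.
    by right; left; rewrite /good gall// ltW.
  + by rewrite /good gall// ltW.
  + by move=> q p'q q1; rewrite d'p'; exact: test'.
  + move=> p'lt1; apply: (a_up_eq mu_gt0 L_ge0 uL psp' p'lt1).
      by rewrite gall// ltW.
    by move=> q p'q q1; rewrite d'p'; exact: test'.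
  + by rewrite -dd0 // psp lexx.
  + by rewrite /good /ode_gap -WW0 -?dd0 ?psp0.
- case: hexit => [->|h]; [by left|right].
  by rewrite (@rho_up_eq W' phi)// W'phi// ltW.
Qed.

End UpRun.

(** * Progress and termination of a sequence of steps *)

Section UpRunSequence.
Context {R : realType}.
Variables (u : R -> R) (ps mu L : R) (cs : seq R).
Hypotheses (mu_gt0 : 0 < mu) (ps_ge0 : 0 <= ps) (L_ge0 : 0 <= L).
Hypothesis (uL : forall p q, `|u p - u q| <= L * `|p - q|).
Hypothesis (ucs : breakpoints u cs).
Variables (a0 p0 : R) (W0 dW0 : R -> R) (st : nat -> R * (R -> R)).
Hypothesis inv0 : up_inv u ps mu a0 p0 p0 W0 dW0.
Hypothesis st0 : st 0%N = (p0, W0).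
Hypothesis st_step : forall k dW, up_inv u ps mu a0 p0 (st k).1 (st k).2 dW ->
  (st k).1 < 1 -> up_step u ps mu (st k).1 (st k).2 (st k.+1).1 (st k.+1).2.
Hypothesis st_stop : forall k, 1 <= (st k).1 -> st k.+1 = st k.

Lemma run_inv k : exists dW, up_inv u ps mu a0 p0 (st k).1 (st k).2 dW.
Proof.
elim: k => [|k [dW IH]]; first by rewrite st0; exists dW0.
have [h1|h1] := leP 1 (st k).1; first by rewrite st_stop//; exists dW.
have [r|r] := boolP ((st k).1 < Defs.rho_up u ps mu (st k).1 (st k).2).
  by have [] := linear_step mu_gt0 L_ge0 uL ucs IH h1 (st_step IH h1) r.
by have [] := ode_step mu_gt0 ps_ge0 L_ge0 uL ucs IH h1 (st_step IH h1) r.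
Qed.

Lemma run_le1 k : (st k).1 <= 1.
Proof. by have [dW [[]]] := run_inv k. Qed.

Lemma run_increasing k : (st k).1 < 1 -> (st k).1 < (st k.+1).1.
Proof.
move=> h1; have [dW IH] := run_inv k.
have [r|r] := boolP ((st k).1 < Defs.rho_up u ps mu (st k).1 (st k).2).
  by have [] := linear_step mu_gt0 L_ge0 uL ucs IH h1 (st_step IH h1) r.
by have [] := ode_step mu_gt0 ps_ge0 L_ge0 uL ucs IH h1 (st_step IH h1) r.
Qed.

Lemma count_lt_sub (T : eqType) (a b : pred T) (s : seq T) (x : T) :
  (forall y, a y -> b y) -> x \in s -> b x -> ~~ a x ->
  (count a s < count b s)%N.
Proof.
move=> ab + bx ax; elim: s => //= y s IH; rewrite inE => /predU1P[<-|/IH h].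
  by rewrite bx (negbTE ax) add0n add1n ltnS; apply: sub_count.
by rewrite -addnS leq_add//; case: (a y) (ab y) => // /(_ isT) ->.
Qed.

(** The measure is the number of points of [1 :: cs] to the right of the current one: a linear step
    lowers it, and a step of the differential equation does not raise it and either ends the run or
    precedes a linear step. *)
Lemma run_reaches k : ps < (st k).1 -> exists j, (st j).1 = 1.
Proof.
pose m p := count (fun x => p < x) (1 :: cs).
have m_lt p p' x : p <= p' -> x \in 1 :: cs -> p < x <= p' -> (m p' < m p)%N.
  move=> pp xcs /andP[px xp']; apply: (@count_lt_sub _ _ _ _ x) => //.
    by move=> y; apply: le_lt_trans.
  by rewrite -leNgt.
have m_le p p' : p <= p' -> (m p' <= m p)%N.
  by move=> pp; apply: sub_count => y; apply: le_lt_trans.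
have lin i : ps < (st i).1 -> (st i).1 < 1 ->
    (st i).1 < Defs.rho_up u ps mu (st i).1 (st i).2 ->
    (m (st i.+1).1 < m (st i).1)%N.
  move=> psi i1 r; have [dW IH] := run_inv i.
  have [h1 _ /(_ psi)[x xcs hx]] :=
    linear_step mu_gt0 L_ge0 uL ucs IH i1 (st_step IH i1) r.
  by apply: m_lt hx => //; exact: ltW.
have [n] := ubnP (m (st k).1); elim: n k => // n IH k; rewrite ltnS => mn psk.
have [k1|k1] := leP 1 (st k).1.
  by exists k; apply/eqP; rewrite eq_le k1 run_le1.
have kk := run_increasing k1.
have psk1 := lt_trans psk kk.
have [r|r] := boolP ((st k).1 < Defs.rho_up u ps mu (st k).1 (st k).2).
  by apply: (IH k.+1) => //; apply: leq_trans mn; exact: lin.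
have [dW hinv] := run_inv k.
have [_ _ [h|h]] := ode_step mu_gt0 ps_ge0 L_ge0 uL ucs hinv k1 (st_step hinv k1) r.
  by exists k.+1.
have [k2|k2] := leP 1 (st k.+1).1.
  by exists k.+1; apply/eqP; rewrite eq_le k2 run_le1.
apply: (IH k.+2); last exact: lt_trans (run_increasing k2).
by apply: leq_trans mn; apply: leq_trans (lin _ psk1 k2 h) _; exact/m_le/ltW.
Qed.

Lemma run_terminates : exists j, (st j).1 = 1.
Proof.
have [ps0 _ _] := up_range inv0.
have [h1|h1] := leP 1 (st 0%N).1.
  by exists 0%N; apply/eqP; rewrite eq_le h1 run_le1.
apply: (@run_reaches 1%N).
by apply: le_lt_trans (run_increasing h1); rewrite st0.
Qed.

Lemma run_stable j k q : (j <= k)%N -> q <= (st j).1 -> (st k).2 q = (st j).2 q.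
Proof.
move=> /subnKC <-; elim: (k - j)%N => [|i IH] qj; first by rewrite addn0.
rewrite addnS -IH//.
have [h1|h1] := leP 1 (st (j + i)).1; first by rewrite st_stop.
have [dW hinv] := run_inv (j + i)%N.
have [-> //] := st_step hinv h1.
apply: (le_trans qj); elim: (i) => [|i' IH']; first by rewrite addn0.
rewrite addnS; apply: (le_trans IH').
have [h2|h2] := leP 1 (st (j + i')).1; first by rewrite st_stop.
exact/ltW/run_increasing.
Qed.

End UpRunSequence.

Section UpRunStart.
Context {R : realType}.
Variables (u : R -> R) (ps mu L : R).
Hypotheses (mu_gt0 : 0 < mu) (ps01 : 0 < ps < 1) (L_ge0 : 0 <= L).
Hypothesis (uL : forall p q, `|u p - u q| <= L * `|p - q|).

(** The factor [mu / (1 + mu)] makes [mu] times the difference of the two lines issued from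
    [(ps, c)] equal to [a0 * (x - ps)], so the majorant becomes the Bellman inequality and the
    contact at [p0] the equality. *)
Lemma up_inv_init c m p0 W0 : ps <= p0 -> p0 <= 1 ->
  (forall q, ps <= q -> q <= 1 -> u q <= c + m * (q - ps)) ->
  u p0 = c + m * (p0 - ps) ->
  (forall q, ps <= q -> q <= p0 -> W0 q = c + m * (mu / (1 + mu)) * (q - ps)) ->
  exists dW0, up_inv u ps mu (m * (mu / (1 + mu))) p0 p0 W0 dW0.
Proof.
move=> psp0 p01 maj up0 W0E; have /andP[ps0 ps1] := ps01.
pose a0 := m * (mu / (1 + mu)).
have a0E : (1 + mu) * a0 = mu * m.
  by rewrite /a0; field; rewrite gt_eqF//; move: mu_gt0; lra.
have lineE x : mu * (c + m * (x - ps) - (c + a0 * (x - ps))) = a0 * (x - ps).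
  transitivity ((mu * m - mu * a0) * (x - ps)); first by ring.
  by rewrite -a0E; ring.
have W0p0 : W0 p0 = c + a0 * (p0 - ps) by rewrite W0E.
have below q : p0 < q -> q <= 1 -> below_line u mu a0 p0 q.
  move=> pq q1; rewrite /below_line a0E up0 -mulrA ler_pM2l//.
  by have := maj q (le_trans psp0 (ltW pq)) q1; lra.
have goodE : ode_gap u mu W0 p0 = a0 * (p0 - ps).
  by rewrite /ode_gap up0 W0p0 lineE.
move: (psp0); rewrite le_eqVlt => /predU1P[psE|psp0'].
  have g : ode_gap u mu W0 p0 = a_up u ps mu p0 W0 * (p0 - ps).
    by rewrite goodE psE subrr !mulr0.
  (* When [p0 = ps] the interval is one point and the equality holds with any slope. The supremum is
     chosen, as [up_a] requires; the majorant bounds it by [a0]. *)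
  exists (fun=> a_up u ps mu p0 W0); split => //.
  - by rewrite psp0 lexx.
  - by move=> x y; rewrite -psE => /le_anti -> /le_anti ->; rewrite subrr mulr0 addr0.
  - by move=> x; rewrite {1}psE => /le_anti <-; rewrite g.
  - exists 0 => // x y; rewrite -psE => /le_anti -> /le_anti ->.
    by rewrite !subrr normr0 mulr0.
  - by move=> x /andP[_ xp]; left.
  - move=> q pq q1; rewrite /below_line -(slope_leE mu_gt0 psp0 pq g).
    exact: (slope_le_a_up mu_gt0 L_ge0 uL psp0 g pq q1).
  - rewrite -/a0; apply: ge_sup.
      by exists (slope u ps mu W0 p0 1); exists 1 => //=; rewrite in_itv/= lexx andbT -psE.
    move=> _ [q /= /[!in_itv]/= /andP[pq q1] <-].
    by rewrite (slope_leE mu_gt0 psp0 pq goodE); exact: below.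
exists (fun=> a0); split => //.
- by rewrite psp0 lexx.
- move=> x y /andP[px xp] /andP[py yp].
  by rewrite !W0E// -/a0; lra.
- move=> x /andP[px xp]; rewrite /ode_gap W0E// -/a0.
  by rewrite -[leRHS]lineE ler_pM2l// lerD2r maj// (le_trans xp).
- exists `|a0| => // x y _ _.
  by rewrite -mulrBr normrM opprB addrA subrK.
- by move=> x /andP[_ xp]; left.
- by move=> p01'; exact: (a_up_eq mu_gt0 L_ge0 uL psp0' p01' goodE).
Qed.

End UpRunStart.

(** * Existence of the solutions of the differential equation *)

Section OdeExistence.
Context {R : realType}.
Variables (u : R -> R) (ps mu L : R).
Hypotheses (mu_gt0 : 0 < mu) (ps_ge0 : 0 <= ps).
Hypothesis (uL : forall p q, `|u p - u q| <= L * `|p - q|).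

Lemma is_derive_has_derivative_within (D : set R) (f : R -> R) (p l : R) :
  is_derive p 1 f l -> has_derivative_within D f p l.
Proof.
move=> df.
have h : h^-1 *: ((f \o shift p) (h *: (1 : R)) - f p) @[h --> 0^'] --> l.
  have [d1 d2] := df; rewrite -d2; exact: d1.
apply/cvgrPdist_lt => e e0.
have /cvgrPdist_lt/(_ e e0) := h.
rewrite !near_withinE /= => /nbhs_ballP[eta /= eta0 he].
apply/nbhs_ballP; exists eta => //= x px xp _.
have := he (x - p); rewrite -ball_normE /ball_/= sub0r normrN distrC.
move: px; rewrite -ball_normE /ball_/= => px /(_ px).
rewrite subr_eq0 => /(_ xp).
by rewrite /GRing.scale/= mulr1 subrK mulrC.
Qed.

Definition pos_powR (c y : R) : R := (Num.max y 0) `^ c.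

Lemma pos_powR_continuous (c : R) : 0 < c -> continuous (pos_powR c).
Proof.
move=> c0 y.
have [y0|y0|->] := ltgtP y 0.
- suff : {near y, (fun=> 0) =1 pos_powR c}.
    have y0E : pos_powR c y = 0 by rewrite /pos_powR max_r ?ltW// powR0 ?gt_eqF.
    rewrite /continuous_at y0E => h.
    exact: cvg_trans (near_eq_cvg h) (cvg_cst _).
  near=> z; rewrite /pos_powR max_r ?powR0 ?gt_eqF//.
  by apply/ltW; near: z; exact: lt_nbhsl.
- have dy := is_derive1_powR c y0.
  apply/differentiable_continuous/derivable1_diffP.
  apply: (@near_eq_derivable _ _ _ (@powR R ^~ c)) => //.
  near=> z; rewrite /pos_powR max_l//.
  by apply/ltW; near: z; exact: lt_nbhsr.
- have p0E : pos_powR c 0 = 0 by rewrite /pos_powR maxxx powR0 ?gt_eqF.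
  rewrite /continuous_at p0E; apply/cvgrPdist_lt => e e0.
  near=> z; rewrite sub0r normrN ger0_norm ?powR_ge0//.
  have zc : Num.max z 0 < e `^ c^-1.
    rewrite gt_max powR_gt0// andbT; near: z.
    by apply: lt_nbhsl; exact: powR_gt0.
  have := gt0_ltr_powR c0 _ _ zc; rewrite !nnegrE le_max lexx orbT powR_ge0.
  by rewrite -powRrM mulVf ?gt_eqF// powRr1 ?ltW//; exact.
Unshelve. all: by end_near. Qed.

(** With [y = (p - ps) ^ mu], the equation says that the derivative of [y * phi] with respect to [y]
    is [U y]. This removes the singularity and avoids an improper integral of [(p - ps) ^ (mu - 1)];
    for [y <= 0] the truncation in [pos_powR] extends [U] by [u ps]. *)
Let U (y : R) : R := u (ps + pos_powR mu^-1 y).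

Let U_continuous : continuous U.
Proof.
move=> y; apply: (@continuous_comp _ _ _ (fun y => ps + pos_powR mu^-1 y) u).
  apply: cvgD; first exact: cvg_cst.
  by apply: pos_powR_continuous; rewrite invr_gt0.
exact: (lipschitz_continuous uL).
Qed.

(** The integral starts at -1 so that 0, the value of [Y] at [ps], is an interior point where [J] is
    differentiable. *)
Let J (y : R) : R := (\int[lebesgue_measure]_(t in `[-1, y]) U t)%R.

Let J_derive (y : R) : -1 < y -> y < 2 -> is_derive y 1 J (U y).
Proof.
move=> y1 y2.
have [||dJ JE] := @continuous_FTC1_closed R U (-1) y 2 y2 _ y1.
- apply: continuous_compact_integrable; first exact: segment_compact.
  exact: continuous_subspaceT.
- exact: U_continuous.
- by apply: DeriveDef; [exact: dJ|rewrite -derive1E; exact: JE].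
Qed.

Let Y (p : R) : R := (p - ps) `^ mu.

Let U_Y (p : R) : ps <= p -> U (Y p) = u p.
Proof.
move=> pp; rewrite /U /pos_powR /Y max_l ?powR_ge0// -powRrM mulfV ?gt_eqF//.
by rewrite powRr1 ?subr_ge0// addrC subrK.
Qed.

Let Y_gt0 (p : R) : ps < p -> 0 < Y p.
Proof. by move=> pp; rewrite powR_gt0// subr_gt0. Qed.

Let Y_le1 (p : R) : ps <= p -> p <= 1 -> Y p <= 1.
Proof.
move=> pp p1; rewrite -[leRHS]/((fun=> 1) mu) -powR1 ge0_ler_powR ?nnegrE ?subr_ge0 ?ler01 ?(ltW mu_gt0)//.
by move: ps_ge0; lra.
Qed.

Let Y_derive (p : R) : ps < p -> is_derive p 1 Y (mu / (p - ps) * Y p).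
Proof.
move=> pp; have p0 : 0 < p - ps by rewrite subr_gt0.
have d1 := is_derive1_powR mu p0.
have d2 : is_derive p 1 (fun p => p - ps) (1 - 0).
  exact: (is_deriveB (is_derive_id p 1) (is_derive_cst ps p 1)).
have h := @is_derive1_comp R (@powR R ^~ mu) (fun p => p - ps) p _ _ d1 d2.
apply: (is_derive_eq h); rewrite subr0 mulr1 -mulrA; congr (_ * _).
by rewrite /Y -(mulr_powRB1 (ltW p0) mu_gt0) mulKf ?gt_eqF.
Qed.

Let num (q k p : R) : R := k * Y q - J (Y q) + J (Y p).
Let phi0 (q k p : R) : R := num q k p / Y p.

Let phi0_derive (q k p : R) : ps < p -> Y p < 2 ->
  is_derive p 1 (phi0 q k) (mu * (u p - phi0 q k p) / (p - ps)).
Proof.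
move=> pp Y2.
have Y0 := Y_gt0 pp.
have dJ : is_derive p 1 (J \o Y) (U (Y p) * (mu / (p - ps) * Y p)).
  apply: is_derive1_comp; last exact: Y_derive.
  by apply: J_derive => //; apply: lt_trans Y0; rewrite oppr_lt0.
have dN : is_derive p 1 (num q k) (0 + U (Y p) * (mu / (p - ps) * Y p)).
  exact: (is_deriveD (is_derive_cst (k * Y q - J (Y q)) p 1) dJ).
have Yn0 : Y p != 0 by rewrite gt_eqF.
have dV := is_deriveV Yn0 (Y_derive pp).
apply: (is_derive_eq (is_deriveM dN dV)).
rewrite U_Y ?ltW// /GRing.scale/= /phi0 -[(Y p)^-1]/((Y p)^-1).
move: (num q k p) (Y p) Yn0 => n y yn0.
by field; rewrite yn0 /= subr_eq0 gt_eqF.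
Qed.

Lemma ode_solution_exists q k : ps <= q -> q < 1 -> (q = ps -> k = u q) ->
  exists phi, ode_solution u ps mu `[q, 1] q k phi.
Proof.
move=> psq q1 hk.
pose phi p := if p <= q then k else phi0 q k p.
exists phi.
have phiq : phi q = k by rewrite /phi lexx.
have dphi p : q < p -> p <= 1 ->
    is_derive p 1 phi (mu * (u p - phi p) / (p - ps)).
  move=> qp p1.
  have psp := le_lt_trans psq qp.
  have phip : phi p = phi0 q k p by rewrite /phi leNgt qp.
  rewrite phip; apply: (@near_eq_is_derive _ _ _ (phi0 q k)).
    by near=> z; rewrite /phi leNgt ifF//; apply/negbTE; rewrite negbK;
      near: z; exact: lt_nbhsr.
  apply: phi0_derive => //.
  by apply: (le_lt_trans (Y_le1 (ltW psp) p1)); rewrite ltr1n.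
have sol p : `[q, 1]%classic p -> p != q ->
    has_derivative_within `[q, 1] phi p (mu * (u p - phi p) / (p - ps)).
  rewrite /= in_itv/= => /andP[qp p1] pq.
  by apply/is_derive_has_derivative_within/dphi => //; rewrite lt_neqAle eq_sym pq.
split => //.
apply/subspace_continuousP => p; rewrite /= in_itv/= => /andP[].
rewrite le_eqVlt => /predU1P[<- _|qp p1]; last first.
  apply: cvg_within_filter; apply/differentiable_continuous/derivable1_diffP.
  by have [] := dphi p qp p1.
move: psq; rewrite le_eqVlt => /predU1P[psE|psq].
  rewrite -psE in phiq hk dphi sol *.
  (* Issued from [ps], the solution at [z] is the mean of [U] over [[0, Y z]], hence a value of [u]
     at a point between [ps] and [z]; this gives continuity at [ps]. *)
  have uL' z : ps < z -> z <= 1 -> `|phi z - phi ps| <= `|L| * `|z - ps|.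
    move=> psp p1.
    have Y0 := Y_gt0 psp; have Y1 := Y_le1 (ltW psp) p1.
    have phip : phi z = (J (Y z) - J 0) / Y z.
      rewrite /phi -psE leNgt psp /= /phi0 /num /Y subrr powR0 ?gt_eqF//.
      by rewrite mulr0 sub0r addrC.
    have [||xi] := @MVT R J U 0 (Y z) Y0.
    - move=> x; rewrite in_itv/= => /andP[x0 xY]; apply: J_derive; lra.
    - apply: derivable_within_continuous => x; rewrite in_itv/= => /andP[x0 xY].
      by have [] : is_derive x 1 J (U x) by apply: J_derive; lra.
    rewrite in_itv/= => /andP[xi0 xiY] E.
    rewrite phip E subr0 mulfK ?gt_eqF// phiq hk//.
    have t0 : 0 <= pos_powR mu^-1 xi by exact: powR_ge0.
    have tp : pos_powR mu^-1 xi <= z - ps.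
      have pE : z - ps = (Y z) `^ mu^-1.
        by rewrite /Y -powRrM mulfV ?gt_eqF// powRr1 ?subr_ge0// ltW.
      rewrite pE /pos_powR max_l ?(ltW xi0)//.
      by apply: ge0_ler_powR; rewrite ?nnegrE ?invr_ge0; apply/ltW.
    have E1 : `|ps + pos_powR mu^-1 xi - ps| = pos_powR mu^-1 xi.
      by rewrite addrAC subrr add0r ger0_norm.
    have E2 : `|z - ps| = z - ps by rewrite ger0_norm ?subr_ge0 ?ltW.
    rewrite E2 (le_trans (uL _ _))// E1.
    apply: (@le_trans _ _ (`|L| * pos_powR mu^-1 xi)).
      by rewrite ler_wpM2r// ler_norm.
    by rewrite ler_wpM2l.
  apply/cvgrPdist_lt => e e0; rewrite near_withinE.
  have L1 : 0 < `|L| + 1 by rewrite ltr_wpDl.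
  near=> z; rewrite /= in_itv/= => /andP[].
  rewrite le_eqVlt => /predU1P[<- _|psz z1]; first by rewrite subrr normr0.
  rewrite distrC (le_lt_trans (uL' z psz z1))//.
  apply: (@le_lt_trans _ _ ((`|L| + 1) * `|z - ps|)).
    by rewrite ler_wpM2r// lerDl.
  rewrite mulrC -ltr_pdivlMr// distrC.
  near: z; apply: (@cvgr_dist_lt _ _ _ _ _ id) => //.
  by rewrite divr_gt0.
have phi0q : phi0 q k q = k.
  by rewrite /phi0 /num subrK mulfK// gt_eqF// Y_gt0.
have dq : is_derive q 1 (phi0 q k) (mu * (u q - phi0 q k q) / (q - ps)).
  apply: phi0_derive => //.
  by apply: (le_lt_trans (Y_le1 (ltW psq) (ltW q1))); rewrite ltr1n.
have cq : {for q, continuous (phi0 q k)}.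
  by apply/differentiable_continuous/derivable1_diffP; have [] := dq.
suff : phi z @[z --> within `[q, 1] (nbhs q)] --> phi q by [].
have -> : phi q = phi0 q k q by rewrite phiq phi0q.
apply: cvg_trans (cvg_within_filter `[q, 1] cq).
apply: near_eq_cvg; rewrite near_withinE; near=> z.
rewrite /= in_itv/= => /andP[+ _]; rewrite le_eqVlt => /predU1P[<-|qz].
  by rewrite phi0q phiq.
by rewrite /phi leNgt qz.
Unshelve. all: by end_near. Qed.

End OdeExistence.

Section UpStep.
Context {R : realType}.
Variables (u : R -> R) (ps mu L : R).
Hypotheses (mu_gt0 : 0 < mu) (ps_ge0 : 0 <= ps).
Hypothesis (uL : forall p q, `|u p - u q| <= L * `|p - q|).

Lemma step_upP (st : R * (R -> R)) : ps <= st.1 -> st.1 < 1 ->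
  (st.1 = ps -> st.2 st.1 = u st.1) ->
  up_step u ps mu st.1 st.2 (step_up u ps mu st).1 (step_up u ps mu st).2.
Proof.
case: st => p W /= psp p1 Wp; rewrite /step_up p1.
have [r|r] := boolP (p < rho_up u ps mu p W); split => /=.
- by move=> q ->.
- by rewrite r; split => // q pq _; rewrite leNgt pq.
- by move=> q ->.
rewrite (negbTE r); exists (phi_up u ps mu p (W p)); split => //.
  have [phi hphi] := ode_solution_exists mu_gt0 ps_ge0 uL psp p1 Wp.
  by rewrite /phi_up; case: xgetP => [//|] /(_ phi).
by move=> q pq _; rewrite leNgt pq.
Qed.

Lemma step_up_stop (st : R * (R -> R)) : 1 <= st.1 -> step_up u ps mu st = st.
Proof. by case: st => p W /= p1; rewrite /step_up ltNge p1. Qed.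

End UpStep.

(** * The reflection of the belief, exchanging the two parts of the algorithm *)

Section Mirror.
Context {R : realType}.

Definition mir (f : R -> R) (q : R) : R := f (1 - q).

Lemma onemK (x : R) : 1 - (1 - x) = x.
Proof. by ring. Qed.

Lemma mirK f : mir (mir f) = f.
Proof. by apply/funext => x; rewrite /mir onemK. Qed.

Lemma sup_mir (E E' : set R) : (forall x, E' x <-> E (1 - x)) -> E !=set0 ->
  has_lbound E -> sup E' = 1 - inf E.
Proof.
move=> EE [x0 Ex0] [l hl].
have E0 : E !=set0 by exists x0.
have Elb : has_lbound E by exists l.
have E'0 : E' !=set0 by exists (1 - x0); apply/EE; rewrite onemK.
have E'ub : has_ubound E'.
  by exists (1 - l) => y /EE /hl; lra.
apply/eqP; rewrite eq_le; apply/andP; split.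
  apply: ge_sup => // y /EE h.
  by have := ge_inf Elb h; lra.
rewrite lerBlDl -lerBlDr; apply: lb_le_inf => // y Ey.
have : 1 - y <= sup E' by apply: ub_le_sup => //; apply/EE; rewrite onemK.
lra.
Qed.

Lemma inf_mir (E E' : set R) : (forall x, E' x <-> E (1 - x)) -> E !=set0 ->
  has_ubound E -> inf E' = 1 - sup E.
Proof.
move=> EE [x0 Ex0] [b hb].
have E'0 : E' !=set0 by exists (1 - x0); apply/EE; rewrite onemK.
have E'lb : has_lbound E' by exists (1 - b) => y /EE /hb; lra.
rewrite (@sup_mir E' E) //; first by rewrite onemK.
by move=> x; rewrite EE onemK.
Qed.

Variables (u : R -> R) (ps mu : R).

Lemma slope_mir f p q :
  slope (mir u) (1 - ps) mu (mir f) p q = - slope u ps mu f (1 - p) (1 - q).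
Proof.
rewrite /slope /mir.
have -> : q - (1 - ps) + mu * (q - p) = - (1 - q - ps + mu * (1 - q - (1 - p))).
  by ring.
by rewrite invrN mulrN.
Qed.

Lemma a_up_mir f p : a_up (mir u) (1 - ps) mu p (mir f) = - a_down u ps mu (1 - p) f.
Proof.
rewrite /a_up /a_down /inf opprK; congr sup.
rewrite eqEsubset; split=> [_ [q /= + <-]|_ [_ [q /= + <-] <-]].
  rewrite in_itv/= => /andP[pq q1]; exists (slope u ps mu f (1 - p) (1 - q)).
    by exists (1 - q) => //=; rewrite in_itv/=; lra.
  by rewrite slope_mir.
rewrite in_itv/= => /andP[q0 qp]; exists (1 - q).
  by rewrite /= in_itv/=; lra.
by rewrite slope_mir onemK.
Qed.

Lemma rho_up_mir f p : rho_up (mir u) (1 - ps) mu p (mir f) = 1 - rho_down u ps mu (1 - p) f.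
Proof.
rewrite /rho_up /rho_down.
set E' := [set p' | p < p' <= 1 /\ _]; set E := [set p' | 0 <= p' < 1 - p /\ _].
have EE x : E' x <-> E (1 - x).
  rewrite /E' /E /= a_up_mir slope_mir; split.
    move=> [/andP[px x1] /oppr_inj ->]; split => //; lra.
  by move=> [/andP[x1 px] ->]; split => //; lra.
have [E0|nE] := asboolP (E !=set0).
  rewrite ifT; last by apply/asboolP; case: E0 => x Ex; exists (1 - x); apply/EE; rewrite onemK.
  by apply: sup_mir => //; exists 0 => x [/andP[]].
rewrite ifF ?onemK//; apply/asboolPn => -[x /EE Ex]; apply: nE; by exists (1 - x).
Qed.

Lemma has_derivative_withinP (D : set R) (f : R -> R) (p l : R) :
  has_derivative_within D f p l <-> forall e, 0 < e -> exists2 eta, 0 < eta &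
    forall q, D q -> q != p -> `|p - q| < eta -> `|l - (f q - f p) / (q - p)| < e.
Proof.
split=> [/cvgrPdist_lt h e e0|h].
  have := h e e0; rewrite !near_withinE /= => /nbhs_ballP[eta /= eta0 he].
  by exists eta => // q Dq qp pq; apply: he.
apply/cvgrPdist_lt => e e0; have [eta eta0 he] := h e e0.
rewrite !near_withinE /=; apply/nbhs_ballP; exists eta => //= q pq qp Dq.
exact: he.
Qed.

Lemma ode_solution_mir (D D' : set R) q c phi : (forall x, D' x <-> D (1 - x)) ->
  ode_solution u ps mu D q c phi ->
  ode_solution (mir u) (1 - ps) mu D' (1 - q) c (mir phi).
Proof.
move=> DD [/within_continuousP fc fq fd]; split.
- apply/within_continuousP => x /DD Dx e e0.
  have [eta eta0 he] := fc _ Dx e e0; exists eta => // y /DD Dy xy.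
  apply: he => //; have -> : 1 - x - (1 - y) = - (x - y) by ring.
  by rewrite normrN.
- by rewrite /mir onemK.
- move=> p /DD Dp pq; apply/has_derivative_withinP => e e0.
  have pq' : 1 - p != q by apply: contraNneq pq => <-; rewrite onemK.
  have /has_derivative_withinP/(_ e e0)[eta eta0 he] := fd _ Dp pq'.
  exists eta => // x /DD Dx xp px.
  have xp' : 1 - x != 1 - p.
    by apply: contraNneq xp => h; apply/eqP; rewrite -(onemK x) h onemK.
  have E : 1 - p - (1 - x) = - (p - x) by ring.
  have := he _ Dx xp'; rewrite E normrN => /(_ px).
  rewrite /mir; have -> : p - (1 - ps) = - (1 - p - ps) by ring.
  have -> : x - p = - (1 - x - (1 - p)) by ring.
  by rewrite !invrN !mulrN -opprB normrN opprK [- _ + _]addrC.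
Qed.

End Mirror.

Section DownStep.
Context {R : realType}.
Variables (u : R -> R) (ps mu L : R).
Hypotheses (mu_gt0 : 0 < mu) (ps01 : 0 <= ps <= 1).
Hypothesis (uL : forall p q, `|u p - u q| <= L * `|p - q|).

Definition mir_state (st : R * (R -> R)) : R * (R -> R) := (1 - st.1, mir st.2).

Lemma mir_lipschitz p q : `|mir u p - mir u q| <= L * `|p - q|.
Proof.
have E : 1 - p - (1 - q) = - (p - q) by ring.
by rewrite (le_trans (uL _ _))// E normrN.
Qed.

Lemma step_downP (st : R * (R -> R)) : st.1 <= ps -> 0 < st.1 ->
  (st.1 = ps -> st.2 st.1 = u st.1) ->
  up_step (mir u) (1 - ps) mu (mir_state st).1 (mir_state st).2
    (mir_state (step_down u ps mu st)).1 (mir_state (step_down u ps mu st)).2.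
Proof.
case: st => p W /= psp p0 Wp; rewrite /step_down p0.
have rE : rho_up (mir u) (1 - ps) mu (1 - p) (mir W) = 1 - rho_down u ps mu p W.
  by rewrite rho_up_mir onemK.
have aE : a_up (mir u) (1 - ps) mu (1 - p) (mir W) = - a_down u ps mu p W.
  by rewrite a_up_mir onemK.
have rlt : (1 - p < rho_up (mir u) (1 - ps) mu (1 - p) (mir W)) =
    (rho_down u ps mu p W < p) by rewrite rE ltrD2l ltrN2.
rewrite /up_step rlt.
have [r|r] := boolP (rho_down u ps mu p W < p); split => /=.
- move=> q qp; rewrite /mir ifT//; lra.
- rewrite rE; split => // q pq _; rewrite /mir ifF; last first.
    by apply/negbTE; rewrite -ltNge; lra.
  by rewrite aE onemK; ring.
- move=> q qp; rewrite /mir ifT//; lra.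
set phi := phi_down u ps mu p (W p).
(* [phi_down] is an arbitrary choice with a junk default; the reflection of an increasing solution
   shows that there is something to choose. *)
have hphi : ode_solution u ps mu `[0, p] p (W p) phi.
  have ps' : 0 <= 1 - ps by move: ps01 => /andP[? ?]; lra.
  have psp' : 1 - ps <= 1 - p by lra.
  have p1' : 1 - p < 1 by lra.
  have Wp' : 1 - p = 1 - ps -> W p = mir u (1 - p).
    by move=> h; rewrite /mir onemK; apply: Wp; lra.
  have [psi hpsi] := ode_solution_exists mu_gt0 ps' mir_lipschitz psp' p1' Wp'.
  have hpsi' : ode_solution u ps mu `[0, p] p (W p) (mir psi).
    have := @ode_solution_mir _ (mir u) (1 - ps) mu `[1 - p, 1] `[0, p] _ _ _ _ hpsi.
    rewrite mirK !onemK; apply => x.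
    by rewrite /= !in_itv/=; split => /andP[? ?]; lra.
  by rewrite /phi /phi_down; case: xgetP => [//|] /(_ _ hpsi').
exists (mir phi); split.
- rewrite /mir onemK -/(mir phi).
  apply: (@ode_solution_mir _ _ _ _ `[0, p] `[1 - p, 1]) => // x.
  by rewrite /= !in_itv/=; split => /andP[? ?]; lra.
- rewrite /ode_exit.
  set E' := [set q | 1 - p < q < 1 /\ _]; set E := [set q | 0 < q < p /\ _].
  have EE x : E' x <-> E (1 - x).
    rewrite /E' /E /= rho_up_mir; split => -[/andP[? ?] ?];
      (split; [lra|lra]).
  have [E0|nE] := asboolP (E !=set0).
    rewrite ifT; last by apply/asboolP; case: E0 => x Ex; exists (1 - x); apply/EE; rewrite onemK.
    by symmetry; apply: inf_mir => //; exists p => x [/andP[_ /ltW]].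
  rewrite ifF ?subr0//; apply/asboolPn => -[x /EE Ex]; apply: nE; by exists (1 - x).
- move=> q pq _; rewrite /mir ifF//; apply/negbTE; rewrite -ltNge; lra.
Qed.

End DownStep.

(** * The initial step *)

Section ConcaveEnvelope.
Context {R : realType}.

Lemma concave_chord (h : R -> R) (x y t : R) : concave_function `[0, 1] h ->
  0 <= x <= 1 -> 0 <= y <= 1 -> 0 <= t <= 1 ->
  t * h x + (1 - t) * h y <= h (t * x + (1 - t) * y).
Proof.
move=> hc x01 y01 /andP[t0 t1].
have := hc (Itv01 t0 t1) x y; rewrite !inE /= !in_itv/= => /(_ x01 y01).
by rewrite !convRE /= /unstable.onem => ?; lra.
Qed.

Lemma affine_concave (c m z : R) : concave_function `[0, 1] (fun q => c + m * (q - z)).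
Proof.
move=> t x y _ _; rewrite !convRE /= /unstable.onem.
rewrite le_eqVlt; apply/orP; left; apply/eqP.
have -> : conv t x y = t%:num * x + (1 - t%:num) * y by exact: convRE.
ring.
Qed.

Variables (u : R -> R) (ps L : R).
Hypotheses (ps01 : 0 < ps < 1) (L_ge0 : 0 <= L).
Hypothesis (uL : forall p q, `|u p - u q| <= L * `|p - q|).

Definition majorant (c m : R) := forall q, 0 <= q <= 1 -> u q <= c + m * (q - ps).

(** Finds a supporting line at [ps] without using the concave envelope: for each slope [m] the least
    admissible height at [ps] is [cm m], a Lipschitz function of [m], to be minimised. *)
Lemma minimal_majorant : exists c m, majorant c m /\
  forall c' m', majorant c' m' -> c <= c'.
Proof.
have /andP[ps0 ps1] := ps01.
have attain m : exists2 q, 0 <= q <= 1 &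
    forall q', 0 <= q' <= 1 -> u q' - m * (q' - ps) <= u q - m * (q - ps).
  have fc : {within `[0, 1], continuous (fun q => u q - m * (q - ps))}.
    apply: continuous_subspaceT => x; apply: cvgB; first exact: (lipschitz_continuous uL).
    apply: cvgM; first exact: cvg_cst.
    by apply: cvgB; [exact: cvg_id|exact: cvg_cst].
  have [q q01 hq] := EVT_max (ler01 : 0 <= 1 :> R) fc.
  exists q; first by move: q01; rewrite in_itv.
  by move=> q' q'01; apply: hq; rewrite in_itv.
have [top htop] := choice (fun m => let: ex_intro2 q h1 h2 := attain m in
  ex_intro _ q (conj h1 h2)).
pose cm m := u (top m) - m * (top m - ps).
have cm_maj m : majorant (cm m) m.
  by move=> q q01; have [_ h] := htop m; have := h q q01; rewrite /cm; lra.
have cm_min c m : majorant c m -> cm m <= c.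
  by move=> h; have [t01 _] := htop m; have := h _ t01; rewrite /cm; lra.
have cmL m m' : `|cm m - cm m'| <= 1 * `|m - m'|.
  suff H m1 m2 : cm m1 - cm m2 <= `|m1 - m2|.
    by rewrite mul1r ler_norml H andbT lerNl opprB (le_trans (H m' m))// distrC.
  rewrite lerBlDr; apply: cm_min => q q01.
  have h1 := cm_maj m2 q q01.
  have h2 : `|(m1 - m2) * (q - ps)| <= `|m1 - m2|.
    rewrite normrM ler_piMr// ler_norml; move: q01 => /andP[? ?].
    by lra.
  by move: h2; rewrite ler_norml => /andP[h2 _]; lra.
(* Slopes beyond the Lipschitz constant are no better: the line must already pass above [u] at 0 or
   at 1, which forces a height at [ps] at least [cm K] or [cm (- K)]. The search is thus compact. *)
pose K := L + 1.
have K0 : - K <= K by move: L_ge0; rewrite /K; lra.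
have cmc : {within `[- K, K], continuous cm}.
  by apply: continuous_subspaceT; exact: lipschitz_continuous cmL.
have [m mK hm] := EVT_min K0 cmc.
have cmK : cm K <= u 0 + K * ps.
  apply: cm_min => q /andP[q0 q1].
  have h := uL q 0; rewrite subr0 (ger0_norm q0) ler_norml in h.
  by move: h => /andP[_ h]; rewrite /K; lra.
have cmNK : cm (- K) <= u 1 + K * (1 - ps).
  apply: cm_min => q /andP[q0 q1].
  have := uL q 1; rewrite (distrC q 1) (ger0_norm (_ : 0 <= 1 - q)) ?subr_ge0//.
  by rewrite ler_norml /K => /andP[_]; lra.
exists (cm m), m; split=> // c' m' maj.
have [m'K|Km'] := leP `|m'| K.
  by apply: le_trans (cm_min _ _ maj); apply: hm; rewrite in_itv/= -ler_norml.
have z0 : 0 <= (0 : R) <= 1 by rewrite lexx ler01.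
have o1 : 0 <= (1 : R) <= 1 by rewrite lexx ler01.
have [m'0|m'0] := leP 0 m'.
  have hK : cm m <= cm K by apply: hm; rewrite in_itv/= K0 lexx.
  have := maj 0 z0; move: Km'; rewrite ger0_norm// => Km'.
  have : 0 <= (m' - K) * ps by apply: mulr_ge0; lra.
  lra.
have hK : cm m <= cm (- K) by apply: hm; rewrite in_itv/= K0 lexx.
have := maj 1 o1; move: Km'; rewrite ltr0_norm// => Km'.
have : 0 <= (- m' - K) * (1 - ps) by apply: mulr_ge0; lra.
lra.
Qed.

(* Otherwise the line could be tilted around a point slightly to the left of
   [ps], which would lower its value at [ps]. *)
Lemma minimal_touch_right c m : majorant c m ->
  (forall c' m', majorant c' m' -> c <= c') ->
  exists q2, [/\ ps <= q2 <= 1, u q2 = c + m * (q2 - ps) &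
    forall q, ps <= q -> q < q2 -> u q < c + m * (q - ps)].
Proof.
move=> maj minc; have /andP[ps0 ps1] := ps01.
pose G q := c + m * (q - ps) - u q.
have GL x y : `|G x - G y| <= (L + `|m|) * `|x - y|.
  have -> : G x - G y = (u y - u x) + m * (x - y) by rewrite /G; ring.
  by rewrite (le_trans (ler_normD _ _))// mulrDl lerD ?normrM// distrC; exact: uL.
have Gc : continuous G by exact: lipschitz_continuous GL.
have G0 q : 0 <= q <= 1 -> 0 <= G q by move=> /maj; rewrite /G; lra.
have [q0 [q0ps q01 Gq0]] : exists q, [/\ ps <= q, q <= 1 & G q = 0].
  apply: contrapT => hno.
  have Gpos q : ps <= q -> q <= 1 -> 0 < G q.
    move=> psq q1; rewrite lt_neqAle G0 ?q1 ?andbT; last by lra.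
    by apply/eqP => h; apply: hno; exists q.
  have [t] := EVT_min (ltW ps1) (continuous_subspaceT Gc : {within `[ps, 1], continuous G}).
  rewrite in_itv/= => /andP[pst t1] ht.
  have Gt := Gpos t pst t1.
  pose L' := L + `|m| + 1.
  have L'0 : 0 < L' by rewrite /L' ltr_wpDl// addr_ge0.
  (* By the Lipschitz bound the margin stays at least [G t / 2] on [[ps - e, 1]]. Tilting around
     [ps - e] by [eta = G t / 2] costs at most that margin, since the interval has length at most 1,
     and lowers the height at [ps] by [eta * e]. *)
  pose e := Num.min ps (G t / (2 * L')).
  have e0 : 0 < e by rewrite lt_min ps0 divr_gt0// mulr_gt0.
  have eps : e <= ps by rewrite ge_min lexx.
  have eG : e * L' <= G t / 2.
    have h : e <= G t / (2 * L') by rewrite ge_min lexx orbT.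
    apply: (le_trans (ler_wpM2r (ltW L'0) h)).
    rewrite le_eqVlt; apply/orP; left; apply/eqP; field.
    by rewrite gt_eqF.
  have Ge q : ps - e <= q -> q <= 1 -> G t / 2 <= G q.
    move=> eq q1; have [psq|qps] := leP ps q.
      have : G t <= G q by apply: ht; rewrite in_itv/= psq.
      lra.
    have h1 : G t <= G ps by apply: ht; rewrite in_itv/= lexx ltW.
    have := GL ps q; rewrite (ger0_norm (_ : 0 <= ps - q)) ?subr_ge0 ?(ltW qps)//.
    rewrite ler_norml => /andP[_ h2].
    have h3 : (L + `|m|) * (ps - q) <= L' * e.
      by apply: ler_pM => //; [exact: addr_ge0|lra|rewrite /L'; lra|lra].
    by move: h3 eG; rewrite [L' * e]mulrC; lra.
  pose eta := G t / 2.
  have h0 : 0 < eta * e by rewrite mulr_gt0// /eta; lra.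
  suff : c <= c - eta * e by lra.
  apply: (minc _ (m - eta)) => q /andP[q0 q1].
  have [eq|qe] := leP (ps - e) q.
    have := Ge q eq q1; rewrite /G -/eta.
    have : 0 <= eta * (1 - (q - (ps - e))).
      by apply: mulr_ge0; rewrite ?/eta; lra.
    rewrite /eta; lra.
  have h1 := G0 q; rewrite q0 q1 /G in h1.
  have : 0 <= eta * (ps - e - q) by apply: mulr_ge0; rewrite ?/eta; lra.
  by have := h1 isT; lra.
have sol : exists2 q2, ps <= q2 <= 1 & G q2 = 0 /\ forall q, ps <= q -> q < q2 -> 0 < G q.
  pose Z := [set q | ps <= q <= 1 /\ G q = 0].
  have Z0 : Z !=set0 by exists q0; split => //; rewrite q0ps.
  have Zlb : has_lbound Z by exists ps => q [/andP[]].
  have infps : ps <= inf Z by apply: lb_le_inf => // q [/andP[]].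
  have inf1 : inf Z <= 1.
    by apply: (le_trans (ge_inf Zlb _) q01); split => //; rewrite q0ps.
  exists (inf Z); first by rewrite infps.
  have Ginf : G (inf Z) = 0.
    apply/eqP; rewrite eq_le; apply/andP; split; last first.
      by apply: G0; rewrite inf1 andbT; lra.
    rewrite -oppr_ge0.
    apply: (@within_continuous_closed_ge0 _ (fun x => - G x) ps 1 (inf Z)).
    - by apply: continuous_subspaceT => x; apply: cvgN; exact: Gc.
    - by rewrite infps.
    - move=> e e0; have [y [/andP[psy y1] Gy] hy] := inf_adherent e0 (conj Z0 Zlb).
      exists y; rewrite psy y1 Gy oppr0; split => //.
      have : inf Z <= y by apply: ge_inf => //; split => //; rewrite psy.
      by move=> iy; rewrite ler0_norm ?subr_le0//; lra.
  split=> // q psq qi; rewrite lt_neqAle; apply/andP; split; last first.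
    by apply: G0; lra.
  apply/eqP => h; suff : inf Z <= q by rewrite leNgt qi.
  by apply: ge_inf => //; split => //; rewrite psq/=; lra.
have [q2 q2ps [Gq2 hq2]] := sol.
exists q2; split => //; first by move: Gq2; rewrite /G; lra.
by move=> q psq qq2; have := hq2 q psq qq2; rewrite /G; lra.
Qed.

End ConcaveEnvelope.

Section Initialization.
Context {R : realType}.
Variables (u : R -> R) (ps mu L : R).
Hypotheses (ps01 : 0 < ps < 1) (L_ge0 : 0 <= L) (mu_gt0 : 0 < mu).
Hypothesis (uL : forall p q, `|u p - u q| <= L * `|p - q|).

Let ps0 : 0 < ps. Proof. by case/andP: ps01. Qed.
Let ps1 : ps < 1. Proof. by case/andP: ps01. Qed.

Lemma minimal_touch_left c m : majorant u ps c m ->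
  (forall c' m', majorant u ps c' m' -> c <= c') ->
  exists q1, [/\ 0 <= q1 <= ps, u q1 = c + m * (q1 - ps) &
    forall q, q1 < q -> q <= ps -> u q < c + m * (q - ps)].
Proof.
move=> maj minc.
have ps01' : 0 < 1 - ps < 1 by move: ps0 ps1; lra.
have uL' p q : `|u (1 - p) - u (1 - q)| <= L * `|p - q|.
  have E : 1 - p - (1 - q) = - (p - q) by ring.
  by rewrite (le_trans (uL _ _))// E normrN.
have [|c' m' maj'|q [/andP[q0 q1] qE hq]] :=
    @minimal_touch_right R (fun q => u (1 - q)) (1 - ps) L ps01' L_ge0 uL' c (- m).
- move=> q /andP[q0 q1]; have q01 : 0 <= 1 - q <= 1 by lra.
  by apply: (le_trans (maj _ q01)); lra.
- apply: (minc c' (- m')) => q /andP[q0 q1].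
  have q01 : 0 <= 1 - q <= 1 by lra.
  by have := maj' _ q01; rewrite opprB addrCA subrr addr0; lra.
exists (1 - q); split; first by lra.
  by rewrite qE; ring.
move=> x qx xps; have := hq (1 - x).
rewrite opprB addrCA subrr addr0 => /(_ _ _)h.
by have := h ltac:(lra) ltac:(lra); lra.
Qed.

Lemma cav_has_lbound p : 0 <= p <= 1 ->
  has_lbound [set h p | h in [set h : R -> R | concave_function `[0, 1] h /\
    forall q, 0 <= q <= 1 -> u q <= h q]].
Proof. by move=> p01; exists (u p) => _ [h [_ hu] <-]; exact: hu. Qed.

(** The line is itself a concave majorant, and any concave majorant lies above its own chord between
    the two contact points, which is above the line. *)
Lemma cav_touch c m q1 q2 q : majorant u ps c m -> 0 <= q1 -> q2 <= 1 ->
  u q1 = c + m * (q1 - ps) -> u q2 = c + m * (q2 - ps) ->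
  q1 <= q -> q <= q2 -> cav u q = c + m * (q - ps).
Proof.
move=> maj q10 q21 E1 E2 q1q qq2.
have q01 : 0 <= q <= 1 by lra.
apply/eqP; rewrite eq_le; apply/andP; split.
  apply: ge_inf; first exact: cav_has_lbound.
  by exists (fun q => c + m * (q - ps)) => //; split => //; exact: affine_concave.
apply: lb_le_inf.
  by exists (c + m * (q - ps)), (fun q => c + m * (q - ps)) => //; split => //; exact: affine_concave.
move=> _ [h [hc hu] <-].
have [q12|q12] := eqVneq q1 q2.
  have -> : q = q1 by apply/eqP; rewrite eq_le q1q andbT q12.
  by rewrite -E1; apply: hu; lra.
have q12' : 0 < q2 - q1 by rewrite subr_gt0 lt_neqAle q12 (le_trans q1q).
pose t := (q2 - q) / (q2 - q1).
have t01 : 0 <= t <= 1.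
  apply/andP; split; first by apply: divr_ge0; [rewrite subr_ge0|exact: ltW].
  by rewrite /t ler_pdivrMr// mul1r lerD2l lerN2.
have q1_01 : 0 <= q1 <= 1 by lra.
have q2_01 : 0 <= q2 <= 1 by lra.
have := concave_chord hc q1_01 q2_01 t01.
have tE : t * q1 + (1 - t) * q2 = q by rewrite /t; field; rewrite gt_eqF.
rewrite tE; apply: le_trans.
have h1 : t * u q1 <= t * h q1 by apply: ler_wpM2l; [case/andP: t01|exact: hu].
have h2 : (1 - t) * u q2 <= (1 - t) * h q2.
  by apply: ler_wpM2l; [rewrite subr_ge0; case/andP: t01|exact: hu].
apply: le_trans (lerD h1 h2); rewrite E1 E2 -tE.
by rewrite le_eqVlt; apply/orP; left; apply/eqP; ring.
Qed.

(** The contact points of the supporting line closest to [ps] on either side are [pt_init] and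
    [p_init]: between them the envelope is the line, and strictly inside, [u] is below it, except
    possibly at [ps] when both coincide with [ps]. *)
Lemma init_data : exists c m, [/\ majorant u ps c m,
  [/\ 0 <= pt_init u ps, pt_init u ps <= ps, ps <= p_init u ps & p_init u ps <= 1],
  u (pt_init u ps) = c + m * (pt_init u ps - ps),
  u (p_init u ps) = c + m * (p_init u ps - ps) &
  forall p, pt_init u ps <= p -> p <= p_init u ps ->
    w_init u ps mu p = c + m * (mu / (1 + mu)) * (p - ps)].
Proof.
have [c [m [maj minc]]] := minimal_majorant ps01 L_ge0 uL.
have [q2 [/andP[psq2 q21] q2E hq2]] := minimal_touch_right ps01 L_ge0 uL maj minc.
have [q1 [/andP[q10 q1ps] q1E hq1]] := minimal_touch_left maj minc.
have cavE q : q1 <= q -> q <= q2 -> cav u q = c + m * (q - ps).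
  exact: (cav_touch maj q10 q21 q1E q2E).
have p0E : p_init u ps = q2.
  rewrite /p_init; set Z := [set p | _].
  have Zq2 : Z q2 by split; [rewrite psq2|rewrite cavE// (le_trans q1ps)].
  apply/eqP; rewrite eq_le; apply/andP; split.
    by apply: ge_inf => //; exists ps => x [/andP[]].
  apply: lb_le_inf; first by exists q2.
  move=> x [/andP[psx x1] hx]; rewrite leNgt; apply/negP => xq2.
  have := hq2 x psx xq2; rewrite -hx cavE ?ltxx//; first exact: le_trans psx.
  exact: ltW.
have pt0E : pt_init u ps = q1.
  rewrite /pt_init; set Z := [set p | _].
  have Zq1 : Z q1 by split; [rewrite q10|rewrite cavE// (le_trans q1ps)].
  apply/eqP; rewrite eq_le; apply/andP; split; last first.
    by apply: ub_le_sup => //; exists ps => x [/andP[]].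
  apply: ge_sup; first by exists q1.
  move=> x [/andP[x0 xps] hx]; rewrite leNgt; apply/negP => q1x.
  have := hq1 x q1x xps; rewrite -hx cavE ?ltxx//; first exact: ltW.
  exact: le_trans xps _.
exists c, m; rewrite /w_init p0E pt0E; split => // p q1p pq2.
have mu1 : 1 + mu != 0 by rewrite gt_eqF//; move: mu_gt0; lra.
case: ifP => [q12|/negbT]; last first.
  rewrite -leNgt => q21'.
  have -> : p = ps by apply/eqP; rewrite eq_le; lra.
  have {1}-> : ps = q1 by apply/eqP; rewrite eq_le; lra.
  by rewrite q1E; have -> : q1 = ps; [apply/eqP; rewrite eq_le; lra|ring].
have q12n : q2 - q1 != 0 by rewrite subr_eq0 gt_eqF.
have mu1' : mu + 1 != 0 by rewrite addrC.
rewrite q1E q2E; field.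
by rewrite ?mu1 ?mu1' ?q12n.
Qed.

End Initialization.

(** * Beliefs generated by a play *)

Section HistoryProducts.
Context {R : realType}.

(** Carrying the past as an argument turns products indexed by prefixes of a history into a
    structural recursion. *)
Fixpoint wprod {T : Type} (f : seq T -> T -> R) (past h : seq T) : R :=
  if h is m :: h' then f past m * wprod f (rcons past m) h' else 1.

Lemma wprod_rcons (T : Type) (f : seq T -> T -> R) past h m :
  wprod f past (rcons h m) = wprod f past h * f (past ++ h) m.
Proof.
elim: h past => [|m' h IH] past /=; first by rewrite cats0 mulr1 mul1r.
by rewrite IH mulrA cat_rcons.
Qed.

Lemma prod_wprod (T : Type) (f : seq T -> T -> R) k (h : k.-tuple T) :
  \prod_(j < k) f (take j h) (tnth h j) = wprod f [::] h.
Proof.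
have H m0 past s :
    \prod_(j < size s) f (past ++ take j s) (nth m0 s j) = wprod f past s.
  elim: s past => [|m s IH] past /=; first by rewrite big_ord0.
  rewrite big_ord_recl /= cats0; congr (_ * _).
  by rewrite -IH; apply: eq_bigr => i _; rewrite cat_rcons.
case: k h => [|k] h; first by rewrite big_ord0 tuple0.
rewrite -(H (tnth h ord0)) size_tuple.
by apply: eq_bigr => j _; rewrite (tnth_nth (tnth h ord0)).
Qed.

Lemma wprod_ge0 (T : Type) (f : seq T -> T -> R) past h :
  (forall h m, 0 <= f h m) -> 0 <= wprod f past h.
Proof. by move=> f0; elim: h past => //= m h IH past; rewrite mulr_ge0. Qed.

Lemma sum_tupleS (T : finType) k (F : seq T -> R) :
  \sum_(h : k.+1.-tuple T) F h = \sum_(h : k.-tuple T) \sum_(m : T) F (rcons h m).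
Proof.
rewrite pair_big/=.
rewrite (reindex (fun hm : k.-tuple T * T => [tuple of rcons hm.1 hm.2]))//=.
exists (fun h : k.+1.-tuple T => ([tuple of belast (thead h) (behead h)], last (thead h) (behead h))).
  move=> [h m] _; congr (_, _).
    by apply/val_inj => /=; case: h => -[|x s] hs//=; rewrite /thead (tnth_nth x)/= ?belast_rcons.
  by case: h => -[|x s] hs//=; rewrite /thead (tnth_nth m)/= ?last_rcons.
move=> h _; apply/val_inj => /=; rewrite -lastI.
by case/tupleP: h => x s; rewrite theadE.
Qed.

Lemma sum_pair (I J : finType) (F : I * J -> R) :
  \sum_ij F ij = \sum_i \sum_j F (i, j).
Proof. by rewrite pair_bigA; apply: eq_bigr => -[i j]. Qed.

Lemma sum_triple (I J K : finType) (F : I * J * K -> R) :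
  \sum_m F m = \sum_i \sum_j \sum_k F (i, j, k).
Proof. by rewrite sum_pair (sum_pair (fun ij => \sum_k F (ij, k))). Qed.

End HistoryProducts.

Section Beliefs.
Context {R : realType} {A B : finType}.
Variables (g : state -> A -> B -> R) (delta pi1 pi2 p : R).
Hypotheses (pi1_01 : 0 <= pi1 <= 1) (pi2_01 : 0 <= pi2 <= 1) (p_01 : 0 <= p <= 1).

Local Notation move := (state * A * B)%type.
Local Notation next := (@next_state_prob R A B pi1 pi2 p).
Local Notation trans := (trans_prob pi1 pi2).
Local Notation public := (@public A B).

Lemma trans_prob_ge0 s s' : 0 <= trans s s'.
Proof. by rewrite /trans_prob; case: s; case: s'; move: pi1_01 pi2_01 => /andP[? ?] /andP[? ?]; lra. Qed.

Lemma trans_prob_sum1 s : \sum_s' trans s s' = 1.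
Proof. by rewrite big_bool /trans_prob; case: s => /=; lra. Qed.

Lemma next_state_prob_ge0 h s : 0 <= next h s.
Proof.
case: h => [|m h] /=; last exact: trans_prob_ge0.
by rewrite /init_prob; case: s; move: p_01 => /andP[? ?]; lra.
Qed.

Lemma next_state_prob_rcons h m s : next (rcons h m) s = trans m.1.1 s.
Proof. by case: h => //= m' h; rewrite last_rcons. Qed.

Variable sigma : strategy1 R A B.

Definition move_weight (past : seq move) (m : move) : R :=
  let: (s, a, b) := m in next past s * sigma past s a.

(* Total weight, disregarding Player 2's randomisation, of the plays with public
   part [h] and next state [s], respectively next state [s] and action [a]. *)
Definition pub_mass k (h : seq (A * B)) (s : state) : R :=
  \sum_(H : k.-tuple move | map public H == h) wprod move_weight [::] H * next H s.

Definition pub_act k (h : seq (A * B)) (s : state) (a : A) : R :=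
  \sum_(H : k.-tuple move | map public H == h)
    wprod move_weight [::] H * next H s * sigma H s a.

Definition transit (m : state -> R) (s' : state) : R := \sum_s m s * trans s s'.

Lemma wprod_move_weight_ge0 H : 0 <= wprod move_weight [::] H.
Proof.
apply: wprod_ge0 => h [[s a] b] /=.
by rewrite mulr_ge0 ?dist_ge0 ?next_state_prob_ge0.
Qed.

Lemma pub_act_ge0 k h s a : 0 <= pub_act k h s a.
Proof.
apply: sumr_ge0 => H _.
by rewrite !mulr_ge0 ?dist_ge0 ?next_state_prob_ge0 ?wprod_move_weight_ge0.
Qed.

Lemma sum_pub_act k h s : \sum_a pub_act k h s a = pub_mass k h s.
Proof.
rewrite exchange_big; apply: eq_bigr => H _.
by rewrite -mulr_sumr dist_sum1 mulr1.
Qed.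

Lemma pub_mass0 s : pub_mass 0 [::] s = init_prob p s.
Proof.
rewrite /pub_mass (big_pred1 [tuple]) /=; first by rewrite mul1r.
by move=> H; rewrite tuple0 /= !eqxx.
Qed.

Lemma eq_pub_rcons (H : seq move) m h ab :
  (map public (rcons H m) == rcons h ab) = (map public H == h) && (public m == ab).
Proof. by rewrite map_rcons eqseq_rcons. Qed.

Lemma pub_massS k h a b s' :
  pub_mass k.+1 (rcons h (a, b)) s' = transit (fun s => pub_act k h s a) s'.
Proof.
rewrite /pub_mass big_mkcond.
rewrite (sum_tupleS k (fun H => if map public H == rcons h (a, b) then
   wprod move_weight [::] H * next H s' else 0)).
rewrite /transit; under [RHS]eq_bigr do rewrite mulr_suml.
rewrite [RHS]exchange_big /= [RHS]big_mkcond /=.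
apply: eq_bigr => H _.
under eq_bigr do rewrite eq_pub_rcons wprod_rcons next_state_prob_rcons cat0s.
case: eqP => [_|_] /=; last by rewrite big1.
rewrite sum_triple.
apply: eq_bigr => s _.
rewrite (bigD1 a)//= [X in _ + X]big1 ?addr0; last first.
  by move=> a' /negbTE aa'; rewrite big1// => b' _; rewrite /public/= xpair_eqE aa'.
rewrite (bigD1 b)//= [X in _ + X]big1 ?addr0; last first.
  by move=> b' /negbTE bb'; rewrite /public/= xpair_eqE bb' andbF.
by rewrite eqxx !mulrA.
Qed.

Variable tau : strategy2 R A B.

Definition reply_weight : seq (A * B) -> R :=
  wprod (fun past ab => tau past ab.2) [::].

Lemma reply_weight_ge0 h : 0 <= reply_weight h.
Proof. by apply: wprod_ge0 => *; exact: dist_ge0. Qed.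

(** The part of Player 2 depends on the play only through its public part, so it factors out of the
    sums over plays with the same public history. *)
Lemma play_probE k (H : k.-tuple move) :
  play_prob pi1 pi2 p sigma tau H =
  wprod move_weight [::] H * reply_weight (map public H).
Proof.
rewrite /play_prob.
pose f (past : seq move) (m : move) : R := let: (s, a, b) := m in
  next past s * sigma past s a * tau (map public past) b.
rewrite (prod_wprod f) /reply_weight.
rewrite -[X in _ = _ * wprod _ X _]/(map public [::]).
elim: (tval H) [::] => [|[[s a] b] h IH] past /=; first by rewrite mulr1.
by rewrite IH map_rcons /public /=; ring.
Qed.

Lemma sum_by_public k (F : seq move -> R) (G : seq (A * B) -> R) :
  \sum_(H : k.-tuple move) F H * G (map public H) =
  \sum_(h : k.-tuple (A * B)) (\sum_(H : k.-tuple move | map public H == h) F H) * G h.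
Proof.
rewrite (partition_big (fun H : k.-tuple move => [tuple of map public H]) predT)//=.
apply: eq_bigr => h _; rewrite mulr_suml.
apply: eq_big => [H|H]; first by rewrite -val_eqE.
by move=> /eqP <-.
Qed.

Lemma stage_payoffE k : stage_payoff g pi1 pi2 p sigma tau k =
  \sum_(h : k.-tuple (A * B)) reply_weight h *
    \sum_b tau h b * \sum_s \sum_a pub_act k h s a * g s a b.
Proof.
rewrite /stage_payoff.
pose last_payoff (H : seq move) : R := if H is m :: H' then
  let: (s, a, b) := last m H' in g s a b else 0.
transitivity (\sum_(H : k.+1.-tuple move) (wprod move_weight [::] H *
    reply_weight (map public H) * last_payoff H)).
  apply: eq_bigr => H _; rewrite play_probE; congr (_ * _).
  case/tupleP: H => m H; rewrite (tnth_nth m) /last_payoff /=.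
  by rewrite -[X in nth _ _ X](size_tuple H) -nth_last /=; case: (tval H).
rewrite (sum_tupleS k (fun H => wprod move_weight [::] H *
    reply_weight (map public H) * last_payoff H)).
transitivity (\sum_s \sum_a \sum_b \sum_(H : k.-tuple move)
   (wprod move_weight [::] H * next H s * sigma H s a) *
   (reply_weight (map public H) * tau (map public H) b * g s a b)).
  rewrite exchange_big/=.
  rewrite sum_triple.
  apply: eq_bigr => s _; apply: eq_bigr => a _; apply: eq_bigr => b _.
  apply: eq_bigr => H _; rewrite wprod_rcons map_rcons /reply_weight wprod_rcons !cat0s.
  have -> : last_payoff (rcons H (s, a, b)) = g s a b.
    by case: (tval H) => //= m H'; rewrite last_rcons.
  by rewrite /=; ring.
under eq_bigr => s _ do under eq_bigr => a _ do under eq_bigr => b _ do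
  rewrite (sum_by_public k (fun H => wprod move_weight [::] H * next H s * sigma H s a)
    (fun h => reply_weight h * tau h b * g s a b)).
under [RHS]eq_bigr do rewrite mulr_sumr.
rewrite [RHS]exchange_big/=.
under [RHS]eq_bigr => b _ do under eq_bigr => h _ do rewrite mulrA mulr_sumr.
under [RHS]eq_bigr => b _ do rewrite exchange_big/=.
rewrite [RHS]exchange_big/=; apply: eq_bigr => s _.
under [RHS]eq_bigr => b _ do under eq_bigr => h _ do rewrite mulr_sumr.
under [RHS]eq_bigr => b _ do rewrite exchange_big/=.
rewrite [RHS]exchange_big/=; apply: eq_bigr => a _.
apply: eq_bigr => b _; apply: eq_bigr => h _.
by rewrite /pub_act; ring.
Qed.

(** Expectation of [V] at the current belief, for homogeneous [V]: the probability of the history is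
    carried by the mass of the unnormalised belief. *)
Definition value_process (V : (state -> R) -> R) k : R :=
  \sum_(h : k.-tuple (A * B)) reply_weight h * V (pub_mass k h).

Lemma value_processS V k : value_process V k.+1 =
  \sum_(h : k.-tuple (A * B)) reply_weight h *
    \sum_b tau h b * \sum_a V (transit (fun s => pub_act k h s a)).
Proof.
rewrite /value_process (sum_tupleS k (fun h => reply_weight h * V (pub_mass k.+1 h))).
apply: eq_bigr => h _.
rewrite sum_pair exchange_big/= mulr_sumr.
apply: eq_bigr => b _; rewrite !mulr_sumr; apply: eq_bigr => a _.
rewrite /reply_weight wprod_rcons /= mulrA; congr (_ * V _).
by apply/funext => s; exact: pub_massS.
Qed.

Lemma total_mass k : value_process (fun m => \sum_s m s) k = 1.
Proof.
elim: k => [|k IH].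
  rewrite /value_process (big_pred1 [tuple])/=; last by move=> h; apply/esym/eqP; exact: tuple0.
  by rewrite mul1r big_bool !pub_mass0 /init_prob /=; ring.
rewrite value_processS -[RHS]IH /value_process; apply: eq_bigr => h _; congr (_ * _).
have E : \sum_a \sum_s transit (fun s => pub_act k h s a) s = \sum_s pub_mass k h s.
  rewrite /transit; under eq_bigr do rewrite exchange_big/=.
  rewrite exchange_big/=; apply: eq_bigr => s _.
  rewrite -sum_pub_act; apply: eq_bigr => a _.
  by rewrite -mulr_sumr trans_prob_sum1 mulr1.
by rewrite E -mulr_suml dist_sum1 mul1r.
Qed.

End Beliefs.

(** * Telescoping of discounted sums *)

Section Discounting.
Context {R : realType}.
Variables (delta : R).
Hypothesis delta01 : 0 < delta < 1.
Implicit Types (t Phi : nat -> R) (C D e : R).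

Let d0 : 0 < delta. Proof. by case/andP: delta01. Qed.
Let d1 : 0 < 1 - delta. Proof. by case/andP: delta01 => _; rewrite subr_gt0. Qed.
Let dnorm : `|1 - delta| < 1.
Proof. by rewrite gtr0_norm// gtrDl oppr_lt0. Qed.

Definition discounted t : nat -> R := fun k => delta * (1 - delta) ^+ k * t k.

Lemma discounted_cvg t C : (forall k, `|t k| <= C) -> cvgn (series (discounted t)).
Proof.
move=> tC; apply: normed_cvg.
apply: (@series_le_cvg _ _ (geometric (delta * C) (1 - delta))).
- by move=> k; exact: normr_ge0.
- move=> k; rewrite /= mulr_ge0// ?exprn_ge0 ?(ltW d1)// mulr_ge0 ?(ltW d0)//.
  exact: le_trans (normr_ge0 _) (tC 0%N).
- move=> k; rewrite /discounted /= normrM ger0_norm; last first.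
    by rewrite mulr_ge0 ?exprn_ge0 ?ltW.
  by rewrite mulrAC ler_wpM2r ?exprn_ge0 ?(ltW d1)// ler_wpM2l ?(ltW d0).
- exact: is_cvg_geometric_series.
Qed.

Lemma discounted_le t Phi C D e : (forall k, `|t k| <= C) -> (forall k, `|Phi k| <= D) ->
  (forall k, delta * t k + (1 - delta) * Phi k.+1 <= Phi k + e) ->
  limn (series (discounted t)) <= Phi 0%N + e / delta.
Proof.
move=> tC PD h.
(* The shift by [e / delta] absorbs the error of every stage, because the discounting loses exactly
   [delta * (e / delta) = e] of it; the sum then telescopes. *)
pose Psi k := Phi k + e / delta.
have hPsi k : delta * t k <= Psi k - (1 - delta) * Psi k.+1.
  have := h k; rewrite /Psi => hk.
  have E : delta * (e / delta) = e by rewrite mulrCA divff ?mulr1 ?gt_eqF.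
  move: (e / delta) E => x E.
  have -> : Phi k + x - (1 - delta) * (Phi k.+1 + x) =
    Phi k + delta * x - (1 - delta) * Phi k.+1 by ring.
  by rewrite E lerBrDr.
have S_le n : series (discounted t) n <= Psi 0%N - (1 - delta) ^+ n * Psi n.
  elim: n => [|n IH]; first by rewrite /series/= big_geq// expr0 mul1r subrr.
  have -> : series (discounted t) n.+1 = series (discounted t) n + discounted t n.
    by rewrite /series/= big_nat_recr.
  have := hPsi n; have dn : 0 < (1 - delta) ^+ n by exact: exprn_gt0.
  rewrite -(ler_pM2l dn) => h1; rewrite /discounted exprS.
  move: ((1 - delta) ^+ n) (series _ n) h1 IH => x S h1 IH.
  by move: (Psi n) (Psi n.+1) (Psi 0%N) h1 IH => a b c h1 IH; lra.
pose r n := Psi 0%N + (D + `|e / delta|) * (1 - delta) ^+ n.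
have r_cvg : r n @[n --> \oo] --> Psi 0%N.
  rewrite -[X in _ --> X]addr0; apply: cvgD; first exact: cvg_cst.
  exact: cvg_geometric.
rewrite -/(Psi 0%N) -(cvg_lim _ r_cvg)//.
apply: ler_lim; [exact: discounted_cvg tC|by apply/cvg_ex; eexists; exact: r_cvg|].
near=> n; apply: (le_trans (S_le n)); rewrite /r lerD2l.
rewrite mulrC -mulNr ler_wpM2r ?exprn_ge0 ?(ltW d1)//.
rewrite /Psi opprD lerD//.
  by apply: le_trans (PD n); rewrite -normrN ler_norm.
by rewrite -normrN ler_norm.
Unshelve. all: by end_near. Qed.

Lemma discounted_ge t Phi C D e : (forall k, `|t k| <= C) -> (forall k, `|Phi k| <= D) ->
  (forall k, Phi k - e <= delta * t k + (1 - delta) * Phi k.+1) ->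
  Phi 0%N - e / delta <= limn (series (discounted t)).
Proof.
move=> tC PD h.
have /= := @discounted_le (fun k => - t k) (fun k => - Phi k) C D e.
have -> : series (discounted (fun k => - t k)) = (- series (discounted t))%R.
  apply/funext => n; transitivity (- series (discounted t) n) => //.
  rewrite /series/= -sumrN; apply: eq_bigr => k _.
  by rewrite /discounted mulrN.
rewrite limN; last exact: discounted_cvg tC.
move=> H; rewrite -lerN2 opprB [leRHS]addrC; apply: H.
- by move=> k; rewrite normrN.
- by move=> k; rewrite normrN.
- by move=> k; have := h k; rewrite !mulrN; lra.
Qed.

End Discounting.

(** * From one-stage inequalities to bounds on the value *)

Section ValueBounds.
Context {R : realType} {A B : finType}.
Variables (g : state -> A -> B -> R) (delta pi1 pi2 p : R).
Hypotheses (delta01 : 0 < delta < 1).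
Hypotheses (pi1_01 : 0 <= pi1 <= 1) (pi2_01 : 0 <= pi2 <= 1) (p_01 : 0 <= p <= 1).
Variable (V : (state -> R) -> R) (D e : R).
Hypothesis V_bound : forall m, (forall s, 0 <= m s) -> `|V m| <= D * \sum_s m s.

Local Notation Tr := (transit pi1 pi2).

(* [q s a] is the weight of state [s] and action [a]. *)
Definition reply_bound : Prop := forall q : state -> A -> R, (forall s a, 0 <= q s a) ->
  exists b, delta * (\sum_s \sum_a q s a * g s a b) +
    (1 - delta) * (\sum_a V (Tr (fun s => q s a))) <=
    V (fun s => \sum_a q s a) + e * \sum_s \sum_a q s a.

Definition action_bound : Prop := forall m : state -> R, (forall s, 0 <= m s) ->
  exists x : state -> dist R A, forall b,
    V m - e * \sum_s m s <= delta * (\sum_s \sum_a m s * x s a * g s a b) +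
    (1 - delta) * (\sum_a V (Tr (fun s => m s * x s a))).

Section Play.
Variables (sigma : strategy1 R A B) (tau : strategy2 R A B).

Let Q := pub_mass pi1 pi2 p sigma.
Let Act := pub_act pi1 pi2 p sigma.
Let Phi := value_process pi1 pi2 p sigma tau V.
Let t k := stage_payoff g pi1 pi2 p sigma tau k.

Lemma pub_mass_ge0 k h s : 0 <= Q k h s.
Proof. by rewrite /Q -sum_pub_act; apply: sumr_ge0 => a _; exact: pub_act_ge0. Qed.

Lemma value_process_bound k : `|Phi k| <= D.
Proof.
rewrite /Phi /value_process (le_trans (ler_norm_sum _ _ _))//.
rewrite -[leRHS]mulr1 -[X in _ <= D * X](total_mass pi1 pi2 p sigma tau k) mulr_sumr.
apply: ler_sum => h _; rewrite normrM ger0_norm ?reply_weight_ge0// mulrCA.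
by rewrite ler_wpM2l ?reply_weight_ge0//; apply: V_bound => s; exact: pub_mass_ge0.
Qed.

Lemma stage_payoff_bound k : `|t k| <= payoff_bound g.
Proof.
rewrite /t stage_payoffE (le_trans (ler_norm_sum _ _ _))//.
rewrite -[leRHS]mulr1 -[X in _ <= _ * X](total_mass pi1 pi2 p sigma tau k) mulr_sumr.
apply: ler_sum => h _; rewrite normrM ger0_norm ?reply_weight_ge0// mulrCA.
rewrite ler_wpM2l ?reply_weight_ge0//.
rewrite -[leRHS]mul1r -[X in _ <= X * _](dist_sum1 (tau h)) mulr_suml.
rewrite (le_trans (ler_norm_sum _ _ _))//; apply: ler_sum => b _.
rewrite normrM ger0_norm ?dist_ge0// ler_wpM2l ?dist_ge0// mulr_sumr.
rewrite (le_trans (ler_norm_sum _ _ _))//; apply: ler_sum => s _.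
rewrite -sum_pub_act mulr_sumr.
rewrite (le_trans (ler_norm_sum _ _ _))//; apply: ler_sum => a _.
rewrite normrM [X in X * _]ger0_norm ?pub_act_ge0// mulrC.
by rewrite ler_wpM2r ?pub_act_ge0// ler_payoff_bound.
Qed.

Let continuation k (h : seq (A * B)) b := delta * (\sum_s \sum_a Act k h s a * g s a b) +
  (1 - delta) * (\sum_a V (Tr (fun s => Act k h s a))).

Lemma stage_continuation k : delta * t k + (1 - delta) * Phi k.+1 =
  \sum_(h : k.-tuple (A * B)) reply_weight tau h * \sum_b tau h b * continuation k h b.
Proof.
rewrite /t stage_payoffE /Phi value_processS !mulr_sumr -big_split/=.
apply: eq_bigr => h _; rewrite mulrCA [X in _ + X]mulrCA -mulrDr; congr (_ * _).
rewrite !mulr_sumr -big_split/=; apply: eq_bigr => b _.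
by rewrite /continuation mulrDr; congr (_ + _); rewrite mulrCA.
Qed.

Lemma process_shift k c : Phi k + c =
  \sum_(h : k.-tuple (A * B)) reply_weight tau h * (V (Q k h) + c * \sum_s Q k h s).
Proof.
rewrite -{1}[c]mulr1 -[X in _ + c * X](total_mass pi1 pi2 p sigma tau k).
rewrite mulr_sumr /Phi /value_process -big_split/=; apply: eq_bigr => h _.
by rewrite mulrDr; congr (_ + _); rewrite mulrCA.
Qed.

Lemma payoff_le : (forall (h : seq (A * B)) b, 0 < tau h b ->
    continuation (size h) h b <= V (Q (size h) h) + e * \sum_s Q (size h) h s) ->
  payoff g delta pi1 pi2 p sigma tau <= V (init_prob p) + e / delta.
Proof.
move=> hb.
have -> : V (init_prob p) = Phi 0%N.
  rewrite /Phi /value_process (big_pred1 [tuple])/=; last first.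
    by move=> h; apply/esym/eqP; exact: tuple0.
  rewrite /reply_weight /= mul1r; congr V; apply/funext => s.
  by rewrite pub_mass0.
apply: (discounted_le delta01 stage_payoff_bound value_process_bound) => k.
rewrite stage_continuation process_shift; apply: ler_sum => h _.
rewrite ler_wpM2l ?reply_weight_ge0//.
rewrite -[leRHS]mul1r -[X in _ <= X * _](dist_sum1 (tau h)) mulr_suml.
apply: ler_sum => b _.
have := dist_ge0 (tau h) b; rewrite le_eqVlt => /predU1P[<-|tb].
  by rewrite !mul0r.
by rewrite ler_pM2l//; have := hb h b tb; rewrite size_tuple.
Qed.

Lemma payoff_ge : (forall (h : seq (A * B)) b,
    V (Q (size h) h) - e * \sum_s Q (size h) h s <= continuation (size h) h b) ->
  V (init_prob p) - e / delta <= payoff g delta pi1 pi2 p sigma tau.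
Proof.
move=> hb.
have -> : V (init_prob p) = Phi 0%N.
  rewrite /Phi /value_process (big_pred1 [tuple])/=; last first.
    by move=> h; apply/esym/eqP; exact: tuple0.
  rewrite /reply_weight /= mul1r; congr V; apply/funext => s.
  by rewrite pub_mass0.
apply: (discounted_ge delta01 stage_payoff_bound value_process_bound) => k.
rewrite stage_continuation process_shift; apply: ler_sum => h _.
rewrite ler_wpM2l ?reply_weight_ge0//.
rewrite -[leLHS]mul1r -[X in X * _ <= _](dist_sum1 (tau h)) mulr_suml.
apply: ler_sum => b _; rewrite ler_wpM2l ?dist_ge0//.
by have := hb h b; rewrite size_tuple mulNr.
Qed.

End Play.

(** Player 2 replies to an optimal [sigma] provided by [is_value]. Since [sigma] is fixed, the
    weights [pub_act] after each public history are known, and no play of Player 2 influences them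
    otherwise. *)
Lemma is_value_le v : reply_bound -> is_value g delta pi1 pi2 p v ->
  v <= V (init_prob p) + e / delta.
Proof.
move=> hr [[[sigma [_ vmin]] _] _].
pose q h := pub_act pi1 pi2 p sigma (size h) h.
have q0 (h : seq (A * B)) s a : 0 <= q h s a by exact: pub_act_ge0.
pose tau (h : seq (A * B)) := @dirac_dist R B (projT1 (cid (hr (q h) (q0 h)))).
apply: (le_trans (vmin (payoff g delta pi1 pi2 p sigma tau) _)); first by exists tau.
apply: payoff_le => h b; rewrite /tau /=.
case: cid => b0 /= hb0; case: eqVneq => [-> _|]; last by rewrite ltxx.
apply: (le_trans hb0); rewrite le_eqVlt; apply/orP; left; apply/eqP.
congr (V _ + e * _); first by apply/funext => s; exact: sum_pub_act.
by apply: eq_bigr => s _; exact: sum_pub_act.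
Qed.

Lemma is_value_ge v : action_bound -> is_value g delta pi1 pi2 p v ->
  V (init_prob p) - e / delta <= v.
Proof.
move=> ha [_ [[tau [_ vmax]] _]].
have [X hX] : {X : (state -> R) -> state -> dist R A | forall m, (forall s, 0 <= m s) ->
    forall b, V m - e * \sum_s m s <= delta * (\sum_s \sum_a m s * X m s a * g s a b) +
    (1 - delta) * (\sum_a V (Tr (fun s => m s * X m s a)))}.
  apply: cid; have [x0 _] := ha (fun=> 0) (fun=> lexx _).
  pose X m := match pselect (forall s, 0 <= m s) with
    | left h => projT1 (cid (ha m h)) | right _ => x0 end.
  exists X => m m0 b; rewrite /X; case: pselect => // h.
  by case: cid => x /= hx; exact: hx.
pose upd (m : state -> R) (ab : A * B) := Tr (fun s => m s * X m s ab.1).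
(* The strategy must depend on the belief that it itself generates. The circle is broken by
   computing the belief along the public history from the one-stage rule [X]; [massE] checks
   afterwards that it is the right one. *)
pose mass := foldl upd (init_prob p).
pose sigma (H : seq (state * A * B)) s := X (mass (map (@public A B) H)) s.
apply: le_trans (_ : payoff g delta pi1 pi2 p sigma tau <= v); last first.
  by apply: vmax; exists sigma.
have actE k h s a : pub_act pi1 pi2 p sigma k h s a =
    pub_mass pi1 pi2 p sigma k h s * X (mass h) s a.
  rewrite /pub_act /pub_mass mulr_suml; apply: eq_bigr => H /eqP hH.
  by rewrite /sigma hH.
have massE h : pub_mass pi1 pi2 p sigma (size h) h = mass h.
  elim/last_ind: h => [|h [a b] IH].
    by apply/funext => s; rewrite pub_mass0.
  rewrite /mass foldl_rcons -/(mass h) size_rcons; apply/funext => s.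
  rewrite pub_massS /upd /=; congr (Tr _ s); apply/funext => s'.
  by rewrite actE IH.
apply: payoff_ge => h b.
have E s a : pub_act pi1 pi2 p sigma (size h) h s a = mass h s * X (mass h) s a.
  by rewrite actE massE.
have m0 s : 0 <= mass h s by rewrite -massE; exact: pub_mass_ge0.
rewrite massE; apply: (le_trans (hX (mass h) m0 b)).
rewrite le_eqVlt; apply/orP; left; apply/eqP; congr (_ * _ + _ * _).
  by apply: eq_bigr => s _; apply: eq_bigr => a _; rewrite E.
apply: eq_bigr => a _; congr (V (Tr _)).
by apply/funext => s; rewrite E.
Qed.

End ValueBounds.

(** * Bounds on the discounted values *)

Section BellmanBounds.
Context {R : realType} {A B : finType}.
Variables (g : state -> A -> B -> R) (delta pi1 pi2 : R).
Hypotheses (hA : (0 < #|A|)%N) (hB : (0 < #|B|)%N).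
Hypotheses (delta01 : 0 < delta < 1).
Hypotheses (pi1_01 : 0 <= pi1 <= 1) (pi2_01 : 0 <= pi2 <= 1).

Local Notation Tr := (transit pi1 pi2).
Let u := nonrevealing_value g.

Definition next_belief (q : R) : R := q * (1 - pi1) + (1 - q) * pi2.
Local Notation T := next_belief.

(* Homogeneous extension of a function of the belief to unnormalised beliefs
   (zero at the null vector). *)
Definition hom (W : R -> R) (m : state -> R) : R :=
  (m true + m false) * W (m true / (m true + m false)).

Lemma sum_state (m : state -> R) : \sum_s m s = m true + m false.
Proof. by rewrite big_bool. Qed.

Lemma hom_bound W D : (forall q, 0 <= q <= 1 -> `|W q| <= D) ->
  forall m : state -> R, (forall s, 0 <= m s) -> `|hom W m| <= D * \sum_s m s.
Proof.
move=> WD m m0; rewrite sum_state /hom.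
have t0 : 0 <= m true + m false by rewrite addr_ge0.
have [->|tn] := eqVneq (m true + m false) 0; first by rewrite mul0r mulr0 normr0.
rewrite normrM ger0_norm// mulrC ler_wpM2r//; apply: WD.
rewrite divr_ge0//= ler_pdivrMr ?mul1r ?lerDl//.
by rewrite lt_neqAle eq_sym tn.
Qed.

Lemma hom_scale W (A0 q : R) (m : state -> R) : m true = A0 * q -> m false = A0 * (1 - q) ->
  hom W m = A0 * W q.
Proof.
move=> mt mf; rewrite /hom.
have -> : m true + m false = A0 by rewrite mt mf; ring.
have [->|A0n] := eqVneq A0 0; first by rewrite !mul0r.
by rewrite mt [A0 * q / A0]mulrAC divff// mul1r.
Qed.

Lemma transit_true m : Tr m true = m true * (1 - pi1) + m false * pi2.
Proof. by rewrite /transit big_bool. Qed.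

Lemma transit_false m : Tr m false = m true * pi1 + m false * (1 - pi2).
Proof. by rewrite /transit big_bool. Qed.

Lemma hom_transit W (A0 q : R) (m : state -> R) : m true = A0 * q ->
  m false = A0 * (1 - q) -> hom W (Tr m) = A0 * W (T q).
Proof.
by move=> mt mf; apply: hom_scale;
  rewrite ?transit_true ?transit_false mt mf /next_belief; ring.
Qed.

Lemma next_belief01 q : 0 <= q <= 1 -> 0 <= T q <= 1.
Proof.
move=> /andP[q0 q1]; move: pi1_01 pi2_01 => /andP[a0 a1] /andP[b0 b1].
have h1 : 0 <= q * (1 - pi1) by apply: mulr_ge0; lra.
have h2 : 0 <= (1 - q) * pi2 by apply: mulr_ge0; lra.
have h3 : 0 <= q * pi1 by apply: mulr_ge0; lra.
have h4 : 0 <= (1 - q) * (1 - pi2) by apply: mulr_ge0; lra.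
by rewrite /next_belief; lra.
Qed.

Lemma next_belief_dist q : 0 <= q <= 1 -> `|q - T q| <= pi1 + pi2.
Proof.
move=> /andP[q0 q1]; move: pi1_01 pi2_01 => /andP[a0 a1] /andP[b0 b1].
have h1 : 0 <= (1 - q) * pi2 by apply: mulr_ge0; lra.
have h2 : 0 <= q * pi1 by apply: mulr_ge0; lra.
have h3 : 0 <= (1 - q) * pi1 by apply: mulr_ge0; lra.
have h4 : 0 <= q * pi2 by apply: mulr_ge0; lra.
by rewrite ler_norml /next_belief; lra.
Qed.

Variables (W dW : R -> R).
Hypothesis W_sg : supergrad W dW 0 1.

Let d0 : 0 < delta. Proof. by case/andP: delta01. Qed.
Let d1 : 0 < 1 - delta. Proof. by case/andP: delta01 => _; rewrite subr_gt0. Qed.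

Section Upper.
Variables (e1 c : R).
Hypothesis c_gt0 : 0 < c.
Hypothesis W_upper : forall q, 0 <= q <= 1 ->
  delta * u q + (1 - delta) * W (T q) <= W q + e1.

Let M := 2 * payoff_bound g + 2 * payoff_bound g.

(* The quadratic term makes [W] strictly concave enough to pay for the
   information revealed by Player 1. *)
Let W2 q := W q + c * delta * (1 - q ^+ 2).
(** The transition moves the belief by at most [pi1 + pi2], hence its square by at most twice
    that. *)
Let e2 := e1 + 2 * c * delta * (pi1 + pi2).

Let W2_upper q : 0 <= q <= 1 -> delta * u q + (1 - delta) * W2 (T q) <= W2 q + e2.
Proof.
move=> q01; have := W_upper q01.
have /andP[t0 t1] := next_belief01 q01.
have := next_belief_dist q01; rewrite ler_norml => /andP[n1 n2].
move: q01 => /andP[q0 q1].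
rewrite /W2 /e2; move: (T q) t0 t1 n1 n2 => t t0 t1 n1 n2 h.
have cd : 0 < c * delta by exact: mulr_gt0.
have h1 : 0 <= c * delta * (delta * (1 - t ^+ 2)).
  apply: mulr_ge0; first exact: ltW.
  by apply: mulr_ge0; [exact: ltW|rewrite subr_ge0 expr_le1].
have h2 : 0 <= c * delta * ((pi1 + pi2) * 2 - (q - t) * (q + t)).
  apply: mulr_ge0; first exact: ltW.
  have h3 : 0 <= (pi1 + pi2 - (q - t)) * (q + t) by apply: mulr_ge0; lra.
  have h4 : 0 <= (pi1 + pi2) * (2 - (q + t)).
    by apply: mulr_ge0; move: pi1_01 pi2_01 => /andP[? ?] /andP[? ?]; lra.
  lra.
lra.
Qed.

(** Player 2 answers the average action at the average belief [P]. Against an action with posterior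
    [r] this is wrong by at most [M * |r - P|] per unit of [delta], which the quadratic term
    covers. *)
Lemma belief_upper : reply_bound g delta pi1 pi2 (hom W2) (e2 + delta * (M ^+ 2 / (4 * c))).
Proof.
move=> q q0.
pose X a := q true a + q false a.
have X0 a : 0 <= X a by rewrite addr_ge0.
pose tot := \sum_a X a.
have totE : \sum_s \sum_a q s a = tot by rewrite sum_state -big_split.
have t0 : 0 <= tot by exact: sumr_ge0.
pose P := (\sum_a q true a) / tot.
have [tot0|totn] := eqVneq tot 0.
  have X00 a : X a = 0.
    by apply/eqP; move/eqP: tot0; rewrite psumr_eq0// => /allP/(_ a (mem_index_enum _)).
  have q00 s a : q s a = 0.
    have h := X00 a; have := q0 true a; have := q0 false a; rewrite /X in h.
    by case: s => ? ?; apply/eqP; rewrite eq_le q0 andbT; lra.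
  exists (enum_val (Ordinal hB)).
  rewrite totE tot0 mulr0 addr0 big1; last first.
    by move=> s _; rewrite big1// => a _; rewrite q00 mul0r.
  rewrite big1 => [|a _]; last first.
    by rewrite (@hom_transit _ 0 0) ?mul0r// q00.
  by rewrite /hom !big1 ?addr0 ?mul0r ?mulr0// => a _; rewrite q00.
have tot_gt0 : 0 < tot by rewrite lt_neqAle eq_sym totn.
have P01 : 0 <= P <= 1.
  rewrite divr_ge0 ?sumr_ge0//= ler_pdivrMr// mul1r.
  by apply: ler_sum => a _; rewrite lerDl.
have x0 a : 0 <= X a / tot by rewrite divr_ge0.
have x1 : \sum_a X a / tot = 1 by rewrite -mulr_suml divff.
have [b hb] := nonrevealing_value_reply g hA hB P (Dist x0 x1).
exists b.
have VE : hom W2 (fun s => \sum_a q s a) = tot * W2 P.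
  apply: hom_scale; first by rewrite mulrC divfK.
  have -> : tot * (1 - P) = tot - tot * P by rewrite mulrBr mulr1.
  by rewrite [tot * P]mulrC divfK// /tot big_split/= addrC addrK.
rewrite VE totE.
rewrite exchange_big/= mulr_sumr mulr_sumr -big_split/=.
set E := e2 + _.
(* A supergradient of [W2] at [P]. Its contribution cancels in the sum over actions because the
   posteriors average to [P]. *)
pose D := dW P - 2 * c * delta * P.
have PayE : \sum_a X a * avg_payoff g P a b <= tot * u P.
  rewrite -ler_pdivrMl// mulr_sumr; apply: le_trans hb.
  rewrite le_eqVlt; apply/orP; left; apply/eqP.
  by apply: eq_bigr => a _ /=; ring.
have DE : \sum_a (D * (q true a - X a * P)) = 0.
  rewrite -mulr_sumr sumrB -mulr_suml -/tot.
  by rewrite [tot * P]mulrC divfK// subrr mulr0.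
have -> : tot * W2 P + E * tot =
  \sum_a (X a * (W2 P + E) + D * (q true a - X a * P)).
  by rewrite big_split/= DE addr0 -mulr_suml -/tot; ring.
have le_sum : \sum_a (delta * \sum_s q s a * g s a b +
      (1 - delta) * hom W2 (Tr (fun s => q s a))) <=
    \sum_a (X a * (W2 P + E) + D * (q true a - X a * P) +
      delta * (X a * avg_payoff g P a b - X a * u P)).
  apply: ler_sum => a _; rewrite sum_state.
  have [Xa0|Xan] := eqVneq (X a) 0.
    have h := q0 true a; have h' := q0 false a.
    have qt : q true a = 0 by rewrite /X in Xa0; lra.
    have qf : q false a = 0 by rewrite /X in Xa0; lra.
    by rewrite (@hom_transit _ 0 0) ?qt ?qf ?mul0r// Xa0 !mul0r !(mulr0, addr0, subr0).
  have Xa : 0 < X a by rewrite lt_neqAle eq_sym Xan X0.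
  pose r := q true a / X a.
  have qt : q true a = X a * r by rewrite mulrC divfK.
  have qf : q false a = X a * (1 - r) by rewrite mulrBr mulr1 -qt /X; ring.
  have r01 : 0 <= r <= 1.
    by rewrite divr_ge0//= ler_pdivrMr// mul1r lerDl.
  rewrite (@hom_transit _ (X a) r)// qt qf.
  have h1 := W2_upper r01.
  have h2 : avg_payoff g r a b <= avg_payoff g P a b + 2 * payoff_bound g * `|r - P|.
    have := avg_payoff_lipschitz g r P a b.
    by rewrite ler_norml => /andP[_]; lra.
  have h3 : u P <= u r + 2 * payoff_bound g * `|r - P|.
    have := nonrevealing_value_lipschitz g hA hB P r.
    by rewrite ler_norml distrC -/u => /andP[_]; lra.
  have h4 : W2 r <= W2 P + D * (r - P) - c * delta * (r - P) ^+ 2.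
    by have := W_sg P01 r01; rewrite /W2 /D; lra.
  (* Completing the square; the remainder [M ^+ 2 / (4 * c)] is the price of not knowing the
     posterior and vanishes as [c] grows. *)
  have h5 : M * `|r - P| <= c * (r - P) ^+ 2 + M ^+ 2 / (4 * c).
    have -> : (r - P) ^+ 2 = `|r - P| ^+ 2 by rewrite real_normK ?num_real.
    move: `|r - P| => z.
    have E1 : c * z ^+ 2 + M ^+ 2 / (4 * c) - M * z = (2 * c * z - M) ^+ 2 / (4 * c).
      by field; rewrite gt_eqF.
    rewrite -subr_ge0 E1 divr_ge0 ?sqr_ge0//.
    by apply: mulr_ge0 => //; exact: ltW.
  rewrite -subr_ge0.
  have -> : X a * (W2 P + E) + D * (X a * r - X a * P) +
      delta * (X a * avg_payoff g P a b - X a * u P) -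
      (delta * (X a * r * g true a b + X a * (1 - r) * g false a b) +
       (1 - delta) * (X a * W2 (T r))) =
      X a * (W2 P + E + D * (r - P) + delta * (avg_payoff g P a b - u P) -
       delta * avg_payoff g r a b - (1 - delta) * W2 (T r)).
    by rewrite /avg_payoff; ring.
  apply: mulr_ge0 => //.
  have k2 := ler_wpM2l (ltW d0) h2.
  have k3 := ler_wpM2l (ltW d0) h3.
  have k5 := ler_wpM2l (ltW d0) h5.
  move: h1 h4 k2 k3 k5; rewrite /E /M.
  move: (W2 (T r)) (W2 P) (W2 r) (avg_payoff g r a b) (avg_payoff g P a b) (u P) (u r).
  move: (`|r - P|) (D * (r - P)) ((r - P) ^+ 2) => z1 z2 z3 z4 z5 z6 z7 z8 z9 z10.
  move: (_ ^+ 2 / _) => z11; lra.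
apply: (le_trans le_sum); rewrite big_split/= -mulr_sumr sumrB -mulr_suml -/tot.
rewrite gerDl pmulr_rle0// subr_le0.
exact: PayE.
Qed.

End Upper.
End BellmanBounds.

Section BellmanLower.
Context {R : realType} {A B : finType}.
Variables (g : state -> A -> B -> R) (delta pi1 pi2 : R).
Hypotheses (hA : (0 < #|A|)%N) (hB : (0 < #|B|)%N).
Hypotheses (delta01 : 0 < delta < 1).
Hypotheses (pi1_01 : 0 <= pi1 <= 1) (pi2_01 : 0 <= pi2 <= 1).

Local Notation Tr := (transit pi1 pi2).
Local Notation T := (next_belief pi1 pi2).
Let u := nonrevealing_value g.

Variables (W dW : R -> R) (e1 : R).
Hypothesis W_sg : supergrad W dW 0 1.

Let d0 : 0 < delta. Proof. by case/andP: delta01. Qed.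
Let d1 : 0 < 1 - delta. Proof. by case/andP: delta01 => _; rewrite subr_gt0. Qed.

(** The homogeneous extension of a concave function is superadditive: merging two unnormalised
    beliefs cannot lower it. *)
Lemma hom_superadd (a b y z : R) (m : state -> R) : 0 <= a -> 0 <= b ->
  0 <= y <= 1 -> 0 <= z <= 1 -> m true = a * y + b * z ->
  m false = a * (1 - y) + b * (1 - z) -> a * W y + b * W z <= hom W m.
Proof.
move=> a0 b0 y01 z01 mt mf.
have [ab0|abn] := eqVneq (a + b) 0.
  have a00 : a = 0 by lra.
  have b00 : b = 0 by lra.
  by rewrite /hom mt mf a00 b00 !mul0r !addr0 mul0r.
have ab : 0 < a + b by rewrite lt_neqAle eq_sym abn addr_ge0.
pose P := (a * y + b * z) / (a + b).
have PE : (a + b) * P = a * y + b * z by rewrite mulrC divfK.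
have P01 : 0 <= P <= 1.
  move: y01 z01 => /andP[y0 y1] /andP[z0 z1].
  rewrite divr_ge0 ?(ltW ab) ?addr_ge0 ?mulr_ge0//= ler_pdivrMr// mul1r.
  by rewrite lerD// ler_piMr.
have mt' : m true = (a + b) * P by rewrite PE.
have mf' : m false = (a + b) * (1 - P) by rewrite [RHS]mulrBr mulr1 PE mf; ring.
rewrite (hom_scale W mt' mf').
have h1 := ler_wpM2l a0 (W_sg P01 y01).
have h2 := ler_wpM2l b0 (W_sg P01 z01).
apply: (le_trans (lerD h1 h2)); rewrite le_eqVlt; apply/orP; left; apply/eqP.
transitivity ((a + b) * W P + dW P * (a * y + b * z - (a + b) * P)); first by ring.
by rewrite PE subrr mulr0 addr0.
Qed.

Definition secured (q : R) : Prop :=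
  W q <= delta * u q + (1 - delta) * W (T q) + e1.

(* Player 1 splits the belief [q] between [y] and [z], where playing without
   revealing the state is good enough. *)
Hypothesis W_lower : forall q, 0 <= q <= 1 -> exists y z al,
  [/\ 0 <= al <= 1, 0 <= y <= 1, 0 <= z <= 1, secured y /\ secured z &
   q = al * y + (1 - al) * z /\ W q <= al * W y + (1 - al) * W z].

Lemma split_dist (w1 w2 : R) (x1 x2 : dist R A) : 0 <= w1 -> 0 <= w2 ->
  exists x : dist R A, forall a, (w1 + w2) * x a = w1 * x1 a + w2 * x2 a.
Proof.
move=> w10 w20; have [w0|wn] := eqVneq (w1 + w2) 0.
  have -> : w1 = 0 by lra.
  have -> : w2 = 0 by lra.
  by exists x1 => a; rewrite addr0 !mul0r addr0.
have w0 : 0 < w1 + w2 by rewrite lt_neqAle eq_sym wn addr_ge0.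
pose x a := (w1 * x1 a + w2 * x2 a) / (w1 + w2).
have x0 a : 0 <= x a.
  by rewrite divr_ge0 ?(ltW w0)// addr_ge0// mulr_ge0// dist_ge0.
have xs : \sum_a x a = 1.
  by rewrite -mulr_suml big_split/= -!mulr_sumr !dist_sum1 !mulr1 divff.
by exists (Dist x0 xs) => a /=; rewrite mulrC divfK.
Qed.

(** Player 1 draws, with probabilities depending on the state, which of the almost optimal actions
    [xy] and [xz] to use, so that the draw itself would lead to the posteriors [y] and [z]. *)
Lemma belief_lower eta : 0 < eta ->
  action_bound g delta pi1 pi2 (hom W) (e1 + delta * eta).
Proof.
move=> eta0 m m0; pose tot := m true + m false.
have t0 : 0 <= tot by rewrite addr_ge0.
have [tot0|totn] := eqVneq tot 0.
  have mE s : m s = 0.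
    have := m0 true; have := m0 false; move: tot0; rewrite /tot.
    by case: s => ? ? ?; lra.
  exists (fun=> dirac_dist (enum_val (Ordinal hA))) => b.
  rewrite /hom sum_state !mE addr0 !mul0r mulr0 subrr.
  rewrite big1 ?mulr0 ?add0r => [|s _]; last first.
    by rewrite big1// => a _; rewrite mE !mul0r.
  rewrite big1 ?mulr0// => a _.
  by rewrite transit_true transit_false !mE !mul0r !addr0 mul0r.
have tot_gt0 : 0 < tot by rewrite lt_neqAle eq_sym totn.
pose q := m true / tot.
have mt : m true = tot * q by rewrite mulrC divfK.
have mf : m false = tot * (1 - q) by rewrite mulrBr mulr1 -mt /tot; ring.
have q01 : 0 <= q <= 1.
  by rewrite divr_ge0//= ler_pdivrMr// mul1r lerDl.
have [y [z [al [/andP[al0 al1] y01 z01 [sy sz] [qE Wq]]]]] := W_lower q01.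
have [xy hxy] := nonrevealing_value_approx g hA hB y eta0.
have [xz hxz] := nonrevealing_value_approx g hA hB z eta0.
have al1' : 0 <= 1 - al by lra.
move: (y01) (z01) => /andP[y0 y1] /andP[z0 z1].
have [xt hxt] : exists x : dist R A, forall a, (al * y + (1 - al) * z) * x a =
    al * y * xy a + (1 - al) * z * xz a.
  by apply: split_dist; apply: mulr_ge0.
have [xf hxf] : exists x : dist R A, forall a,
    (al * (1 - y) + (1 - al) * (1 - z)) * x a =
    al * (1 - y) * xy a + (1 - al) * (1 - z) * xz a.
  by apply: split_dist; apply: mulr_ge0 => //; lra.
pose x (s : state) := if s then xt else xf.
exists x => b.
have Et a : m true * x true a = tot * (al * y * xy a + (1 - al) * z * xz a).
  by rewrite mt -mulrA qE hxt.
have Ef a : m false * x false a =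
    tot * (al * (1 - y) * xy a + (1 - al) * (1 - z) * xz a).
  rewrite mf -mulrA -hxf; congr (_ * (_ * _)); rewrite qE; ring.
have payE : \sum_s \sum_a m s * x s a * g s a b =
    tot * (al * pure_reply_payoff g y xy b + (1 - al) * pure_reply_payoff g z xz b).
  rewrite sum_state -big_split/= /pure_reply_payoff !mulr_sumr -big_split/=.
  rewrite mulr_sumr; apply: eq_bigr => a _.
  by rewrite Et Ef /avg_payoff; ring.
(* Player 2 sees only the action, which may be common to [xy] and [xz]. The belief is then a merge
   of the two, and superadditivity says that this does not hurt Player 1. *)
have contE : tot * (al * W (T y) + (1 - al) * W (T z)) <=
    \sum_a hom W (Tr (fun s => m s * x s a)).
  have -> : tot * (al * W (T y) + (1 - al) * W (T z)) =
      \sum_a (tot * al * xy a * W (T y) + tot * (1 - al) * xz a * W (T z)).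
    by rewrite big_split/= -!mulr_suml -!mulr_sumr !dist_sum1; ring.
  apply: ler_sum => a _; apply: hom_superadd.
  - by rewrite !mulr_ge0 ?dist_ge0.
  - by rewrite !mulr_ge0 ?dist_ge0.
  - exact: next_belief01.
  - exact: next_belief01.
  - by rewrite transit_true Et Ef /next_belief; ring.
  - by rewrite transit_false Et Ef /next_belief; ring.
have VE : hom W m = tot * W q by apply: hom_scale.
rewrite VE payE sum_state -/tot.
apply: (@le_trans _ _ (delta * (tot * (al * (u y - eta) + (1 - al) * (u z - eta))) +
  (1 - delta) * (tot * (al * W (T y) + (1 - al) * W (T z))))); last first.
  apply: lerD; last by apply: ler_wpM2l => //; exact: ltW.
  apply: ler_wpM2l; first exact: ltW.
  apply: ler_wpM2l => //; apply: lerD; apply: ler_wpM2l => //; apply/ltW;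
    [exact: hxy|exact: hxz].
move: sy sz; rewrite /secured => sy sz.
have k1 := ler_wpM2l al0 sy.
have k2 := ler_wpM2l al1' sz.
have -> : delta * (tot * (al * (u y - eta) + (1 - al) * (u z - eta))) +
  (1 - delta) * (tot * (al * W (T y) + (1 - al) * W (T z))) =
  tot * (al * (delta * u y + (1 - delta) * W (T y)) +
    (1 - al) * (delta * u z + (1 - delta) * W (T z)) - delta * eta) by ring.
have -> : tot * W q - (e1 + delta * eta) * tot = tot * (W q - e1 - delta * eta) by ring.
apply: ler_wpM2l => //.
move: k1 k2 Wq; move: (delta * u y + (1 - delta) * W (T y)).
move: (delta * u z + (1 - delta) * W (T z)) => a1 a2.
rewrite !mulrDr; move: (delta * eta) => a3; lra.
Qed.

End BellmanLower.

Section StageValueBounds.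
Context {R : realType} {A B : finType}.
Variables (g : state -> A -> B -> R) (delta pi1 pi2 p v : R).
Hypotheses (hA : (0 < #|A|)%N) (hB : (0 < #|B|)%N).
Hypotheses (delta01 : 0 < delta < 1).
Hypotheses (pi1_01 : 0 <= pi1 <= 1) (pi2_01 : 0 <= pi2 <= 1) (p_01 : 0 <= p <= 1).
Hypothesis hv : is_value g delta pi1 pi2 p v.
Variables (W dW : R -> R) (D : R).
Hypothesis W_sg : supergrad W dW 0 1.
Hypothesis W_bound : forall q, 0 <= q <= 1 -> `|W q| <= D.

Let d0 : 0 < delta. Proof. by case/andP: delta01. Qed.

Let hom_init (V : R -> R) : hom V (init_prob p) = V p.
Proof. by rewrite (@hom_scale _ V 1 p)// /init_prob mul1r. Qed.

Lemma stage_value_upper e1 c : 0 < c ->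
  (forall q, 0 <= q <= 1 -> delta * nonrevealing_value g q +
     (1 - delta) * W (next_belief pi1 pi2 q) <= W q + e1) ->
  v <= W p + c * delta + e1 / delta + 2 * c * (pi1 + pi2) +
     (4 * payoff_bound g) ^+ 2 / (4 * c).
Proof.
move=> c0 hW.
have hr := belief_upper hA hB delta01 pi1_01 pi2_01 W_sg c0 hW.
have bnd : forall m : state -> R, (forall s, 0 <= m s) ->
    `|hom (fun q => W q + c * delta * (1 - q ^+ 2)) m| <= (D + c * delta) * \sum_s m s.
  apply: hom_bound => q q01.
  rewrite (le_trans (ler_normD _ _))// lerD ?W_bound//.
  have cd : 0 <= c * delta by rewrite mulr_ge0// ltW.
  move: q01 => /andP[q0 q1].
  have q21 : q ^+ 2 <= 1 by rewrite expr_le1.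
  rewrite normrM (ger0_norm cd) ler_piMr// ger0_norm ?subr_ge0//.
  by rewrite gerBl sqr_ge0.
have := is_value_le delta01 pi1_01 pi2_01 p_01 bnd hr hv.
rewrite hom_init => h; apply: (le_trans h).
have cd : 0 <= c * delta * p ^+ 2 by rewrite mulr_ge0 ?sqr_ge0// mulr_ge0// ltW.
have -> : (e1 + 2 * c * delta * (pi1 + pi2) + delta *
   ((2 * payoff_bound g + 2 * payoff_bound g) ^+ 2 / (4 * c))) / delta =
   e1 / delta + 2 * c * (pi1 + pi2) + (4 * payoff_bound g) ^+ 2 / (4 * c).
  by field; rewrite !gt_eqF.
move: (e1 / delta) (_ ^+ 2 / _) => x y; lra.
Qed.

Lemma stage_value_lower e1 eta : 0 < eta ->
  (forall q, 0 <= q <= 1 -> exists y z al,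
  [/\ 0 <= al <= 1, 0 <= y <= 1, 0 <= z <= 1,
   secured g delta pi1 pi2 W e1 y /\ secured g delta pi1 pi2 W e1 z &
   q = al * y + (1 - al) * z /\ W q <= al * W y + (1 - al) * W z]) ->
  W p - e1 / delta - eta <= v.
Proof.
move=> eta0 hW.
have ha := belief_lower hA hB delta01 pi1_01 pi2_01 W_sg hW eta0.
have bnd := hom_bound W_bound.
have := is_value_ge delta01 pi1_01 pi2_01 p_01 bnd ha hv.
rewrite hom_init mulrDl [delta * eta]mulrC mulfK ?gt_eqF//.
by rewrite opprD addrA.
Qed.

End StageValueBounds.

(** * The function produced by the algorithm *)

Section AlgorithmRun.
Context {R : realType}.
Variables (u : R -> R) (ps mu L : R) (cs : seq R).
Hypotheses (mu_gt0 : 0 < mu) (ps01 : 0 < ps < 1) (L_ge0 : 0 <= L).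
Hypothesis (uL : forall p q, `|u p - u q| <= L * `|p - q|).
Hypothesis (ucs : breakpoints u cs).

Let ps0 : 0 < ps. Proof. by case/andP: ps01. Qed.
Let ps1 : ps < 1. Proof. by case/andP: ps01. Qed.
Let ps_ge0 : 0 <= ps. Proof. exact: ltW. Qed.
Let ps'01 : 0 < 1 - ps < 1.
Proof. by move: ps0 ps1; lra. Qed.
Let ps'_ge0 : 0 <= 1 - ps. Proof. by move: ps1; lra. Qed.

Let breakpoints_mir : breakpoints (mir u) [seq 1 - x | x <- cs].
Proof.
move=> c d cd hcs.
have cd' : 1 - d < 1 - c by lra.
have [|h|h] := ucs cd'.
- move=> x xcs; have := hcs (1 - x) (map_f _ xcs).
  by apply: contra => /andP[? ?]; lra.
- left => s p t cs' sp pt td.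
  have := @h (1 - t) (1 - p) (1 - s) (ltac:(lra)) (ltac:(lra)) (ltac:(lra)) (ltac:(lra)).
  by rewrite /mir; lra.
- right => s p t cs' sp pt td.
  have := @h (1 - t) (1 - p) (1 - s) (ltac:(lra)) (ltac:(lra)) (ltac:(lra)) (ltac:(lra)).
  by rewrite /mir; lra.
Qed.

Let up := run_up u ps mu.
Let dn k := mir_state (run_down u ps mu k).

Let mirL : forall p q, `|mir u p - mir u q| <= L * `|p - q| := mir_lipschitz uL.

Let good_at_singular W dW p (v : R -> R) z : good v z mu W dW p -> p = z -> W p = v p.
Proof.
rewrite /good /ode_gap => h pz; move: h; rewrite pz subrr mulr0 => /eqP.
by rewrite mulf_eq0 gt_eqF//= subr_eq0 => /eqP.
Qed.

Let up_step_ok a0 p0 k dW : up_inv u ps mu a0 p0 (up k).1 (up k).2 dW ->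
  (up k).1 < 1 -> up_step u ps mu (up k).1 (up k).2 (up k.+1).1 (up k.+1).2.
Proof.
move=> inv p1; apply: (step_upP mu_gt0 ps_ge0 uL) => //.
  by have [] := up_range inv.
exact: good_at_singular (up_good inv).
Qed.

Let dn_step_ok a0 p0 k dW : up_inv (mir u) (1 - ps) mu a0 p0 (dn k).1 (dn k).2 dW ->
  (dn k).1 < 1 -> up_step (mir u) (1 - ps) mu (dn k).1 (dn k).2 (dn k.+1).1 (dn k.+1).2.
Proof.
move=> inv p1.
have psl : 0 <= ps <= 1 by rewrite !ltW.
have [h1 _ _] := up_range inv; rewrite /dn /= in h1 p1.
apply: (step_downP mu_gt0 psl uL); [lra|lra|] => hp.
have := good_at_singular (up_good inv).
by rewrite /dn /= hp => /(_ erefl); rewrite /mir !onemK.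
Qed.

Let up_stop k : 1 <= (up k).1 -> up k.+1 = up k.
Proof. exact: step_up_stop. Qed.

Let dn_stop k : 1 <= (dn k).1 -> dn k.+1 = dn k.
Proof.
rewrite /dn /=; case: (run_down u ps mu k) => p W /= h.
by congr mir_state; rewrite /= ltNge ifF//; apply/negbTE; rewrite negbK; lra.
Qed.

Definition splittable W dW (x : R) : Prop := exists y z al,
    [/\ 0 <= al <= 1, 0 <= y <= 1, 0 <= z <= 1,
      good u ps mu W dW y /\ good u ps mu W dW z &
      x = al * y + (1 - al) * z /\ W x <= al * W y + (1 - al) * W z].

Lemma splittable_good W dW x : 0 <= x <= 1 -> good u ps mu W dW x -> splittable W dW x.
Proof.
move=> x01 gx; exists x, x, 1; rewrite lexx ler01 subrr !mul1r !mul0r !addr0.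
by split.
Qed.

Lemma splittable_chord W dW x y z : 0 <= y -> y < z -> z <= 1 -> y <= x <= z ->
  good u ps mu W dW y -> good u ps mu W dW z ->
  W x * (z - y) = W y * (z - x) + W z * (x - y) -> splittable W dW x.
Proof.
move=> y0 yz z1 /andP[yx xz] gy gz E.
have zy0 : 0 < z - y by lra.
exists y, z, ((z - x) / (z - y)); split => //; [|lra|lra|].
  by rewrite divr_ge0 ?subr_ge0 ?(ltW yz)//= ler_pdivrMr// mul1r lerD2l lerN2.
split; first by field; rewrite gt_eqF.
rewrite le_eqVlt; apply/orP; left; apply/eqP.
by rewrite -[W x](mulfK (lt0r_neq0 zy0)) E; field; rewrite gt_eqF.
Qed.

Record value_data (W dW : R -> R) : Prop := ValueData {
  vd_sg : supergrad W dW 0 1;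
  vd_upper : forall x, 0 <= x <= 1 -> ode_gap u mu W x <= dW x * (x - ps);
  vd_lip : lipschitz_on (fun x => dW x * (x - ps)) 0 1;
  vd_split : forall x, 0 <= x <= 1 -> splittable W dW x }.

Lemma algorithm_run :
  [/\ forall k, p_seq u ps mu k < 1 -> p_seq u ps mu k < p_seq u ps mu k.+1,
      forall k, 0 < pt_seq u ps mu k -> pt_seq u ps mu k.+1 < pt_seq u ps mu k,
      (exists k, p_seq u ps mu k = 1) /\ (exists k, pt_seq u ps mu k = 0) &
      exists dW, value_data (w_alg u ps mu) dW].
Proof.
have [c [m [maj [pt0 ptps psp p01] uptE upE wE]]] := init_data ps01 L_ge0 mu_gt0 uL.
set a0 := m * (mu / (1 + mu)) in wE.
have [dU0 invU0] : exists dW, up_inv u ps mu a0 (p_init u ps) (p_init u ps) (w_init u ps mu) dW.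
  apply: (up_inv_init mu_gt0 ps01 L_ge0 uL psp p01 _ upE).
  - by move=> q psq q1; apply: maj; rewrite q1 (le_trans ps_ge0).
  - by move=> q psq qp; apply: wE => //; exact: le_trans psq.
have [dD0 invD0] : exists dW, up_inv (mir u) (1 - ps) mu (- m * (mu / (1 + mu)))
    (1 - pt_init u ps) (1 - pt_init u ps) (mir (w_init u ps mu)) dW.
  apply: (@up_inv_init _ (mir u) (1 - ps) mu L mu_gt0 ps'01 L_ge0 mirL c (- m)).
  - lra.
  - lra.
  - move=> q psq q1; have q01 : 0 <= 1 - q <= 1 by move: ps1; lra.
    by rewrite /mir; have := maj _ q01; lra.
  - by rewrite /mir onemK uptE; ring.
  - move=> q psq qp; rewrite /mir wE; [rewrite /a0; ring|lra|lra].
have upI := run_inv mu_gt0 ps_ge0 L_ge0 uL ucs invU0 (erefl (up 0%N)) (@up_step_ok _ _) up_stop.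
have dnI := run_inv mu_gt0 ps'_ge0 L_ge0 mirL breakpoints_mir invD0 (erefl (dn 0%N))
  (@dn_step_ok _ _) dn_stop.
have [KU KUE] := run_terminates mu_gt0 ps_ge0 L_ge0 uL ucs invU0 (erefl (up 0%N))
  (@up_step_ok _ _) up_stop.
have [KD KDE] := run_terminates mu_gt0 ps'_ge0 L_ge0 mirL breakpoints_mir invD0
  (erefl (dn 0%N)) (@dn_step_ok _ _) dn_stop.
have upS := run_stable mu_gt0 ps_ge0 L_ge0 uL ucs invU0 (erefl (up 0%N)) (@up_step_ok _ _) up_stop.
have dnS := run_stable mu_gt0 ps'_ge0 L_ge0 mirL breakpoints_mir invD0 (erefl (dn 0%N))
  (@dn_step_ok _ _) dn_stop.
split.
- exact: (run_increasing mu_gt0 ps_ge0 L_ge0 uL ucs invU0 (erefl (up 0%N))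
    (@up_step_ok _ _) up_stop).
- move=> k pk; have := run_increasing mu_gt0 ps'_ge0 L_ge0 mirL breakpoints_mir invD0
    (erefl (dn 0%N)) (@dn_step_ok _ _) dn_stop (k := k).
  by rewrite /dn /= ltrD2l ltrN2; apply; move: pk; rewrite /pt_seq; lra.
- split; first by exists KU.
  by exists KD; move: KDE; rewrite /dn /pt_seq /=; lra.
have [dU invU] := upI KU; have [dD invD] := dnI KD.
rewrite KUE in invU; rewrite KDE in invD.
set WU := (up KU).2 in invU; set WD := (dn KD).2 in invD.
set W := w_alg u ps mu.
have WUE q : ps <= q -> q <= 1 -> W q = WU q.
  move=> psq q1; rewrite /W /w_alg psq.
  set k := xget _ _.
  have hk : q <= (up k).1.
    have : [set k | q <= p_seq u ps mu k] KU by rewrite /= /p_seq -/up KUE.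
    by rewrite /k; case: xgetP => [y -> //|/(_ KU)].
  have [kK|/ltnW Kk] := leqP k KU; first by rewrite /WU (upS k KU q).
  by rewrite -/up -/(up k) (upS KU k q)// KUE.
have WDE q : 0 <= q -> q < ps -> W q = WD (1 - q).
  move=> q0 qps; rewrite /W /w_alg leNgt qps /=.
  set k := xget _ _.
  have hk : (run_down u ps mu k).1 <= q.
    have : [set k | pt_seq u ps mu k <= q] KD.
      by move: KDE; rewrite /dn /= /pt_seq; lra.
    by rewrite /k; case: xgetP => [y -> //|/(_ KD)].
  have E j : (run_down u ps mu j).2 q = (dn j).2 (1 - q) by rewrite /dn /= /mir onemK.
  rewrite E; have [kK|/ltnW Kk] := leqP k KD.
    by rewrite /WD (dnS k KD)// /dn /=; lra.
  by rewrite (dnS KD k)// KDE; lra.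
have WUps : WU ps = c.
  rewrite /WU (upS 0%N KU ps)//=.
  by rewrite wE// subrr mulr0 addr0.
have WDps : WD (1 - ps) = c.
  rewrite /WD (dnS 0%N KD (1 - ps))//=; last by lra.
  by rewrite /mir onemK wE// subrr mulr0 addr0.
(* Both runs start from the height [c] at [ps], so the formula of the left half is valid at [ps]
   too. *)
have WD' q : 0 <= q -> q <= ps -> W q = WD (1 - q).
  move=> q0; rewrite le_eqVlt => /predU1P[->|]; last exact: WDE.
  by rewrite (WUE ps (lexx _) (ltW ps1)) WUps WDps.
pose dW q := if ps <= q then dU q else - dD (1 - q).
have dWU q : ps <= q -> dW q = dU q by rewrite /dW => ->.
have dWD q : q < ps -> dW q = - dD (1 - q) by rewrite /dW ltNge => /negbTE ->.
have KD' q : q <= ps -> dW q * (q - ps) = dD (1 - q) * (1 - q - (1 - ps)).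
  rewrite le_eqVlt => /predU1P[->|/dWD ->]; last by ring.
  by rewrite !subrr !mulr0.
have goodU q : ps <= q -> q <= 1 -> good u ps mu WU dU q -> good u ps mu W dW q.
  by move=> psq q1; rewrite /good /ode_gap WUE// dWU.
have goodD q : 1 - ps <= q -> q <= 1 -> good (mir u) (1 - ps) mu WD dD q ->
    good u ps mu W dW (1 - q).
  move=> psq q1; rewrite /good /ode_gap => h.
  rewrite WD'; [|lra|lra].
  by rewrite KD' ?onemK -?h//; lra.
have sgU := up_sg invU; have sgD := up_sg invD.
exists dW; split.
(* The slopes at [ps] are in the right order because the slope [a0] of the initial line separates
   them. *)
- apply: (@supergrad_glue _ W dW 0 ps 1) => //; first exact: ltW.
    exists (- dD (1 - ps)); split.
      rewrite dWU// (le_trans (up_ps invU))// lerNr.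
      by apply: (le_trans (up_ps invD)); rewrite mulNr.
    move=> x y /andP[x0 xps] /andP[y0 yps]; rewrite !WD'//.
    have hx : 1 - ps <= 1 - x <= 1 by lra.
    have hy : 1 - ps <= 1 - y <= 1 by lra.
    have := sgD _ _ hx hy.
    have -> : (if x < ps then dW x else - dD (1 - ps)) = - dD (1 - x).
      case: ifP => [/dWD //|/negbT]; rewrite -leNgt => psx.
      by congr (- dD (1 - _)); apply/eqP; rewrite eq_le psx.
    lra.
  apply: (supergrad_eq _ _ sgU) => x /andP[psx x1].
    by rewrite WUE.
  by rewrite dWU.
- move=> x /andP[x0 x1]; have [psx|xps] := leP ps x.
    rewrite /ode_gap WUE// dWU//; apply: (up_upper invU).
    by rewrite psx.
  rewrite (KD' x (ltW xps)) /ode_gap WDE//.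
  have hx : 1 - ps <= 1 - x <= 1 by lra.
  by have := up_upper invD hx; rewrite /ode_gap /mir onemK.
- apply: (@lipschitz_on_glue _ _ 0 ps 1) => //; first exact: ltW.
    have [C C0 hC] := up_lip invD; exists C => // x y /andP[x0 xps] /andP[y0 yps].
    rewrite !KD'//.
    have hx : 1 - ps <= 1 - x <= 1 by lra.
    have hy : 1 - ps <= 1 - y <= 1 by lra.
    apply: (le_trans (hC _ _ hx hy)).
    by have -> : 1 - x - (1 - y) = - (x - y) by [ring]; rewrite normrN.
  by apply: (lipschitz_on_eq _ (up_lip invU)) => x /andP[psx x1]; rewrite dWU.
have goodp0 : good u ps mu W dW (p_init u ps).
  by apply: goodU => //; exact: up_good0 invU.
have goodpt0 : good u ps mu W dW (pt_init u ps).
  by rewrite -[pt_init u ps]onemK; apply: goodD; [lra|lra|exact: up_good0 invD].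
(* The initial segment straddles [ps]: [W] is affine on all of it, and the splitting uses its two
   ends, one from each run. *)
have split_init x : pt_init u ps <= x -> x <= p_init u ps -> splittable W dW x.
  move=> ptx xp0.
  have Waff q : pt_init u ps <= q -> q <= p_init u ps -> W q = c + a0 * (q - ps).
    move=> ptq qp0; have [psq|qps] := leP ps q.
      rewrite WUE ?(le_trans qp0)// /WU (upS 0%N KU q)//=.
      exact: wE.
    have q0 : 0 <= q by exact: le_trans ptq.
    rewrite WDE// /WD (dnS 0%N KD (1 - q))//=; last by lra.
    by rewrite /mir onemK wE.
  have p0_01 : 0 <= p_init u ps <= 1 by rewrite p01 andbT; exact: le_trans psp.
  have pt0_01 : 0 <= pt_init u ps <= 1 by rewrite pt0/= (le_trans ptps)// ltW.
  have [pe|pn] := eqVneq (pt_init u ps) (p_init u ps).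
    have -> : x = p_init u ps by apply/eqP; rewrite eq_le xp0 -pe ptx.
    exact: splittable_good.
  have ptp0 : pt_init u ps < p_init u ps by rewrite lt_neqAle pn (le_trans ptx).
  apply: (splittable_chord pt0 ptp0 p01) => //; first by rewrite ptx.
  rewrite (Waff x)// (Waff (pt_init u ps) (lexx _) (ltW ptp0)).
  by rewrite (Waff (p_init u ps) (ltW ptp0) (lexx _)); ring.
move=> x /andP[x0 x1]; have [psx|xps] := leP ps x.
  have x01 : ps <= x <= 1 by rewrite psx.
  have [xp0|[gx|[y [z [psy yz z1 /andP[yx xz] [gy gz E]]]]]] := up_tame invU x01.
  - by apply: split_init => //; exact: le_trans psx.
  - by apply: splittable_good; [rewrite x0|exact: goodU].
  - have psz : ps <= z := le_trans psy (ltW yz).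
    have y1 : y <= 1 := le_trans (ltW yz) z1.
    apply: (splittable_chord (le_trans ps_ge0 psy) yz z1).
    + by rewrite yx.
    + exact: goodU.
    + exact: goodU.
    + by rewrite !WUE.
have x01 : 1 - ps <= 1 - x <= 1 by rewrite lerD2l lerN2 (ltW xps) gerBl.
have [xp0|[gx|[y [z [psy yz z1 /andP[yx xz] [gy gz E]]]]]] := up_tame invD x01.
- apply: split_init; last exact: le_trans (ltW xps) psp.
  by move: xp0; rewrite lerD2l lerN2.
- apply: splittable_good; first by rewrite x0.
  by rewrite -[x]onemK; case/andP: x01 => *; exact: goodD.
- have psz : 1 - ps <= z := le_trans psy (ltW yz).
  have y1 : y <= 1 := le_trans (ltW yz) z1.
  have zps : 1 - z <= ps by rewrite lerBlDr addrC -lerBlDr.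
  have yps : 1 - y <= ps by rewrite lerBlDr addrC -lerBlDr.
  have z0 : 0 <= 1 - z by rewrite subr_ge0.
  have yx' : 1 - z <= x <= 1 - y.
    by rewrite lerBlDr -lerBlDl xz lerBrDr -lerBrDl.
  apply: (splittable_chord z0 _ _ yx'); rewrite ?ltrD2l ?ltrN2 ?gerBl//.
  + exact: le_trans ps'_ge0 psy.
  + exact: goodD.
  + exact: goodD.
  + rewrite !WD' ?(ltW xps)// ?onemK ?subr_ge0//.
    by move: E; lra.
Qed.

End AlgorithmRun.

(** * Discounted values for short stages *)

Section Asymptotics.
Context {R : realType}.

Lemma one_sub_expRN_bounds (x : R) : 0 <= x ->
  x - x ^+ 2 <= 1 - expR (- x) <= x.
Proof.
move=> x0; apply/andP; split; last by have := expR_ge1Dx (- x); lra.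
have h := expR_ge1Dx x; have x1 : 0 < 1 + x by lra.
have h2 : expR (- x) <= (1 + x)^-1 by rewrite expRN lef_pV2 ?posrE ?expR_gt0.
suff : (1 + x)^-1 <= 1 - x + x ^+ 2 by move: h2; lra.
rewrite -(ler_pM2l x1) divff ?gt_eqF//.
have : 0 <= x ^+ 3 by exact: exprn_ge0.
by rewrite !exprS expr0; lra.
Qed.

Variables (r l1 l2 : R).
Hypotheses (r0 : 0 < r) (l10 : 0 < l1) (l20 : 0 < l2).
Let Lam := l1 + l2.
Let ps := l2 / Lam.
Let mu := r / Lam.
Let Lam0 : 0 < Lam. Proof. by rewrite addr_gt0. Qed.

Variables (u W dW : R -> R).
Hypothesis W_data : value_data u ps mu W dW.

Section Stage.
Variable h : R.
Hypothesis h01 : 0 < h.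
Hypothesis hLam : Lam * h <= 1.
Let delta := 1 - expR (- (r * h)).
Let pi1 := 1 - expR (- (l1 * h)).
Let pi2 := 1 - expR (- (l2 * h)).
Local Notation T := (next_belief pi1 pi2).
Let theta := Lam * h.

(** The Euler step of the drift towards [ps]; [hLam] makes it a convex combination, so it stays in
    [[0, 1]]. *)
Let flow x := (1 - theta) * x + theta * ps.

Let theta_ps : theta * ps = l2 * h.
Proof. by rewrite /theta /ps; field; rewrite gt_eqF. Qed.

Let theta_mu : theta * mu = r * h.
Proof. by rewrite /theta /mu; field; rewrite gt_eqF. Qed.

Let theta01 : 0 < theta <= 1.
Proof. by rewrite hLam andbT mulr_gt0. Qed.

Let ps01 : 0 <= ps <= 1.
Proof. by rewrite divr_ge0 ?(ltW l20) ?(ltW Lam0)//= ler_pdivrMr// mul1r lerDr ltW. Qed.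

Let flow01 x : 0 <= x <= 1 -> 0 <= flow x <= 1.
Proof.
move=> /andP[x0 x1]; move: theta01 ps01 => /andP[t0 t1] /andP[p0 p1].
have h1 : 0 <= (1 - theta) * x by apply: mulr_ge0; lra.
have h2 : 0 <= theta * ps by apply: mulr_ge0; lra.
have h3 : 0 <= (1 - theta) * (1 - x) by apply: mulr_ge0; lra.
have h4 : 0 <= theta * (1 - ps) by apply: mulr_ge0; lra.
by rewrite /flow; lra.
Qed.

Lemma next_belief_flow x : 0 <= x <= 1 ->
  `|T x - flow x| <= (l1 ^+ 2 + 2 * l2 ^+ 2) * h ^+ 2.
Proof.
move=> /andP[x0 x1].
have h0 := ltW h01.
have b1 : 0 <= l1 * h by apply: mulr_ge0 => //; exact: ltW.
have b2 : 0 <= l2 * h by apply: mulr_ge0 => //; exact: ltW.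
have /andP[e1 e1'] := one_sub_expRN_bounds b1.
have /andP[e2 e2'] := one_sub_expRN_bounds b2.
have -> : T x - flow x = (pi2 - l2 * h) * (1 - x) - (pi1 - l1 * h) * x.
  by rewrite /flow theta_ps /next_belief /theta /Lam; ring.
rewrite -/pi1 -/pi2 in e1 e1' e2 e2'.
have k1 : 0 <= (l2 * h - pi2) * (1 - x) by apply: mulr_ge0; lra.
have k2 : 0 <= (l1 * h - pi1) * x by apply: mulr_ge0; lra.
have k3 : (l2 * h - pi2) * (1 - x) <= (l2 * h) ^+ 2 * 1.
  by apply: ler_pM; lra.
have k4 : (l1 * h - pi1) * x <= (l1 * h) ^+ 2 * 1.
  by apply: ler_pM; lra.
have k5 : 0 <= (l2 * h) ^+ 2 by exact: sqr_ge0.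
by rewrite ler_norml; move: k3 k4 k5; rewrite !exprMn => k3 k4 k5; lra.
Qed.

Variables (C B D : R).
Hypotheses (C0 : 0 <= C) (B0 : 0 <= B).
Hypothesis K_lip : forall x y, 0 <= x <= 1 -> 0 <= y <= 1 ->
  `|dW x * (x - ps) - dW y * (y - ps)| <= C * `|x - y|.
Hypothesis W_lip : forall x y, 0 <= x <= 1 -> 0 <= y <= 1 -> `|W x - W y| <= B * `|x - y|.
Hypothesis D_bound : forall x, 0 <= x <= 1 -> `|u x - W x| <= D.

Let c1 := l1 ^+ 2 + 2 * l2 ^+ 2.
(** The terms come, in order, from [delta] against [r * h], from the true transition against [flow],
    and from evaluating the supergradient after the move instead of before it. *)
Let E := 2 * r ^+ 2 * D + B * c1 + (C + B) * Lam ^+ 2.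

Let c1_ge0 : 0 <= c1.
Proof. by rewrite /c1; apply: addr_ge0; [exact: sqr_ge0|apply: mulr_ge0 => //; exact: sqr_ge0]. Qed.

Let pi_01 l : 0 < l -> 0 <= 1 - expR (- (l * h)) <= 1.
Proof.
move=> l0; rewrite subr_ge0 gerBl expR_ge0 andbT.
by rewrite -expR0 ler_expR oppr_le0 ltW// mulr_gt0.
Qed.

Let delta01 : 0 < delta < 1.
Proof.
rewrite /delta subr_gt0 gtrBl expR_gt0 andbT.
by rewrite -expR0 ltr_expR oppr_lt0 mulr_gt0.
Qed.

Let jump x : 0 <= x <= 1 -> `|W (T x) - W (flow x)| <= B * c1 * h ^+ 2.
Proof.
move=> x01; have T01 : 0 <= T x <= 1 by apply: next_belief01 => //; exact: pi_01.
apply: (le_trans (W_lip T01 (flow01 x01))).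
by rewrite -mulrA ler_wpM2l//; exact: next_belief_flow.
Qed.

(** With [a] the difference [u x - W x] and [Delta] the increment of [W], the terms of first order
    cancel: [delta - r * h + delta * (r * h)] is of order [h ^+ 2]. *)
Let drift (a Delta e : R) : `|a| <= D -> Delta <= - (r * h) * a + e -> 0 <= e ->
  delta * a + (1 - delta) * Delta <= 2 * r ^+ 2 * D * h ^+ 2 + e.
Proof.
move=> aD hD e0.
have /andP[d0 d1] := delta01.
have rh : 0 <= r * h by apply: mulr_ge0; exact: ltW.
have /andP[dl du] := one_sub_expRN_bounds rh.
rewrite -/delta in dl du.
have k1 : (1 - delta) * Delta <= (1 - delta) * (- (r * h) * a + e).
  by apply: ler_wpM2l => //; lra.
have k2 : 0 <= delta * e by apply: mulr_ge0 => //; exact: ltW.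
have k3 : (delta - r * h + delta * (r * h)) * a <= 2 * (r * h) ^+ 2 * D.
  apply: (le_trans (ler_norm _)); rewrite normrM; apply: ler_pM => //.
  have m1 : 0 <= (r * h - delta) * (r * h) by apply: mulr_ge0; lra.
  have m2 : 0 <= delta * (r * h) by apply: mulr_ge0 => //; exact: ltW.
  by rewrite ler_norml; lra.
have -> : 2 * r ^+ 2 * D * h ^+ 2 = 2 * (r * h) ^+ 2 * D by ring.
lra.
Qed.

Lemma bellman_upper x : 0 <= x <= 1 ->
  delta * u x + (1 - delta) * W (T x) <= W x + E * h ^+ 2.
Proof.
move=> x01.
have k1 : W (flow x) <= W x + dW x * (flow x - x) := vd_sg W_data x01 (flow01 x01).
have k2 := vd_upper W_data x01.
have /andP[t0 t1] := theta01.
have k3 : theta * ode_gap u mu W x <= theta * (dW x * (x - ps)).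
  by apply: ler_wpM2l => //; exact: ltW.
have k3' : theta * ode_gap u mu W x = r * h * (u x - W x).
  by rewrite /ode_gap mulrA theta_mu.
have fE : flow x - x = - (theta * (x - ps)) by rewrite /flow; ring.
have := jump x01; rewrite ler_norml => /andP[_ k4].
have e0 : 0 <= B * c1 * h ^+ 2.
  by apply: mulr_ge0; [exact: mulr_ge0|exact: sqr_ge0].
have k5 : W (T x) - W x <= - (r * h) * (u x - W x) + B * c1 * h ^+ 2.
  move: k1; rewrite fE => k1; lra.
have k6 := drift (D_bound x01) k5 e0.
have k7 : 0 <= (C + B) * Lam ^+ 2 * h ^+ 2.
  by apply: mulr_ge0; [apply: mulr_ge0; [exact: addr_ge0|exact: sqr_ge0]|exact: sqr_ge0].
by rewrite /E; lra.
Qed.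

(** A lower bound on [W] after the move needs the supergradient at the new point [y]; the Lipschitz
    bound on its product with [y - ps] brings it back to [x], where equality holds. *)
Lemma bellman_lower x : 0 <= x <= 1 -> good u ps mu W dW x ->
  W x <= delta * u x + (1 - delta) * W (T x) + E * h ^+ 2.
Proof.
move=> x01 gx.
have y01 := flow01 x01; set y := flow x in y01.
have /andP[t0 t1] := theta01.
have xyE : x - y = theta * (x - ps) by rewrite /y /flow; ring.
have yE : y - ps = (1 - theta) * (x - ps) by rewrite /y /flow; ring.
have k1 : W x <= W y + dW y * (x - y) := vd_sg W_data y01 x01.
have xps : `|x - ps| <= 1.
  move: (x01) ps01 => /andP[? ?] /andP[? ?].
  by rewrite ler_norml; lra.
have xy : `|x - y| <= theta.
  by rewrite xyE normrM (gtr0_norm t0) ler_piMr// ltW.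
have k2 : dW y * (y - ps) <= dW x * (x - ps) + C * theta.
  have := K_lip y01 x01; rewrite ler_norml => /andP[_ k2].
  have k2' : C * `|y - x| <= C * theta by rewrite ler_wpM2l// distrC.
  lra.
have k3 : W x - W y <= B * theta.
  apply: (le_trans (ler_norm _)); apply: (le_trans (W_lip x01 y01)).
  by rewrite ler_wpM2l.
have k4 : (1 - theta) * (W x - W y) <= theta * (dW y * (y - ps)).
  (* [x - y] and [y - ps] are the parts [theta] and [1 - theta] of [x - ps]; cross-multiplying makes
     the product with [y - ps] appear without a division. *)
  have -> : theta * (dW y * (y - ps)) = (1 - theta) * (dW y * (x - y)).
    by rewrite xyE yE; ring.
  by apply: ler_wpM2l; lra.
have k5 : theta * (dW y * (y - ps)) <= theta * (dW x * (x - ps) + C * theta).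
  by apply: ler_wpM2l => //; exact: ltW.
have k6 : theta * (W x - W y) <= theta * (B * theta).
  by apply: ler_wpM2l => //; exact: ltW.
have k7 : theta * (dW x * (x - ps)) = r * h * (u x - W x).
  by rewrite -gx /ode_gap mulrA theta_mu.
have := jump x01; rewrite -/y ler_norml => /andP[k8 _].
have e0 : 0 <= B * c1 * h ^+ 2.
  by apply: mulr_ge0; [exact: mulr_ge0|exact: sqr_ge0].
have e1 : 0 <= (C + B) * Lam ^+ 2 * h ^+ 2.
  by apply: mulr_ge0; [apply: mulr_ge0; [exact: addr_ge0|exact: sqr_ge0]|exact: sqr_ge0].
have thE : theta * theta = Lam ^+ 2 * h ^+ 2 by rewrite /theta; ring.
have k9 : - (W (T x) - W x) <= - (r * h) * - (u x - W x) +
    (B * c1 * h ^+ 2 + (C + B) * Lam ^+ 2 * h ^+ 2).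
  have -> : (C + B) * Lam ^+ 2 * h ^+ 2 = C * (theta * theta) + B * (theta * theta).
    by rewrite thE; ring.
  lra.
have aD : `|- (u x - W x)| <= D by rewrite normrN; exact: D_bound.
have := drift aD k9 (addr_ge0 e0 e1).
by rewrite /E; lra.
Qed.

End Stage.

End Asymptotics.

Section Verification.
Context {R : realType} {A B : finType}.
Variables (g : state -> A -> B -> R) (r l1 l2 : R).
Hypotheses (hA : (0 < #|A|)%N) (hB : (0 < #|B|)%N).
Hypotheses (r0 : 0 < r) (l10 : 0 < l1) (l20 : 0 < l2).
Let u := nonrevealing_value g.
Let Lam := l1 + l2.
Let ps := l2 / Lam.
Let mu := r / Lam.
Let Lam0 : 0 < Lam. Proof. by rewrite addr_gt0. Qed.

Lemma lipschitz_on_bound (f : R -> R) : lipschitz_on f 0 1 ->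
  exists2 K, 0 <= K & forall x, 0 <= x <= 1 -> `|f x| <= K.
Proof.
move=> [C C0 hC]; exists (`|f 0| + C); first by rewrite addr_ge0.
move=> x x01; have o01 : 0 <= (0 : R) <= 1 by rewrite lexx ler01.
have -> : f x = f 0 + (f x - f 0) by ring.
rewrite (le_trans (ler_normD _ _))// lerD2l (le_trans (hC _ _ x01 o01))//.
by move: x01 => /andP[x0 x1]; rewrite subr0 ger0_norm// ler_piMr.
Qed.

Lemma stage_value_close (W dW : R -> R) e : value_data u ps mu W dW -> 0 < e ->
  exists2 h0, 0 < h0 & forall h p v, 0 < h -> h <= h0 -> 0 <= p <= 1 ->
    is_value g (1 - expR (- (r * h))) (1 - expR (- (l1 * h)))
      (1 - expR (- (l2 * h))) p v -> `|v - W p| <= 2 * e.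
Proof.
move=> hW e0; have sg := vd_sg hW.
have [B0 B00 W_lip] := supergrad_lipschitz sg ler01.
have [C C0 K_lip] := vd_lip hW.
have [Dw Dw0 W_bound] := lipschitz_on_bound (supergrad_lipschitz sg ler01).
have u_lip : lipschitz_on u 0 1.
  exists (2 * payoff_bound g) => [|x y _ _]; last exact: nonrevealing_value_lipschitz.
  by rewrite mulr_ge0// payoff_bound_ge0.
have [Du Du0 u_bound] := lipschitz_on_bound u_lip.
pose D := Du + Dw.
have D_bound x : 0 <= x <= 1 -> `|u x - W x| <= D.
  by move=> x01; rewrite (le_trans (ler_normB _ _))// lerD ?u_bound ?W_bound.
pose E := 2 * r ^+ 2 * D + B0 * (l1 ^+ 2 + 2 * l2 ^+ 2) + (C + B0) * Lam ^+ 2.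
have E0 : 0 <= E.
  have s1 := sqr_ge0 r; have s2 := sqr_ge0 l1; have s3 := sqr_ge0 l2.
  have D0 : 0 <= D by rewrite addr_ge0.
  apply: addr_ge0; last by apply: mulr_ge0; [exact: addr_ge0|exact: sqr_ge0].
  apply: addr_ge0; apply: mulr_ge0 => //; first by rewrite mulr_ge0.
  by rewrite addr_ge0// mulr_ge0.
pose M2 := (4 * payoff_bound g) ^+ 2.
have M20 : 0 <= M2 by exact: sqr_ge0.
(* Chosen so that the cost of revelation, [M2 / (4 * c)], is at most [e]. *)
pose c := M2 / (4 * e) + 1.
have c0 : 0 < c by rewrite ltr_wpDl// divr_ge0// mulr_ge0// ltW.
have cM : M2 / (4 * c) <= e.
  rewrite ler_pdivrMr ?mulr_gt0//.
  have -> : e * (4 * c) = M2 + 4 * e by rewrite /c; field; rewrite gt_eqF.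
  by rewrite lerDl mulr_ge0// ltW.
(* Collects the coefficients of all remaining terms of order [h], so that [h <= e / S] bounds them
   by [e]; the final 1 keeps [S] positive. *)
pose S := c * r + 2 * E / r + 2 * c * Lam + 1.
have cr0 : 0 <= c * r by rewrite mulr_ge0 ?ltW.
have Er0 : 0 <= 2 * E / r by rewrite divr_ge0 ?(ltW r0)// mulr_ge0.
have cL0 : 0 <= 2 * c * Lam by rewrite !mulr_ge0 ?(ltW c0) ?(ltW Lam0).
have S0 : 0 < S by rewrite /S; lra.
exists (Num.min (Lam^-1) (Num.min ((2 * r)^-1) (e / S))).
  by rewrite !lt_min !invr_gt0 Lam0 mulr_gt0// divr_gt0.
move=> h p v h0; rewrite !le_min => /andP[hL /andP[hr hS]] p01 hv.
have hLam : Lam * h <= 1 by rewrite mulrC -ler_pdivlMr// mul1r.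
have hr2 : r * h <= 2^-1.
  have := ler_wpM2l (ltW r0) hr.
  by rewrite invfM mulrCA divff ?gt_eqF// mulr1.
have hSe : h * S <= e by rewrite -ler_pdivlMr.
have rh : 0 < r * h by rewrite mulr_gt0.
set delta := 1 - expR (- (r * h)) in hv.
set pi1 := 1 - expR (- (l1 * h)) in hv.
set pi2 := 1 - expR (- (l2 * h)) in hv.
have /andP[dl du] := one_sub_expRN_bounds (ltW rh).
rewrite -/delta in dl du.
have dhalf : r * h / 2 <= delta.
  have : 0 <= (2^-1 - r * h) * (r * h) by apply: mulr_ge0; lra.
  by move: dl; lra.
have delta01 : 0 < delta < 1.
  by rewrite (lt_le_trans _ dhalf)/= ?divr_gt0// /delta gtrBl expR_gt0.
have /andP[d0 _] := delta01.
have pi_bnd l : 0 < l -> 0 <= 1 - expR (- (l * h)) <= 1 /\ 1 - expR (- (l * h)) <= l * h.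
  move=> l0; have lh : 0 <= l * h by rewrite mulr_ge0 ?ltW.
  have /andP[_ ->] := one_sub_expRN_bounds lh; split=> //.
  by rewrite subr_ge0 gerBl expR_ge0 andbT -expR0 ler_expR oppr_le0.
have [pi1_01 pi1h] := pi_bnd _ l10; have [pi2_01 pi2h] := pi_bnd _ l20.
rewrite -/pi1 -/pi2 in pi1_01 pi1h pi2_01 pi2h.
(* Here [r * h <= 1 / 2] is used, through [delta >= r * h / 2]: the accumulated error is of order
   [h]. *)
have Ed : E * h ^+ 2 / delta <= 2 * E / r * h.
  rewrite ler_pdivrMr//.
  have -> : E * h ^+ 2 = 2 * E / r * h * (r * h / 2) by field; rewrite gt_eqF.
  by apply: ler_wpM2l => //; apply: mulr_ge0 => //; exact: ltW.
have hcr : 0 <= h * (c * r) by apply: mulr_ge0 => //; exact: ltW.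
have hcL : 0 <= h * (2 * c * Lam) by apply: mulr_ge0 => //; exact: ltW.
have cd : c * delta <= c * (r * h) by rewrite ler_pM2l.
have cp : 2 * c * (pi1 + pi2) <= 2 * c * (Lam * h).
  apply: ler_wpM2l; first by rewrite mulr_ge0// ltW.
  by rewrite /Lam; lra.
have up := @stage_value_upper _ _ _ g delta pi1 pi2 p v hA hB delta01 pi1_01 pi2_01 p01 hv
  W dW Dw sg W_bound (E * h ^+ 2) c c0
  (bellman_upper r0 l10 l20 hW h0 hLam C0 B00 W_lip D_bound).
have low : W p - E * h ^+ 2 / delta - e <= v.
  apply: (stage_value_lower hA hB delta01 pi1_01 pi2_01 p01 hv sg W_bound e0) => x x01.
  have [y [z [al [al01 y01 z01 [gy gz] xE]]]] := vd_split hW x01.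
  exists y, z, al; split => //; split;
    apply: (bellman_lower r0 l10 l20 hW h0 hLam C0 B00 K_lip W_lip D_bound) => //.
move: up; rewrite -/M2 => up.
rewrite ler_norml; move: hSe; rewrite /S => hSe.
by lra.
Qed.

(** Taking [h = 1 / n] in the previous estimate, with the three thirds of [e] split between it (two)
    and the convergence at [p] (one). *)
Lemma limit_value_unique (W dW : R -> R) v p : value_data u ps mu W dW ->
  is_limit_value g r l1 l2 v -> 0 <= p <= 1 -> W p = v p.
Proof.
move=> hW [vn [hvn vn_cvg]] p01.
have vnp : vn n p @[n --> \oo] --> v p.
  have sub : [set p] `<=` `[0, 1]%classic by move=> _ ->; rewrite /= in_itv.
  have := @uniform_subset_cvg _ _ v _ _ (vn @ \oo) _ sub vn_cvg.
  by rewrite uniform_set1; apply.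
apply/eqP; rewrite -subr_eq0 -normr_le0; apply/ler_addgt0Pl => e e0.
have e30 : 0 < e / 3 by rewrite divr_gt0.
have [h0 h00 close] := stage_value_close hW e30.
have /cvgrPdist_le/(_ _ e30) vclose := vnp.
have [n [n0 nh vne]] : exists n, [/\ (0 < n)%N, n%:R^-1 <= h0 & `|v p - vn n p| <= e / 3].
  near \oo => n; exists n; split.
  - by near: n; exact: nbhs_infty_gt.
  - rewrite invf_ple ?posrE//.
      by near: n; exact: nbhs_infty_ger.
    by rewrite ltr0n; near: n; exact: nbhs_infty_gt.
  - by near: n.
have nR : 0 < (n%:R^-1 : R) by rewrite invr_gt0 ltr0n.
have := close n%:R^-1 p (vn n p) nR nh p01 (hvn n p n0 p01).
have -> : W p - v p = - (vn n p - W p) - (v p - vn n p) by ring.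
move=> h; rewrite addr0 (le_trans (ler_normB _ _))// normrN.
by move: h vne; lra.
Unshelve. all: by end_near. Qed.

End Verification.

Unset Implicit Arguments.

Theorem theorem3p3 (R : realType) (A B : finType)
  (hA : (0 < #|A|)%N) (hB : (0 < #|B|)%N)
  (g : state -> A -> B -> R) (r lambda1 lambda2 : R)
  (hr : 0 < r) (hlambda1 : 0 < lambda1) (hlambda2 : 0 < lambda2)
  (v : R -> R) (hv : is_limit_value g r lambda1 lambda2 v) :
  let u := nonrevealing_value g in
  let pstar := lambda2 / (lambda1 + lambda2) in
  let mu := r / (lambda1 + lambda2) in
  [/\ forall k : nat, p_seq u pstar mu k < 1 ->
        p_seq u pstar mu k < p_seq u pstar mu k.+1,
      forall k : nat, 0 < pt_seq u pstar mu k ->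
        pt_seq u pstar mu k.+1 < pt_seq u pstar mu k,
      (exists k : nat, p_seq u pstar mu k = 1) /\
        (exists k : nat, pt_seq u pstar mu k = 0) &
      forall p : R, 0 <= p <= 1 -> w_alg u pstar mu p = v p].
Proof.
move=> u pstar mu.
have Lam0 : 0 < lambda1 + lambda2 by rewrite addr_gt0.
have mu0 : 0 < mu by rewrite divr_gt0.
have ps01 : 0 < pstar < 1.
  by rewrite divr_gt0//= ltr_pdivrMr// mul1r ltrDr.
have L0 : 0 <= 2 * payoff_bound g by rewrite mulr_ge0// payoff_bound_ge0.
have uL := nonrevealing_value_lipschitz g hA hB.
have [s hs] := nonrevealing_value_rational g hA hB.
have [cs ucs] := rational_pieces (lipschitz_continuous uL) hs.
have [up down ends [dW hW]] := algorithm_run mu0 ps01 L0 uL ucs.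
split => // p p01.
exact: (limit_value_unique hA hB hr hlambda1 hlambda2 hW hv p01).
Qed.
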